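(* Let $\delta > 0$ and $K \ge 0$. There exist positive constants $C_0 = C_0(\delta, K)$, $\epsilon_0=\epsilon_0(\delta, K)$, $N_0 = N_0(\delta, K)$ (depending only on $\delta,K$) and $s_0 = s_0(\delta)$ (depending only on $\delta$) such that the following statements hold for all $\mathbf{v} \in S_\delta \cap \mathbb{Z}_{\ge N_0}^2$, $s \in [s_0, \epsilon_0 \|\mathbf{v}\|^{2/3}]$, $w > 0$ and $z < 1$. (a) If $w \le \zeta_{\mathbf{v}} + Ks^{1/2}\|\mathbf{v}\|^{-1/3}$ then $\mathbf{P}\{G^{w, \mathrm{hor}}_{\mathbf{v}}-G_{\mathbf{v}} \ge s\|\mathbf{v}\|^{1/3}\} \ge \exp\{-C_0 s^{3/2}\}$. (b) If $z \ge \zeta_{\mathbf{v}}-K s^{1/2}\|\mathbf{v}\|^{-1/3}$ then $\mathbf{P}\{G^{z, \mathrm{ver}}_{\mathbf{v}}-G_{\mathbf{v}} \ge s\|\mathbf{v}\|^{1/3}\} \ge \exp\{-C_0 s^{3/2}\}$.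
   Context: $\mathrm{Exp}(\lambda)$ is the exponential distribution with rate $\lambda$. For $w>0$ and $z<1$, let $\{\omega^{w,z}_{\mathbf{v}}:\mathbf{v}\in\mathbb{Z}_{\ge0}^2\}$ be independent weights with $\omega^{w,z}_{\mathbf{v}}=\omega_{\mathbf{v}}\sim\mathrm{Exp}(1)$ for $\mathbf{v}\in\mathbb{Z}_{>0}^2$ (bulk weights, the same for all $w,z$), $\omega^{w,z}_{(i,0)}\sim\mathrm{Exp}(w)$ for $i\in\mathbb{Z}_{>0}$, $\omega^{w,z}_{(0,j)}\sim\mathrm{Exp}(1-z)$ for $j\in\mathbb{Z}_{>0}$, and $\omega^{w,z}_{(0,0)}=0$. $\Pi_{\mathbf{u},\mathbf{v}}$ is the set of up-right lattice paths from $\mathbf{u}$ to $\mathbf{v}$ with steps $(1,0)$ and $(0,1)$, viewed as vertex sets including both endpoints. Put $G_{\mathbf{v}}=\max_{\pi\in\Pi_{(1,1),\mathbf{v}}}\sum_{\mathbf{p}\in\pi}\omega_{\mathbf{p}}$ (bulk LPP), $G^{w,\mathrm{hor}}_{\mathbf{v}}=\max_{\pi\in\Pi_{(1,0),\mathbf{v}}}\sum_{\mathbf{p}\in\pi}\omega^{w,z}_{\mathbf{p}}$ (which does not depend on $z$) and $G^{z,\mathrm{ver}}_{\mathbf{v}}=\max_{\pi\in\Pi_{(0,1),\mathbf{v}}}\sum_{\mathbf{p}\in\pi}\omega^{w,z}_{\mathbf{p}}$ (which does not depend on $w$), for $\mathbf{v}\in\mathbb{Z}_{>0}^2$; these are all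 coupled through the common bulk weights. For $\mathbf{x}=(x,y)\in\mathbb{R}_{>0}^2$, $\zeta_{\mathbf{x}}=\frac{\sqrt{x}}{\sqrt{x}+\sqrt{y}}$. $\|\cdot\|$ is the $L^1$ norm. $S_\delta = \{(x,y)\in\mathbb{R}_{>0}^2: x\ge \delta y,\ y\ge\delta x\}$, and $\mathbb{Z}_{\ge N}=\{n\in\mathbb{Z}: n\ge N\}$. *)

(* Defs.v *)
From HB Require Import structures.
From mathcomp Require Export all_boot all_order all_algebra.
From mathcomp Require Export all_classical all_reals all_analysis.

Set Implicit Arguments.
Unset Strict Implicit.
Unset Printing Implicit Defensive.

Export Order.TTheory GRing.Theory Num.Theory.
Export numFieldNormedType.Exports.

Open Scope classical_set_scope.
Open Scope ring_scope.

Definition mutually_independent (d : measure_display) (T : measurableType d)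
    (R : realType) (P : probability T R) (I : eqType)
    (X : I -> {RV P >-> R}) : Prop :=
  forall (s : seq I) (A : I -> set R), uniq s -> (forall i, measurable (A i)) ->
    P (\bigcap_(i in [set` s]) (X i @^-1` A i))
      = (\prod_(i <- s) P (X i @^-1` A i))%E.

Definition has_exponential_law (d : measure_display) (T : measurableType d)
    (R : realType) (P : probability T R) (X : {RV P >-> R}) (rate : R) : Prop :=
  forall A : set R, measurable A -> distribution P X A = exponential_prob rate A.

(* The bulk weights are shared by all parameters, the horizontal boundary
   depends only on w and the vertical one only on z. The values [bulk (i, j)]
   with [i = 0] or [j = 0], [hor w 0] and [ver z 0] are never used. *)
Definition boundary_weight (d : measure_display) (T : measurableType d)
    (R : realType) (P : probability T R)
    (bulk : nat * nat -> {RV P >-> R}) (hor ver : R -> nat -> {RV P >-> R})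
    (w z : R) (v : nat * nat) : {RV P >-> R} :=
  match v with
  | (0%N, 0%N) => (cst 0 : {mfun T >-> R})
  | (_.+1, 0%N) => hor w v.1
  | (0%N, _.+1) => ver z v.2
  | (_.+1, _.+1) => bulk v
  end.

(* Nothing is assumed on the joint law of the boundary weights for different
   values of the parameters. *)
Record coupled_weights (d : measure_display) (T : measurableType d)
    (R : realType) (P : probability T R) := CoupledWeights {
  bulk : nat * nat -> {RV P >-> R};
  hor : R -> nat -> {RV P >-> R};
  ver : R -> nat -> {RV P >-> R};
  bulk_law : forall i j : nat, (0 < i)%N -> (0 < j)%N ->
    has_exponential_law (bulk (i, j)) 1;
  hor_law : forall (w : R) (i : nat), 0 < w -> (0 < i)%N ->
    has_exponential_law (hor w i) w;
  ver_law : forall (z : R) (j : nat), z < 1 -> (0 < j)%N ->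
    has_exponential_law (ver z j) (1 - z);
  weight_independence : forall w z : R, 0 < w -> z < 1 ->
    mutually_independent (boundary_weight bulk hor ver w z)
}.

Definition weight (d : measure_display) (T : measurableType d)
    (R : realType) (P : probability T R) (W : coupled_weights P) (w z : R) :
    nat * nat -> {RV P >-> R} :=
  boundary_weight (bulk W) (hor W) (ver W) w z.

Definition lattice_step : rel (nat * nat) :=
  fun p q => (q == (p.1.+1, p.2)) || (q == (p.1, p.2.+1)).

(* A path is the sequence of its vertices, endpoints included. *)
Definition up_right_path (u v : nat * nat) : set (seq (nat * nat)) :=
  [set pi | exists p, [/\ pi = u :: p, path lattice_step u p & last u p = v]].

(* For u <= v this is a supremum over a finite nonempty set, that is, a
   maximum: see [lpp_attained] and [lpp_ub]. *)
Definition lpp (R : realType) (omega : nat * nat -> R) (u v : nat * nat) : R :=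
  sup [set \sum_(p <- pi) omega p | pi in up_right_path u v].

Definition G (d : measure_display) (T : measurableType d)
    (R : realType) (P : probability T R) (W : coupled_weights P)
    (v : nat * nat) (t : T) : R :=
  lpp (fun p => bulk W p t) (1%N, 1%N) v.

(* Independent of z: see [Ghor_indep]. *)
Definition Ghor (d : measure_display) (T : measurableType d)
    (R : realType) (P : probability T R) (W : coupled_weights P)
    (w z : R) (v : nat * nat) (t : T) : R :=
  lpp (fun p => weight W w z p t) (1%N, 0%N) v.

(* Independent of w: see [Gver_indep]. *)
Definition Gver (d : measure_display) (T : measurableType d)
    (R : realType) (P : probability T R) (W : coupled_weights P)
    (w z : R) (v : nat * nat) (t : T) : R :=
  lpp (fun p => weight W w z p t) (0%N, 1%N) v.

Definition zeta (R : realType) (x : R * R) : R :=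
  Num.sqrt x.1 / (Num.sqrt x.1 + Num.sqrt x.2).

Definition cone (R : realType) (delta : R) : set (R * R) :=
  [set x | [/\ 0 < x.1, 0 < x.2, delta * x.2 <= x.1 & delta * x.1 <= x.2]].

Definition l1norm (R : realType) (x : R * R) : R := `|x.1| + `|x.2|.

Definition toR2 (R : realType) (v : nat * nat) : R * R := (v.1%:R, v.2%:R).

Lemma path_ge (u : nat * nat) p q : path lattice_step u p -> q \in u :: p ->
  (u.1 <= q.1)%N && (u.2 <= q.2)%N.
Proof.
elim: p u => [|a p IH] u /=; first by rewrite inE => _ /eqP ->; rewrite !leqnn.
move=> /andP[ua pa]; rewrite inE => /orP[/eqP ->|qa]; first by rewrite !leqnn.
have /andP[h1 h2] := IH _ pa qa.
by case/orP: ua h1 h2 => /eqP -> /= h1 h2; apply/andP; split=> //; exact: ltnW.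
Qed.

Lemma path_size (u : nat * nat) p : path lattice_step u p ->
  ((last u p).1 + (last u p).2 = u.1 + u.2 + size p)%N.
Proof.
elim: p u => [|a p IH] u /=; first by rewrite addn0.
move=> /andP[ua pa]; rewrite (IH _ pa).
by case/orP: ua => /eqP -> /=; rewrite ?addnS ?addSn.
Qed.

Lemma path_last_ge (u : nat * nat) p q : path lattice_step u p ->
  q \in u :: p -> (q.1 <= (last u p).1)%N && (q.2 <= (last u p).2)%N.
Proof.
elim: p u => [|a p IH] u; first by rewrite inE => _ /eqP -> /=; rewrite !leqnn.
move=> up; have /andP[_ pa] := up.
rewrite inE => /orP[/eqP ->|]; last exact: IH.
by apply: (path_ge up); rewrite mem_last.
Qed.

Lemma finite_up_right_path u v : finite_set (up_right_path u v).
Proof.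
pose n := (v.1 + v.2).+1.
pose f (t : {ffun 'I_n -> 'I_n * 'I_n} * 'I_n.+1) :=
  take t.2 [seq (nat_of_ord (t.1 i).1, nat_of_ord (t.1 i).2) | i <- enum 'I_n].
apply: (@sub_finite_set _ _ (f @` [set: _])); last first.
  by apply: finite_image; exact: finite_finset.
move=> _ [p [-> up ev]].
have sz : (size (u :: p) <= n)%N.
  by have := path_size up; rewrite ev /n /= ltnS => ->; rewrite leq_addl.
have bd q : q \in u :: p -> (q.1 < n)%N /\ (q.2 < n)%N.
  move=> /(path_last_ge up); rewrite ev /n => /andP[h1 h2].
  by rewrite !ltnS (leq_trans h1) ?leq_addr ?(leq_trans h2) ?leq_addl.
have szS : (size (u :: p) < n.+1)%N by rewrite ltnS.
exists ([ffun i : 'I_n => (inord (nth u (u :: p) i).1, inord (nth u (u :: p) i).2)],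
  Ordinal szS) => //.
rewrite /f /=; set M := map _ _.
have sM : size (take (size p).+1 M) = (size p).+1.
  by rewrite size_takel // /M size_map size_enum_ord.
apply: (@eq_from_nth _ u); rewrite sM // => i hi'.
have hin : (i < n)%N by exact: leq_trans hi' sz.
rewrite nth_take // /M (nth_map (Ordinal hin)) ?size_enum_ord // ffunE /=.
rewrite nth_enum_ord //.
have [] := bd (nth u (u :: p) i); first by rewrite mem_nth.
by move=> h1 h2; rewrite !inordK //; case: (nth _ _ _).
Qed.

Lemma up_right_path_nonempty u v : (u.1 <= v.1)%N -> (u.2 <= v.2)%N ->
  up_right_path u v !=set0.
Proof.
have ext v1 v2 : up_right_path u v1 !=set0 -> lattice_step v1 v2 ->
    up_right_path u v2 !=set0.
  move=> [pi [p [_ pp lp]]] st.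
  exists (u :: rcons p v2), (rcons p v2); split=> //; last by rewrite last_rcons.
  by rewrite rcons_path pp lp st.
case: u v ext => [a b] [x y] ext /= /subnKC <- /subnKC <-.
elim: (x - a)%N => [|m IHm].
  rewrite addn0; elim: (y - b)%N => [|n IHn].
    by rewrite addn0; exists [:: (a, b)], [::].
  by apply: ext IHn _; rewrite /lattice_step /= addnS eqxx orbT.
by apply: ext IHm _; rewrite /lattice_step /= addnS eqxx.
Qed.

Lemma lpp_ub (R : realType) (omega : nat * nat -> R) u v pi :
  up_right_path u v pi -> \sum_(p <- pi) omega p <= lpp omega u v.
Proof.
move=> h; apply: ub_le_sup; last by exists pi.
have /finite_seqP[X XE] : finite_set
    [set \sum_(p <- pi) omega p | pi in up_right_path u v].
  exact/finite_image/finite_up_right_path.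
exists (\sum_(r <- X) `|r|) => r.
rewrite XE /= => rX.
by rewrite (big_rem r) //= (le_trans (ler_norm r)) // lerDl sumr_ge0.
Qed.

Lemma lpp_attained (R : realType) (omega : nat * nat -> R) u v :
  (u.1 <= v.1)%N -> (u.2 <= v.2)%N ->
  exists2 pi, up_right_path u v pi & lpp omega u v = \sum_(p <- pi) omega p.
Proof.
move=> u1 u2; pose S := [set \sum_(p <- pi) omega p | pi in up_right_path u v].
have fS : finite_set S by exact/finite_image/finite_up_right_path.
have [pi0 pi0P] := up_right_path_nonempty u1 u2.
have [X XE] := (iffLR (finite_seqP _)) fS.
pose r0 := \sum_(p <- pi0) omega p.
have r0S : S r0 by exists pi0.
pose m := \big[Num.max/r0]_(r <- X) r.
have mS : S m.
  rewrite /m big_seq; apply: big_ind => //.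
    by move=> x y xS yS; rewrite /Num.max; case: ifP.
  by move=> r rX; rewrite XE.
have -> : lpp omega u v = m.
  apply/eqP; rewrite eq_le; apply/andP; split.
    apply: ge_sup; first by exists r0.
    move=> r; rewrite -/S XE /= => rX.
    by rewrite /m; apply: le_bigmax_seq.
  by have [pi piP <-] := mS; apply: lpp_ub.
by have [pi piP <-] := mS; exists pi.
Qed.

Lemma eq_lpp (R : realType) (omega omega' : nat * nat -> R) u v :
  (forall p, (u.1 <= p.1)%N -> (u.2 <= p.2)%N -> omega p = omega' p) ->
  lpp omega u v = lpp omega' u v.
Proof.
move=> h; rewrite /lpp; congr sup; apply: eq_imagel => _ [p [-> up _]].
rewrite big_seq [RHS]big_seq; apply: eq_bigr => q /(path_ge up)/andP[h1 h2].
exact: h.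
Qed.

Lemma Ghor_indep (d : measure_display) (T : measurableType d)
    (R : realType) (P : probability T R) (W : coupled_weights P)
    (w z z' : R) v t : Ghor W w z v t = Ghor W w z' v t.
Proof. by apply: eq_lpp => -[[|i] [|j]]. Qed.

Lemma Gver_indep (d : measure_display) (T : measurableType d)
    (R : realType) (P : probability T R) (W : coupled_weights P)
    (w w' z : R) v t : Gver W w z v t = Gver W w' z v t.
Proof. by apply: eq_lpp => -[[|i] [|j]]. Qed.

(* Main.v *)
From HB Require Import structures.
Require Import Defs.
From mathcomp Require Import measurable_realfun ring lra zify.
Import HBNNSimple.

Set Implicit Arguments.
Unset Strict Implicit.
Unset Printing Implicit Defensive.

(** The path that follows the horizontal axis from (1, 0) to (k + 1, 0), steps
    up and then follows a bulk geodesic from (k + 1, 1) to v gives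
    Ghor_v - G_v >= S - D, where S is the sum of k + 1 independent boundary
    weights of rate w and D = G_v - G_{(k + 1, 1), v} is a bulk increment
    independent of S. Write N for the norm of v, h = s^(1/2) N^(-1/3) and
    L = h^3 N = s^(3/2), so that the target s N^(1/3) is h^2 N, and take k of
    order h N. It suffices to bound D from above at its typical size, with
    probability at least 1/2, and to force S to exceed that size.

    The sum S. A variable Exp(w) with w <= zeta + K h has mean at least
    1 / (zeta + K h), so S has to exceed k / rho, where rho = zeta - a h, by a
    multiple of h^2 N. This is a relative deviation of order h in a sum of
    order h N exponential variables; it costs exp (- O(h^2 * h N)) =
    exp (- O(L)). The cost is bounded below by applying the Paley-Zygmund
    inequality to exp (t S) with t of order h (paley_zygmund,
    hor_increment_lower, tilted_sum_large, tilt_cost).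

    The increment D. The claim is that D <= k / rho + O(h^2 N) with
    probability at least 1/2 (bulk_increment_tail, bulk_tail_small). After a
    half-turn of the bulk, D is the difference of two passage times from
    (1, 1), to the image v of (1, 1) and to the image u of (k + 1, 1). Adding
    a row of boundary weights below the bulk increases horizontal increments
    (lpp_diff_compare), hence D <= Ghor_v - Ghor_u for boundary weights of
    rate rho. Both terms are compared with the model with weights Exp(w) and
    Exp(1 - z) on the two axes, whose passage time from the origin has an
    explicit exponential moment (lpp_mgf),
      E exp ((w - z) G_(m, n)) = (w / z)^m ((1 - z) / (1 - w))^n.
    It gives the upper bound for Ghor_v by Chernoff's inequality, taken with
    z = rho - h. For the lower bound on Ghor_u, the stationary passage time
    to u, with w = z = rho, is the maximum of Ghor_u and Gver_u. It falls
    short of its mean M by h^2 N only with small probability, since the mean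
    of (M - G)^+ is at most that of (G - M)^+ (lpp_mean_ge), which exponential
    moments control. Moreover Gver_u falls short of M: the parameter rho lies
    below the characteristic value zeta by a h, where a is a large constant,
    so geodesics tend to leave the origin horizontally, and the exponential
    moment with w = rho + h bounds Gver_u away from M.

    The exponential moment and the mean both come from the Burke property
    (top_row_indep): when w = z = rho the increments of the passage time along
    the top side are independent Exp(rho). Its proof sweeps the rectangle one
    cell at a time and rests on a fact on three independent variables
    U of law Exp(r), V of law Exp(1 - r) and W of law Exp(1): the variables
    W + (U - V)^+ and W + (V - U)^+ are independent of laws Exp(r) and
    Exp(1 - r) (corner_flip). Unequal w and z are reduced to equal ones by
    an exponential change of measure on the left side, which turns the rate
    1 - z into 1 - w. For this reason the theory is developed for finite
    measures of arbitrary mass.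

    The vertical statement is the horizontal one for the weights transposed
    in the diagonal (transposed). *)

(** * Measures with a density and the exponential law *)

Lemma measurable_preimage d (T : measurableType d) d' (T' : measurableType d')
    (f : T -> T') (A : set T') : measurable_fun setT f -> measurable A ->
  measurable (f @^-1` A).
Proof. by move=> mf mA; rewrite -[X in measurable X]setTI; exact: mf. Qed.

Section density.
Context d (T : measurableType d) (R : realType).
Implicit Types Q : {measure set T -> \bar R}.
Local Open Scope ereal_scope.

(** Countable additivity is monotone convergence. The exponential laws and
    their exponential tilts are both of this form. *)
Lemma density_measure Q (y : T -> R) :
  measurable_fun setT y -> (forall t, 0 <= y t)%R ->
  exists Q' : {measure set T -> \bar R},
    forall A, Q' A = \int[Q]_(t in A) (y t)%:E.
Proof.
move=> my y0.
pose m (A : set T) := \int[Q]_(t in A) (y t)%:E.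
have m0 : m set0 = 0 by rewrite /m integral_set0.
have mge0 A : 0 <= m A by apply: integral_ge0 => t _; rewrite lee_fin.
have madd : semi_sigma_additive m.
  apply: (@semi_sigma_additive_nng_induced _ _ _ Q (EFin \o y)) => //.
  exact/measurable_EFinP.
pose mM := isMeasure.Build _ _ _ m m0 mge0 madd.
pose Q' : {measure set T -> \bar R} := HB.pack m mM.
by exists Q'.
Qed.

(** Approximation of f by simple functions. The measure is only required to
    have the stated density on measurable sets, so that the lemma applies
    equally to an exponential law, to a tilt and to a restriction, whose
    density is an indicator. *)
Lemma ge0_integral_density Q (Q' : {measure set T -> \bar R}) (y : T -> R)
    (f : T -> \bar R) :
  measurable_fun setT y -> (forall t, 0 <= y t)%R ->
  (forall A, measurable A -> Q' A = \int[Q]_(t in A) (y t)%:E) ->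
  measurable_fun setT f -> (forall t, 0 <= f t) ->
  \int[Q']_t f t = \int[Q]_t (f t * (y t)%:E).
Proof.
move=> my y0 Q'E mf f0; pose g := EFin \o y.
have mg : measurable_fun setT g by exact/measurable_EFinP.
have g0 t : 0 <= g t by rewrite lee_fin.
pose h := nnsfun_approx measurableT mf.
have fE x : f x = lim ((EFin \o h n) x @[n --> \oo]).
  by apply/esym/cvg_lim => //; exact: cvg_nnsfun_approx.
have -> : \int[Q']_x f x = lim (\int[Q']_x (EFin \o h n) x @[n --> \oo]).
  under eq_integral => x _ do rewrite fE.
  apply: monotone_convergence => //.
  - by move=> n; exact/measurable_EFinP.
  - by move=> n x _ //=; rewrite lee_fin.
  - by move=> x _ a b ab; rewrite lee_fin; exact/lefP/nd_nnsfun_approx.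
have -> : \int[Q]_x (f x * g x) =
    lim (\int[Q]_x ((EFin \o h n) \* g) x @[n --> \oo]).
  have fg x : f x * g x = lim (((EFin \o h n) \* g) x @[n --> \oo]).
    by apply/esym/cvg_lim => //; apply: cvgeZr => //; exact: cvg_nnsfun_approx.
  under eq_integral => x _ do rewrite fg.
  apply: monotone_convergence => [//| | |].
  - by move=> n; apply: emeasurable_funM => //; exact/measurable_EFinP.
  - by move=> n x _ /=; rewrite mule_ge0 ?lee_fin.
  - by move=> x _ a b ab/=; rewrite lee_wpmul2r ?lee_fin//; exact/lefP/nd_nnsfun_approx.
suff suf n : \int[Q']_x (EFin \o h n) x = \int[Q]_x ((EFin \o h n) x * g x).
  by under eq_fun do rewrite suf.
transitivity (\int[Q']_x
   (\sum_(z \in range (h n)) (z * \1_(h n @^-1` [set z]) x)%:E)).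
  by apply: eq_integral => t tE; rewrite /= fimfunE -fsumEFin.
have indich m r : measurable_fun setT (fun x => (r * \1_(h m @^-1` [set r]) x)%:E).
  by apply: (measurable_comp measurableT) => //; exact: measurable_funM.
rewrite ge0_integral_fsum//; last by move=> m z Ez; exact: nnfun_muleindic_ge0.
transitivity (\int[Q]_x (\sum_(z \in range (h n))
    (z * \1_(h n @^-1` [set z]) x)%:E * g x)); last first.
  under eq_integral => x xE.
    rewrite -ge0_mule_fsuml => [|z]; last exact: nnfun_muleindic_ge0.
    rewrite fsumEFin // -(fimfunE _ x); over.
  by [].
rewrite ge0_integral_fsum//; last 2 first.
  - by move=> z; apply: emeasurable_funM.
  - by move=> m z Ez; rewrite mule_ge0 ?nnfun_muleindic_ge0.
apply: eq_fsbigr => r rhn.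
under eq_integral do rewrite EFinM.
rewrite integralZl_indic_nnsfun => //.
under [RHS]eq_integral do rewrite EFinM -muleA.
rewrite ge0_integralZl//.
- under [in RHS]eq_integral do rewrite muleC.
  rewrite [in RHS](eq_integral (g \_ (h n @^-1` [set r]))); last first.
    by move=> x xE; rewrite epatch_indic.
  by rewrite -integral_mkcond -Q'E// integral_indic// setIT.
- by apply: emeasurable_funM => //; exact/measurable_EFinP.
- by move=> t Et; rewrite mule_ge0 ?lee_fin.
- by move: rhn; rewrite inE => -[t _ <-]; rewrite lee_fin.
Qed.

(** Exponential variables are positive only almost surely; identities between
    events that use positivity hold up to a null set. *)
Lemma eq_measure_off_null Q (A B N : set T) :
  measurable A -> measurable B -> measurable N -> Q N = 0 ->
  A `<=` B `|` N -> B `<=` A `|` N -> Q A = Q B.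
Proof.
move=> mA mB mN QN AB BA; apply/eqP; rewrite eq_le; apply/andP; split.
  rewrite (le_trans (_ : _ <= Q (B `|` N)))//.
    by rewrite le_measure ?inE//; exact: measurableU.
  by apply: (le_trans (measureU2 _ mB mN)); rewrite [X in _ + X]QN adde0.
rewrite (le_trans (_ : _ <= Q (A `|` N)))//.
  by rewrite le_measure ?inE//; exact: measurableU.
by apply: (le_trans (measureU2 _ mA mN)); rewrite [X in _ + X]QN adde0.
Qed.

End density.

Section exponential_law.
Context (R : realType).
Local Open Scope ereal_scope.
Notation mu := (@lebesgue_measure R).

(** Bundles the set function [exponential_prob] as a measure, so that
    additivity and monotonicity become available for it. *)
Lemma expo_measure (r : R) : (0 < r)%R ->
  exists m : {measure set (measurableTypeR R) -> \bar R}, forall A, m A = exponential_prob r A.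
Proof.
move=> r0.
have pdf0 t : (0 <= exponential_pdf r t)%R by apply: exponential_pdf_ge0; exact: ltW.
have [m mE] := density_measure mu (measurable_exponential_pdf r) pdf0.
by exists m.
Qed.

Lemma expo_setT (r : R) : (0 < r)%R -> exponential_prob r [set: R] = 1.
Proof. exact: integral_exponential_pdf. Qed.

Lemma expo_ge0 (r : R) (A : set R) : (0 < r)%R -> 0 <= exponential_prob r A.
Proof. by move=> r0; have [m mE] := expo_measure r0; rewrite -mE. Qed.

Lemma expo_fin_num (r : R) (A : set R) : (0 < r)%R -> measurable A ->
  exponential_prob r A \is a fin_num.
Proof.
move=> r0 mA; have [m mE] := expo_measure r0.
rewrite ge0_fin_numE -?mE//.
have : m A <= m setT by rewrite le_measure ?inE.
by move=> /le_lt_trans; apply; rewrite mE expo_setT// ltry.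
Qed.

Lemma expo_fine (r : R) (A : set R) : (0 < r)%R -> measurable A ->
  exists2 e : R, (0 <= e)%R & exponential_prob r A = e%:E.
Proof.
move=> r0 mA; exists (fine (exponential_prob r A)).
  by rewrite fine_ge0// expo_ge0.
by rewrite fineK// expo_fin_num.
Qed.

Lemma expo_tail (r a : R) : (0 < r)%R -> (0 <= a)%R ->
  exponential_prob r `]a, +oo[%classic = (expR (- r * a))%:E.
Proof.
move=> r0 a0; rewrite /exponential_prob.
rewrite integral_itv_obnd_cbnd; last first.
  by apply: measurable_funTS; apply/measurable_EFinP; exact: measurable_exponential_pdf.
rewrite (@ge0_continuous_FTC2y _ _ (fun x => - (expR (- r * x)))%R _ 0%R)//.
- by rewrite EFinN oppeK add0e.
- by move=> x _; apply: exponential_pdf_ge0; exact: ltW.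
- apply: (@continuous_subspaceW R^o _ _ [set` `[0%R, +oo[%R]).
    by apply: subset_itvr; rewrite bnd_simp.
  exact: within_continuous_exponential_pdf.
- rewrite -oppr0; apply: cvgN.
  rewrite (_ : (fun x => expR (- r * x)) =
               (fun z => expR (- z)) \o (fun z => r * z))%R; last first.
    by apply: eq_fun => x; rewrite mulNr.
  apply: (@cvg_comp _ _ _ _ _ _ (pinfty_nbhs R)); last exact: cvgr_expR.
  exact: gt0_cvgMry.
- apply: cvgN; apply/cvg_at_right_filter.
  apply: continuous_comp; last exact: continuous_expR.
  by apply: continuousM => //; apply: (@continuousN _ R^o); exact: cst_continuous.
- move=> x; rewrite in_itv/= andbT => ax; apply: derive1_exponential_pdf.
  by rewrite in_itv/= andbT (le_lt_trans a0).
Qed.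

(** The density of rate r multiplied by exp (l x) is r / (r - l) times the
    density of rate r - l: an exponential tilt only changes the rate and the
    total mass. *)
Lemma expo_tilt (r l : R) (A : set R) : (0 < r)%R -> (l < r)%R -> measurable A ->
  forall m : {measure set (measurableTypeR R) -> \bar R},
    (forall B, measurable B -> m B = exponential_prob r B) ->
  \int[m]_(x in A) (expR (l * x))%:E =
  (r / (r - l))%:E * exponential_prob (r - l) A.
Proof.
move=> r0 lr mA m mE.
have mpdf s : measurable_fun [set: R] (exponential_pdf s).
  exact: measurable_exponential_pdf.
have mexp : measurable_fun [set: R] (fun x => expR (l * x)).
  by apply: measurableT_comp => //; exact: measurable_funM.
have rl0 : (0 < r - l)%R by rewrite subr_gt0.
have aux (y : R) : (l * y + - r * y = - (r - l) * y)%R by ring.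
rewrite integral_mkcond.
rewrite (@ge0_integral_density _ _ _ mu m (exponential_pdf r)) //; last 3 first.
- by move=> t; apply: exponential_pdf_ge0; exact: ltW.
- apply/(measurable_restrictT _ _).1 => //.
  by apply: measurable_funTS; exact/measurable_EFinP.
- by move=> t; rewrite patchE; case: ifP => // _; rewrite lee_fin expR_ge0.
rewrite /exponential_prob [in RHS]integral_mkcond.
rewrite -ge0_integralZl//.
- apply: eq_integral => x _; rewrite !patchE; case: ifP => _; last first.
    by rewrite mul0e mule0.
  rewrite -!EFinM /exponential_pdf !patchE; case: ifP => _; last by rewrite !mulr0.
  congr (_%:E).
  rewrite [LHS]mulrCA -expRD [RHS]mulrA divfK ?gt_eqF//.
  by congr (_ * expR _)%R; exact: aux.
- apply/(measurable_restrictT _ _).1 => //.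
  by apply: measurable_funTS; apply/measurable_EFinP; exact: mpdf.
- move=> x _; rewrite patchE; case: ifP => // _.
  by rewrite lee_fin; apply: exponential_pdf_ge0; exact: ltW.
- by rewrite lee_fin divr_ge0// ltW.
- exact: mpdf.
Qed.

Lemma expo_tilt_scaled (q r l : R) (A : set R) :
  (0 <= q)%R -> (0 < r)%R -> (l < r)%R -> measurable A ->
  forall m : {measure set (measurableTypeR R) -> \bar R},
    (forall B, measurable B -> m B = q%:E * exponential_prob r B) ->
  \int[m]_(x in A) (expR (l * x))%:E =
  q%:E * ((r / (r - l))%:E * exponential_prob (r - l) A).
Proof.
move=> q0 r0 lr mA m mE; have [m0 m0E] := expo_measure r0.
rewrite -(expo_tilt r0 lr mA (fun B _ => m0E B)).
rewrite (eq_measure_integral (mscale (NngNum q0) m0)); last first.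
  by move=> B mB _; rewrite mE// -m0E.
rewrite ge0_integral_mscale//.
apply/measurable_EFinP/measurable_funTS.
by apply: measurableT_comp => //; exact: measurable_funM.
Qed.

Lemma expo_ray (r a : R) : (0 < r)%R ->
  exponential_prob r `]a, +oo[%classic = (expR (- r * Num.max a 0))%:E.
Proof.
move=> r0; have [a0|a0] := leP 0%R a; first exact: expo_tail.
have [m mE] := expo_measure r0.
rewrite mulr0 expR0; apply/eqP; rewrite eq_le; apply/andP; split.
  by rewrite -(expo_setT r0) -!mE le_measure ?inE.
have <- : exponential_prob r `]0%R, +oo[%classic = 1.
  by rewrite expo_tail// mulr0 expR0.
rewrite -!mE le_measure ?inE//.
by apply: subset_itvr; rewrite bnd_simp ltW.
Qed.

Lemma expo_nonpos (r : R) : (0 < r)%R ->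
  exponential_prob r (`]-oo, 0%R]%classic : set R) = 0.
Proof.
move=> r0; have [m mE] := expo_measure r0.
have : m (`]-oo, 0%R]%classic) + m (`]0%R, +oo[%classic) = 1.
  rewrite -measureU//; last first.
    by apply/seteqP; split => x //=; rewrite !in_itv/= andbT leNgt => -[/negP].
  rewrite -(expo_setT r0) -mE; congr (m _).
  by apply/seteqP; split => // x _ /=; rewrite !in_itv/= andbT; case: leP; [left|right].
rewrite !mE expo_tail// mulr0 expR0 => h.
by rewrite -[LHS](@addeK _ 1)// h subee.
Qed.

End exponential_law.

(** * Joint laws of independent variables *)

Local Open Scope ereal_scope.

(** Product measures are defined for bundled finite measures, whereas the
    marginal laws below are only known to have finite mass. *)
Lemma finite_measure_pack d (T : measurableType d) (R : realType)
    (m : {measure set T -> \bar R}) : m setT < +oo ->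
  exists m' : {finite_measure set T -> \bar R}, forall A, m' A = m A.
Proof.
move=> moo.
exists (mfrestr measurableT moo) => A.
by rewrite /= /mfrestr/= /mrestr setIT.
Qed.

Lemma pushforward_measure d (T : measurableType d) (R : realType)
    (Q : {measure set T -> \bar R}) d1 (T1 : measurableType d1) (X : T -> T1) :
  measurable_fun setT X ->
  exists m : {measure set T1 -> \bar R}, forall A, m A = Q (X @^-1` A).
Proof.
move=> mX; unshelve refine (ex_intro _ (pushforward Q X : {measure set T1 -> \bar R}) _) => //.
Qed.

Lemma pushforward_integral d (T : measurableType d) (R : realType)
    (Q : {measure set T -> \bar R}) d1 (T1 : measurableType d1) (X : T -> T1)
    (m : {measure set T1 -> \bar R}) (C : set T1) (f : T1 -> \bar R) :
  measurable_fun setT X -> (forall A, measurable A -> m A = Q (X @^-1` A)) ->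
  measurable C -> measurable_fun C f -> (forall x, 0 <= f x) ->
  \int[m]_(x in C) f x = \int[Q]_(t in X @^-1` C) f (X t).
Proof.
move=> mX mE mC mf f0.
rewrite -(@ge0_integral_pushforward _ _ _ _ _ _ mX Q)//; apply: eq_measure_integral.
by move=> A mA _; exact: mE.
Qed.

(** The joint law of an independent pair is the product of the marginals, by
    uniqueness of the product measure; the right-hand side is the value of the
    product measure on S. *)
Lemma joint_law_section d (T : measurableType d) (R : realType)
    (Q : {measure set T -> \bar R}) d1 (T1 : measurableType d1)
    d2 (T2 : measurableType d2) (X : T -> T1) (Y : T -> T2)
    (m1 : {measure set T1 -> \bar R}) (m2 : {measure set T2 -> \bar R}) :
  measurable_fun setT X -> measurable_fun setT Y ->
  m1 setT < +oo -> m2 setT < +oo ->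
  (forall A B, measurable A -> measurable B ->
     Q (X @^-1` A `&` Y @^-1` B) = m1 A * m2 B) ->
  forall S : set (T1 * T2), measurable S ->
    Q [set t | S (X t, Y t)] = \int[m1]_x m2 (xsection S x).
Proof.
move=> mX mY m1oo m2oo QE S mS.
have [m1' m1E] := finite_measure_pack m1oo.
have [m2' m2E] := finite_measure_pack m2oo.
have mXY : measurable_fun setT (fun t => (X t, Y t)) by exact: measurable_fun_pair.
have [D DE] := pushforward_measure Q mXY.
have := @product_measure_unique _ _ _ _ _ m1' m2' D _ S mS.
rewrite DE => <-.
  rewrite /product_measure1 /=.
  transitivity (\int[m1']_x m2 (xsection S x)).
    by apply: eq_integral => x _; exact: m2E.
  by apply: eq_measure_integral => A mA _; exact: m1E.
move=> A B mA mB; rewrite DE; transitivity (m1 A * m2 B); first exact: QE.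
by congr (_ * _); [exact: esym (m1E A)|exact: esym (m2E B)].
Qed.

(** Open right rays form a pi-system that generates the Borel sets. *)
Lemma ray_unique (R : realType) (m1 m2 : {measure set (measurableTypeR R) -> \bar R}) :
  m1 setT < +oo -> (forall a : R, m1 `]a, +oo[%classic = m2 `]a, +oo[%classic) ->
  forall A : set R, measurable A -> m1 A = m2 A.
Proof.
move=> m1oo m12 A mA.
apply: (@measure_unique _ R (measurableTypeR R) (@RGenOInfty.G R)
  (fun n => `](- n%:R)%R, +oo[%classic) _ _ _ _ m1 m2) => //.
- exact: RGenOInfty.measurableE.
- move=> _ _ [a ->] [b ->]; exists (Num.max a b).
  apply/seteqP; split => x /=; rewrite !in_itv/= !andbT gt_max.
    by move=> [-> ->].
  by move=> /andP[].
- by move=> n; exists (- n%:R)%R.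
- rewrite -subTset => x _; exists (Num.truncn `|x|).+1 => //=.
  rewrite in_itv/= andbT ltrNl (le_lt_trans (ler_norm _))// normrN.
  exact: truncnS_gt.
- by move=> _ [a ->].
- move=> n; rewrite (le_lt_trans _ m1oo)// le_measure ?inE//.
Qed.

Local Close Scope ereal_scope.

(** * The corner flip *)

Local Open Scope ereal_scope.

(** Measurable rectangles form a pi-system that generates the product
    sigma-algebra. *)
Lemma rectangle_unique (R : realType) d1 (T1 : measurableType d1)
    d2 (T2 : measurableType d2) (m1 m2 : {measure set (T1 * T2) -> \bar R}) :
  m1 setT < +oo ->
  (forall A B, measurable A -> measurable B -> m1 (A `*` B) = m2 (A `*` B)) ->
  forall S, measurable S -> m1 S = m2 S.
Proof.
move=> m1oo m12 S mS.
apply: (@measure_unique _ R _ [set A `*` B | A in measurable & B in measurable]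
  (fun=> setT) _ _ _ _ m1 m2) => //.
- exact: measurable_prod_measurableType.
- move=> _ _ [A mA [B mB <-]] [A' mA' [B' mB' <-]].
  exists (A `&` A'); first exact: measurableI.
  by exists (B `&` B'); [exact: measurableI|rewrite setXI].
- by move=> _; exists setT => //; exists setT => //; rewrite setXTT.
- by rewrite bigcup_const.
- by move=> _ [A mA [B mB <-]]; exact: m12.
Qed.

Section corner.
Context d (T : measurableType d) (R : realType) (Q : {measure set T -> \bar R}).
Variables (q r : R) (U V W : T -> R).
Hypotheses (q0 : (0 <= q)%R) (r0 : (0 < r)%R) (r1 : (r < 1)%R).
Hypotheses (mU : measurable_fun setT U) (mV : measurable_fun setT V)
  (mW : measurable_fun setT W).
Hypothesis lawUVW : forall A B C : set R,
  measurable A -> measurable B -> measurable C ->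
  Q (U @^-1` A `&` V @^-1` B `&` W @^-1` C) = q%:E *
    (exponential_prob r A * exponential_prob (1 - r) B * exponential_prob 1 C).

Let RM := measurableTypeR R.

Let r1' : (0 < 1 - r)%R. Proof. by rewrite subr_gt0. Qed.
Let r1'' : (0 < 1 :> R)%R. Proof. exact: ltr01. Qed.

Let QT : Q setT = q%:E.
Proof.
have := lawUVW (@measurableT _ R) (@measurableT _ R) (@measurableT _ R).
by rewrite !preimage_setT !setIT !expo_setT// !mule1.
Qed.

Let D t := (U t - V t)%R.
Let mD : measurable_fun setT D. Proof. exact: measurable_funB. Qed.

Let lawUV (A B : set R) : measurable A -> measurable B ->
  Q (U @^-1` A `&` V @^-1` B) =
  q%:E * (exponential_prob r A * exponential_prob (1 - r) B).
Proof.
move=> mA mB; have := lawUVW mA mB (@measurableT _ R).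
by rewrite preimage_setT setIT expo_setT// mule1.
Qed.

Let lawV (B : set R) : measurable B -> Q (V @^-1` B) = q%:E * exponential_prob (1 - r) B.
Proof.
move=> mB; have := lawUV (@measurableT _ R) mB.
by rewrite preimage_setT setTI expo_setT// mul1e.
Qed.

Let lawW (C : set R) : measurable C -> Q (W @^-1` C) = q%:E * exponential_prob 1 C.
Proof.
move=> mC; have := lawUVW (@measurableT _ R) (@measurableT _ R) mC.
by rewrite !preimage_setT !setTI !expo_setT// !mul1e.
Qed.

(** Besides W, the flipped increments depend on U and V only through their
    difference, so the law of three variables is reduced to that of the pair
    (W, U - V). *)
Let lawWD (C E : set R) : measurable C -> measurable E ->
  Q (W @^-1` C `&` D @^-1` E) = exponential_prob 1 C * Q (D @^-1` E).
Proof.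
move=> mC mE.
have mWC : measurable (W @^-1` C) by exact: measurable_preimage.
have mUV : measurable_fun setT (fun t => (U t, V t) : (RM * RM)%type).
  exact: measurable_fun_pair.
have [m1 m1E] := pushforward_measure (mrestr Q mWC) mUV.
have [m2 m2E] := pushforward_measure Q mUV.
have e0 : (0 <= fine (exponential_prob 1 C))%R.
  by rewrite fine_ge0// expo_ge0.
pose m3 := mscale (NngNum e0) m2.
pose S : set (RM * RM) := (fun x : RM * RM => (x.1 - x.2 : R)%R) @^-1` E.
have mS : measurable S.
  rewrite -[X in measurable X]setTI.
  have : measurable_fun setT (fun x : RM * RM => (x.1 - x.2 : R)%R).
    by apply: measurable_funB; [exact: measurable_fst|exact: measurable_snd].
  by apply.
have m3E A : m3 A = exponential_prob 1 C * Q ((fun t => (U t, V t)) @^-1` A).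
  by rewrite -m2E -(fineK (expo_fin_num r1'' mC)).
have m13 : m1 S = m3 S.
  apply: rectangle_unique => //.
    have -> : m1 setT = Q (W @^-1` C).
      by rewrite m1E /mrestr; congr (Q _); apply/seteqP; split => // t [].
    by rewrite lawW// -(fineK (expo_fin_num _ _))// -EFinM ltry.
  move=> A B mA mB.
  have preAB : (fun t => (U t, V t)) @^-1` (A `*` B) = U @^-1` A `&` V @^-1` B by [].
  transitivity (exponential_prob 1 C * Q (U @^-1` A `&` V @^-1` B)); last first.
    by rewrite -preAB; exact: esym (m3E (A `*` B)).
  have -> : m1 (A `*` B) = Q (U @^-1` A `&` V @^-1` B `&` W @^-1` C).
    by rewrite m1E /mrestr; congr (Q _).
  rewrite lawUVW// lawUV//.
  by rewrite [in RHS]muleCA; congr (_ * _); rewrite muleC.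
rewrite setIC; transitivity (m1 S); first by rewrite m1E.
by rewrite m13; exact: m3E.
Qed.

(** Given V = x >= 0, the event is U > x + y, of probability exp (- r x) exp
    (- r y); integrating exp (- r x) against the law Exp(1 - r) of V gives the
    factor 1 - r. *)
Let tailD y : (0 <= y)%R ->
  Q (D @^-1` `]y, +oo[%classic) = (q * (1 - r) * expR (- r * y))%:E.
Proof.
move=> y0.
have [m1 m1E] := @pushforward_measure _ _ _ Q _ RM V mV.
have [m2 m2E] := expo_measure r0.
pose S : set (RM * RM) :=
  [set x : RM * RM | (0 <= x.1)%R] `&`
    (fun x : RM * RM => (x.2 - x.1 : R)%R) @^-1` `]y, +oo[%classic.
have mS : measurable S.
  apply: measurableI.
    rewrite -[X in measurable X]setTI.
    have -> : [set x : RM * RM | (0 <= x.1)%R] = fst @^-1` `[0%R, +oo[%classic.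
      by apply/seteqP; split => x /=; rewrite in_itv/= andbT.
    by apply: (@measurable_fst _ _ RM RM) => //.
  rewrite -[X in measurable X]setTI.
  have : measurable_fun setT (fun x : RM * RM => (x.2 - x.1 : R)%R).
    by apply: measurable_funB; [exact: measurable_snd|exact: measurable_fst].
  by apply.
have -> : Q (D @^-1` `]y, +oo[) = Q [set t | S (V t, U t)].
  apply: (@eq_measure_off_null _ _ _ Q _ _ (V @^-1` `]-oo, 0%R]%classic)).
  - exact: measurable_preimage.
  - rewrite -[X in measurable X]setTI.
    have mVU : measurable_fun setT (fun t => (V t, U t) : (RM * RM)%type).
      exact: measurable_fun_pair.
    exact: mVU.
  - exact: measurable_preimage.
  - by rewrite lawV// expo_nonpos// mule0.
  - move=> t /=; rewrite !in_itv/= !andbT => Dt.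
    have [v0|v0] := leP 0%R (V t); last by right; exact: ltW.
    by left; split => //=; rewrite in_itv/= andbT.
  - by move=> t [_ Dt]; left.
rewrite (@joint_law_section _ _ _ Q _ RM _ RM V U m1 m2)//; last 3 first.
- by rewrite m1E preimage_setT QT ltry.
- by rewrite m2E expo_setT// ltry.
- move=> A B mA mB; rewrite setIC lawUV// m1E m2E lawV//.
  by rewrite -muleA; congr (_ * _); rewrite muleC.
transitivity (\int[m1]_(x in `[0%R, +oo[%classic) (expR (- r * y) * expR ((- r) * x))%:E).
  rewrite [RHS]integral_mkcond; apply: eq_integral => x _.
  rewrite patchE; case: ifPn; rewrite ?inE/= ?notin_setE/= in_itv/= andbT => x0.
    have -> : xsection S x = `](y + x)%R, +oo[%classic.
      rewrite /xsection; apply/seteqP; split => z /=; rewrite inE /S/= !in_itv/= !andbT.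
        by move=> [_]; rewrite ltrBrDr.
      by rewrite ltrBrDr.
    by rewrite m2E expo_tail ?addr_ge0// -expRD mulrDr.
  have -> : xsection S x = set0.
    by apply/seteqP; split => z //=; rewrite /xsection/= inE /S/= => -[].
  by rewrite measure0.
under eq_integral do rewrite EFinM.
rewrite ge0_integralZl//; last first.
  apply/measurable_EFinP/measurable_funTS.
  by apply: measurableT_comp => //; exact: measurable_funM.
rewrite (@expo_tilt_scaled R q (1 - r) (- r))//; last 2 first.
- by rewrite (lt_trans _ r1')// oppr_lt0.
- by move=> B mB; rewrite m1E lawV.
rewrite opprK subrK divr1.
have -> : exponential_prob 1 (`[0%R, +oo[%classic : set R) = 1.
  have [m mE] := expo_measure r1''.
  apply/eqP; rewrite eq_le -!mE; apply/andP; split.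
    by rewrite -(expo_setT r1'') -mE le_measure ?inE.
  have <- : exponential_prob 1 (`]0%R, +oo[%classic : set R) = 1.
    by rewrite expo_tail// mulr0 expR0.
  by rewrite -mE le_measure ?inE//; apply: subset_itvr; rewrite bnd_simp.
by rewrite mule1 -!EFinM mulrC.
Qed.

(** When b <= a the event splits into W > a and the event that b < W <= a
    while U - V > a - W. Up to the mass q, the first has probability exp (-
    a). The second is computed by integrating the tail of U - V over the value
    of W, and the sum of the two factorizes. *)
Lemma flip_rays_pos a b : (0 <= b)%R -> (b <= a)%R ->
  Q [set t | (a < W t + Num.max 0 (D t) /\ b < W t + Num.max 0 (- D t))%R] =
  q%:E * (exponential_prob r `]a, +oo[%classic *
          exponential_prob (1 - r) `]b, +oo[%classic).
Proof.
move=> b0 ba; have a0 : (0 <= a)%R := le_trans b0 ba.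
rewrite !expo_tail//.
have aux (x : R) : (- r * (a - x) = - r * a + r * x)%R by ring.
have [m1 m1E] := expo_measure r1''.
have [m2 m2E] := @pushforward_measure _ _ _ Q _ RM D mD.
pose S : set (RM * RM) := (fst @^-1` `]b, a]%classic) `&`
    (fun x : RM * RM => (x.2 + x.1 : R)%R) @^-1` `]a, +oo[%classic.
have mS : measurable S.
  apply: measurableI.
    rewrite -[X in measurable X]setTI.
    by apply: (@measurable_fst _ _ RM RM) => //.
  rewrite -[X in measurable X]setTI.
  have : measurable_fun setT (fun x : RM * RM => (x.2 + x.1 : R)%R).
    by apply: measurable_funD; [exact: measurable_snd|exact: measurable_fst].
  by apply.
have mWD : measurable_fun setT (fun t => (W t, D t) : (RM * RM)%type).
  exact: measurable_fun_pair.
have mSWD : measurable [set t | S (W t, D t)].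
  exact: measurable_preimage.
(* At most one of the two positive parts is nonzero. *)
have -> : [set t | (a < W t + Num.max 0 (D t) /\ b < W t + Num.max 0 (- D t))%R] =
    W @^-1` `]a, +oo[%classic `|` [set t | S (W t, D t)].
  apply/seteqP; split => t; rewrite /S/= !in_itv/= !andbT /Num.max oppr_gt0.
    case: (ltP 0%R (D t)) => D0; case: (ltP (D t) 0%R) => D1 []; rewrite ?addr0.
    - by move: (lt_trans D0 D1); rewrite ltxx.
    - move=> aD bW; have [|Wa] := ltP a (W t); first by left.
      by right; rewrite bW addrC.
    - by left.
    - by left.
  case=> [aW|[/andP[bW Wa] DW]].
    have bW : (b < W t)%R by exact: le_lt_trans aW.
    by case: (ltP 0%R (D t)) => D0; case: (ltP (D t) 0%R) => D1; split; lra.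
  have D0 : (0 < D t)%R by lra.
  by rewrite D0; case: (ltP (D t) 0%R) => D1; split; lra.
have -> : Q (W @^-1` `]a, +oo[%classic `|` [set t | S (W t, D t)]) =
    Q (W @^-1` `]a, +oo[%classic) + Q [set t | S (W t, D t)].
  apply: measureU => //; first exact: measurable_preimage.
  apply/seteqP; split => t //=; rewrite /S/= !in_itv/= andbT => -[aW [/andP[_ Wa] _]].
  by move: (lt_le_trans aW Wa); rewrite ltxx.
rewrite lawW// expo_tail//.
rewrite (@joint_law_section _ _ _ Q _ RM _ RM W D m1 m2)//; last 3 first.
- by rewrite m1E expo_setT// ltry.
- by rewrite m2E preimage_setT QT ltry.
- by move=> A B mA mB; rewrite lawWD// m1E m2E.
transitivity (q%:E * (expR (- (1) * a))%:E +
   \int[m1]_(x in `]b, a]%classic) ((q * (1 - r) * expR (- r * a))%:E * (expR (r * x))%:E)).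
  congr (_ + _); rewrite [RHS]integral_mkcond; apply: eq_integral => x _.
  rewrite patchE; case: ifPn; rewrite ?inE/= ?notin_setE/= in_itv/= => xab.
    have -> : xsection S x = `](a - x)%R, +oo[%classic.
      rewrite /xsection; apply/seteqP; split => z /=; rewrite inE /S/= !in_itv/= !andbT.
        by move=> [_]; rewrite ltrBlDr.
      by rewrite ltrBlDr.
    rewrite m2E tailD; last by rewrite subr_ge0; case/andP: xab.
    by rewrite -EFinM; congr (_%:E); rewrite -[RHS]mulrA -expRD; congr (_ * expR _)%R; exact: aux.
  have -> : xsection S x = set0.
    by apply/seteqP; split => z //=; rewrite /xsection/= inE /S/= in_itv/= => -[].
  by rewrite measure0.
rewrite ge0_integralZl//; last first.
- by rewrite lee_fin !mulr_ge0// ?expR_ge0// ltW.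
- apply/measurable_EFinP/measurable_funTS.
  by apply: measurableT_comp => //; exact: measurable_funM.
rewrite (@expo_tilt R 1 r)//.
have -> : exponential_prob (1 - r) (`]b, a]%classic : set R) =
    (expR (- (1 - r) * b) - expR (- (1 - r) * a))%:E.
  have [m mE] := expo_measure r1'.
  have h : m `]b, a]%classic + m `]a, +oo[%classic = m `]b, +oo[%classic.
    rewrite -measureU//; last first.
      apply/seteqP; split => x //=; rewrite !in_itv/= andbT => -[/andP[_ xa] ax].
      by move: (lt_le_trans ax xa); rewrite ltxx.
    congr (m _); apply/seteqP; split => x /=; rewrite !in_itv/= !andbT.
      by case=> [/andP[]//|]; exact: le_lt_trans.
    by move=> bx; case: (leP x a); [left; rewrite bx|right].
  move: h; rewrite !mE !expo_tail// => h.
  by rewrite EFinB -h addeK.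
rewrite -!EFinM -EFinD; congr (_%:E).
have e1 : expR (- (1) * a) = (expR (- r * a) * expR (- (1 - r) * a))%R.
  by rewrite -expRD; congr expR; ring.
rewrite e1; field.
by rewrite gt_eqF.
Qed.

End corner.

Local Close Scope ereal_scope.

Local Open Scope ereal_scope.

Section corner_flip.
Context d (T : measurableType d) (R : realType) (Q : {measure set T -> \bar R}).
Variables (q r : R) (U V W : T -> R).
Hypotheses (q0 : (0 <= q)%R) (r0 : (0 < r)%R) (r1 : (r < 1)%R).
Hypotheses (mU : measurable_fun setT U) (mV : measurable_fun setT V)
  (mW : measurable_fun setT W).
Hypothesis lawUVW : forall A B C : set R,
  measurable A -> measurable B -> measurable C ->
  Q (U @^-1` A `&` V @^-1` B `&` W @^-1` C) = q%:E *
    (exponential_prob r A * exponential_prob (1 - r) B * exponential_prob 1 C).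

Let U' t := (W t + Num.max 0 (U t - V t))%R.
Let V' t := (W t + Num.max 0 (V t - U t))%R.

Let r1' : (0 < 1 - r)%R. Proof. by rewrite subr_gt0. Qed.

Let mU' : measurable_fun setT U'.
Proof.
apply: measurable_funD => //; apply: measurable_maxr => //.
exact: measurable_funB.
Qed.

Let mV' : measurable_fun setT V'.
Proof.
apply: measurable_funD => //; apply: measurable_maxr => //.
exact: measurable_funB.
Qed.

(** The case a <= b follows from the other one by exchanging U and V, that is,
    r and 1 - r. *)
Let flip_rays_ge0 a b : (0 <= a)%R -> (0 <= b)%R ->
  Q (U' @^-1` `]a, +oo[%classic `&` V' @^-1` `]b, +oo[%classic) =
  q%:E * (exponential_prob r `]a, +oo[%classic *
          exponential_prob (1 - r) `]b, +oo[%classic).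
Proof.
move=> a0 b0; have [ba|/ltW ab] := leP b a.
  rewrite -(flip_rays_pos q0 r0 r1 mU mV mW lawUVW b0 ba); congr (Q _).
  by apply/seteqP; split => t /=; rewrite !in_itv/= !andbT /U' /V' opprB.
rewrite [X in _ * X]muleC.
have r11 : (1 - (1 - r) = r)%R by rewrite opprB subrKC.
have lawVUW A B C : measurable A -> measurable B -> measurable C ->
  Q (V @^-1` A `&` U @^-1` B `&` W @^-1` C) = q%:E *
    (exponential_prob (1 - r) A * exponential_prob (1 - (1 - r)) B * exponential_prob 1 C).
  move=> mA mB mC; rewrite (setIC (V @^-1` A)) (lawUVW mB mA mC) r11.
  by rewrite (muleC (exponential_prob r B)).
have r11' : (1 - r < 1)%R by rewrite ltrBlDr ltrDl.
have := flip_rays_pos q0 r1' r11' mV mU mW lawVUW a0 ab.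
rewrite r11 => <-; congr (Q _).
by apply/seteqP; split => t /=; rewrite !in_itv/= !andbT /U' /V' opprB => -[].
Qed.

Let lawW (C : set R) : measurable C -> Q (W @^-1` C) = q%:E * exponential_prob 1 C.
Proof.
move=> mC; have := lawUVW (@measurableT _ R) (@measurableT _ R) mC.
by rewrite !preimage_setT !setTI !expo_setT// !mul1e.
Qed.

(** Since W > 0 almost surely, a negative threshold may be replaced by 0. *)
Let flip_rays a b :
  Q (U' @^-1` `]a, +oo[%classic `&` V' @^-1` `]b, +oo[%classic) =
  q%:E * (exponential_prob r `]a, +oo[%classic *
          exponential_prob (1 - r) `]b, +oo[%classic).
Proof.
have maxE (s x : R) : (0 < s)%R -> exponential_prob s `]x, +oo[%classic =
    exponential_prob s `](Num.max x 0)%R, +oo[%classic.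
  move=> s0; rewrite !expo_ray//; congr (expR (_ * _))%:E.
  by rewrite [in RHS]max_l// le_max lexx orbT.
rewrite (maxE r)// (maxE (1 - r)%R)// -flip_rays_ge0; last 2 first.
- by rewrite le_max lexx orbT.
- by rewrite le_max lexx orbT.
apply: (@eq_measure_off_null _ _ _ Q _ _ (W @^-1` `]-oo, 0%R]%classic)).
- by apply: measurableI; exact: measurable_preimage.
- by apply: measurableI; exact: measurable_preimage.
- exact: measurable_preimage.
- by rewrite lawW// expo_nonpos// mule0.
- move=> t /=; rewrite !in_itv/= !andbT => -[aU bV].
  have [W0|W0] := leP (W t) 0%R; first by right.
  left; rewrite !gt_max aU bV; split; rewrite (lt_le_trans W0)// lerDl le_max lexx//.
- move=> t /=; rewrite !in_itv/= !andbT !gt_max => -[/andP[aU _] /andP[bV _]].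
  by left.
Qed.

(** A pair of laws is determined by its values on products of rays, so the
    rays suffice, one coordinate after the other. The mass q is arbitrary
    because the lemma is applied after restriction to an event on the other
    weights and after a change of measure. *)
Lemma corner_flip (A B : set R) : measurable A -> measurable B ->
  Q (U' @^-1` A `&` V' @^-1` B) =
  q%:E * (exponential_prob r A * exponential_prob (1 - r) B).
Proof.
have [mr mrE] := expo_measure r0; have [ms msE] := expo_measure r1'.
have QT : Q setT = q%:E by rewrite -(preimage_setT W) lawW// expo_setT// mule1.
have Qoo C : measurable C -> Q C < +oo.
  by move=> mC; rewrite (@le_lt_trans _ _ (Q setT))// ?le_measure ?inE// QT ltry.
have step1 b C : measurable C -> Q (U' @^-1` C `&` V' @^-1` `]b, +oo[%classic) =
    q%:E * (exponential_prob r C * exponential_prob (1 - r) `]b, +oo[%classic).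
  move=> mC; have mb : measurable `]b, +oo[%classic by exact: measurable_itv.
  have [e e0 eE] := expo_fine r1' mb.
  have mVb : measurable (V' @^-1` `]b, +oo[%classic) by exact: measurable_preimage.
  have [m1 m1E] := @pushforward_measure _ _ _ (mrestr Q mVb) _ (measurableTypeR R) U' mU'.
  have qe0 : (0 <= q * e)%R by exact: mulr_ge0.
  transitivity (m1 C); first by rewrite m1E.
  transitivity (mscale (NngNum qe0) mr C); last first.
    by rewrite /mscale/= mrE eE EFinM -muleA; congr (_ * _); rewrite muleC.
  apply: ray_unique => //.
    by rewrite m1E /mrestr Qoo//; apply: measurableI => //; exact: measurable_preimage.
  move=> a; transitivity (Q (U' @^-1` `]a, +oo[%classic `&` V' @^-1` `]b, +oo[%classic)).
    by rewrite m1E.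
  rewrite flip_rays; transitivity ((q * e)%:E * exponential_prob r `]a, +oo[%classic).
    by rewrite eE EFinM -muleA; congr (_ * _); rewrite muleC.
  by rewrite -mrE.
move=> mA mB; have [e e0 eE] := expo_fine r0 mA.
have mUA : measurable (U' @^-1` A) by exact: measurable_preimage.
have [m1 m1E] := @pushforward_measure _ _ _ (mrestr Q mUA) _ (measurableTypeR R) V' mV'.
have qe0 : (0 <= q * e)%R by exact: mulr_ge0.
transitivity (m1 B); first by rewrite m1E /mrestr setIC.
transitivity (mscale (NngNum qe0) ms B); last first.
  by rewrite /mscale/= msE eE EFinM -muleA.
apply: ray_unique => //.
  by rewrite m1E /mrestr Qoo//; apply: measurableI => //; exact: measurable_preimage.
move=> b; transitivity (Q (U' @^-1` A `&` V' @^-1` `]b, +oo[%classic)).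
  by rewrite m1E /mrestr setIC.
rewrite step1//.
transitivity ((q * e)%:E * exponential_prob (1 - r) `]b, +oo[%classic).
  by rewrite eE EFinM -muleA.
by rewrite -msE.
Qed.

End corner_flip.

Local Close Scope ereal_scope.

(** * Independent families of exponential variables *)

Local Open Scope ereal_scope.

(** Independence with exponential marginals, under a measure of any mass: the
    factor [Q setT] makes the notion stable under restriction to an
    independent event and under tilting. *)
Definition indep_exp (T : Type) (R : realType) (I : eqType)
    (Q : set T -> \bar R) (X : I -> T -> R) (r : I -> R) (s : seq I) : Prop :=
  forall A : I -> set R, (forall i, measurable (A i)) ->
    Q (\bigcap_(i in [set` s]) (X i @^-1` A i)) =
    Q setT * \prod_(i <- s) exponential_prob (r i) (A i).

Section indep_exp.
Context d (T : measurableType d) (R : realType) (I : eqType).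
Implicit Types (Q : {measure set T -> \bar R}) (X : I -> T -> R) (r : I -> R).
Implicit Types s : seq I.

Lemma prod_expo_fine r (A : I -> set R) s :
  (forall i, i \in s -> (0 < r i)%R) -> (forall i, measurable (A i)) ->
  exists2 e : R, (0 <= e)%R & \prod_(i <- s) exponential_prob (r i) (A i) = e%:E.
Proof.
move=> r0 mA; elim: s r0 => [|i s IHs] r0; first by exists 1%R; rewrite ?big_nil.
have [e e0 eE] := IHs (fun j js => r0 j (mem_behead (s := i :: s) js)).
have [e' e'0 e'E] := expo_fine (r0 i (mem_head _ _)) (mA i).
by exists (e' * e)%R; [exact: mulr_ge0|rewrite big_cons eE e'E].
Qed.

Lemma preimage_bigcap_cons X (A : I -> set R) i s :
  \bigcap_(j in [set` i :: s]) (X j @^-1` A j) =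
  X i @^-1` A i `&` \bigcap_(j in [set` s]) (X j @^-1` A j).
Proof.
apply/seteqP; split => t.
  by move=> h; split; [apply: h; exact: mem_head|move=> j sj; apply: h; rewrite /= in_cons sj orbT].
by move=> [hi hs] j /=; rewrite in_cons => /orP[/eqP ->//|]; exact: hs.
Qed.

Lemma measurable_preimage_bigcap X (A : I -> set R) s :
  (forall i, measurable_fun setT (X i)) -> (forall i, measurable (A i)) ->
  measurable (\bigcap_(i in [set` s]) (X i @^-1` A i)).
Proof.
move=> mX mA; apply: fin_bigcap_measurable => // i _.
exact: measurable_preimage.
Qed.

Lemma indep_exp_perm Q X r s s' : perm_eq s s' ->
  indep_exp Q X r s -> indep_exp Q X r s'.
Proof.
move=> ss' QX A mA; rewrite -(perm_big _ ss')/= -QX//; congr (Q _).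
by apply/seteqP; split => t h i /= si; apply: h => /=; move: si;
  rewrite (perm_mem ss').
Qed.

Lemma eq_indep_exp Q X X' r r' s : {in s, X =1 X'} -> {in s, r =1 r'} ->
  indep_exp Q X r s -> indep_exp Q X' r' s.
Proof.
move=> XX' rr' QX A mA.
have -> : \prod_(i <- s) exponential_prob (r' i) (A i) =
    \prod_(i <- s) exponential_prob (r i) (A i).
  by apply: eq_big_seq => i si; rewrite rr'.
rewrite -QX//; congr (Q _).
by apply/seteqP; split => t h i /= si; [rewrite (XX' i si)|rewrite -(XX' i si)]; exact: h.
Qed.

(** Take A i to be the whole line on the discarded indices. *)
Lemma indep_exp_catl Q X r s s' : uniq (s ++ s') ->
  {in s', forall i, (0 < r i)%R} ->
  indep_exp Q X r (s ++ s') -> indep_exp Q X r s.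
Proof.
move=> uss r0 QX A mA.
pose A' i := if i \in s then A i else setT.
have mA' i : measurable (A' i) by rewrite /A'; case: ifP.
have := QX A' mA'; rewrite big_cat/= [X in _ * (_ * X)]big_seq.
rewrite [X in _ * (_ * X)]big1; last first.
  move=> i s'i; rewrite /A' ifF ?expo_setT ?r0//.
  apply/negP => si; move: uss; rewrite cat_uniq => /and3P[_ /hasP]; case.
  by exists i.
rewrite mule1 (eq_big_seq (fun i => exponential_prob (r i) (A i))); last first.
  by move=> i si; rewrite /A' si.
move=> <-; congr (Q _); apply/seteqP; split => t h i /=.
  rewrite mem_cat => /orP[] si; rewrite /A'; first by rewrite si; exact: h.
  by case: ifP => // /h.
by move=> si; have := h i; rewrite /= mem_cat si /A' si; exact.
Qed.

Lemma indep_exp_subset Q X r s s' : uniq s -> uniq s' -> {subset s' <= s} ->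
  {in s, forall i, (0 < r i)%R} ->
  indep_exp Q X r s -> indep_exp Q X r s'.
Proof.
move=> us us' ss' r0 QX.
pose s2 := [seq i <- s | i \notin s'].
have u : uniq (s' ++ s2).
  rewrite cat_uniq us' filter_uniq// andbT.
  by apply/hasPn => i; rewrite mem_filter => /andP[].
have p : perm_eq s (s' ++ s2).
  apply: uniq_perm => // i; rewrite mem_cat mem_filter.
  by have := ss' i; case: (i \in s') => //= ->.
apply: (indep_exp_catl u); last exact: indep_exp_perm QX.
by move=> i; rewrite mem_filter => /andP[_ /r0].
Qed.

(** Reindexing along f. A family of sets over J is moved to I by intersecting
    over the fibres of f, which meet u in at most one point. *)
Lemma indep_exp_map Q X r (J : eqType) (f : J -> I) (u : seq J) :
  {in u &, injective f} ->
  indep_exp Q X r (map f u) -> indep_exp Q (X \o f) (r \o f) u.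
Proof.
move=> finj QX A mA.
pose A' i := \bigcap_(j in [set j | j \in u /\ f j = i]) A j.
have A'E j : j \in u -> A' (f j) = A j.
  move=> uj; apply/seteqP; split => x; first by apply.
  by move=> Ajx k /= [uk fk]; rewrite (finj _ _ uk uj fk).
have mA' i : measurable (A' i).
  rewrite /A'; apply: fin_bigcap_measurable => //.
  by apply: (sub_finite_set _ (finite_seq u)) => j [].
have := QX A' mA'; rewrite big_map.
rewrite (eq_big_seq (fun j => exponential_prob (r (f j)) (A j))); last first.
  by move=> j uj; rewrite A'E.
move=> <-; congr (Q _); apply/seteqP; split => t h i /=.
  by move=> /mapP[j uj ->]; rewrite A'E//; exact: h.
by move=> ui; rewrite /= -(A'E i ui); apply: h => /=; exact: map_f.
Qed.

(** Under independence the tilt by exp (l X_i) acts only on the factor of X_i,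
    where [expo_tilt] computes it. *)
Lemma indep_exp_tilt1 Q (q : R) X r i s (l : R) : Q setT = q%:E ->
  (forall j, measurable_fun setT (X j)) ->
  {in i :: s, forall j, (0 < r j)%R} -> (l < r i)%R -> i \notin s ->
  indep_exp Q X r (i :: s) ->
  exists Q' : {measure set T -> \bar R},
    [/\ forall A, Q' A = \int[Q]_(t in A) (expR (l * X i t))%:E,
        Q' setT = (q * (r i / (r i - l)))%:E &
        indep_exp Q' X (fun j => if j == i then r i - l else r j)%R (i :: s)].
Proof.
move=> QT mX r0 lr is_ QX.
have q0 : (0 <= q)%R by rewrite -lee_fin -QT.
have mexp : measurable_fun setT (fun t => expR (l * X i t)).
  by apply: measurableT_comp => //; exact: measurable_funM.
have exp0 t : (0 <= expR (l * X i t))%R by rewrite expR_ge0.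
have [Q' Q'E] := density_measure Q mexp exp0.
have r0i : (0 < r i)%R by apply: r0; rewrite mem_head.
have rli : (0 < r i - l)%R by rewrite subr_gt0.
have key A : (forall j, measurable (A j)) ->
    Q' (\bigcap_(j in [set` i :: s]) (X j @^-1` A j)) =
    q%:E * ((r i / (r i - l))%:E * exponential_prob (r i - l) (A i) *
            \prod_(j <- s) exponential_prob (r j) (A j)).
  move=> mA; rewrite preimage_bigcap_cons.
  set B := \bigcap_(j in [set` s]) _.
  have mB : measurable B by exact: measurable_preimage_bigcap.
  have mi C : measurable C -> measurable (X i @^-1` C).
    by move=> mC; rewrite -[X in measurable X]setTI; exact: mX.
  have [e e0 eE] : exists2 e : R, (0 <= e)%R &
      \prod_(j <- s) exponential_prob (r j) (A j) = e%:E.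
    by apply: prod_expo_fine => // j sj; apply: r0; rewrite in_cons sj orbT.
  have [m1 m1E] := @pushforward_measure _ _ _ (mrestr Q mB) _ (measurableTypeR R) (X i) (mX i).
  have m1E' C : measurable C -> m1 C = (q * e)%:E * exponential_prob (r i) C.
    move=> mC; rewrite m1E.
    pose A' j := if j == i then C else A j.
    have mA' j : measurable (A' j) by rewrite /A'; case: ifP => _; [exact: mC|exact: mA].
    have := QX A' mA'.
    have Bs j : j \in s -> A' j = A j.
      by rewrite /A'; case: eqP => // -> si; rewrite si in is_.
    rewrite big_cons preimage_bigcap_cons /A' eqxx QT EFinM -muleA.
    rewrite (eq_big_seq (fun j => exponential_prob (r j) (A j))); last first.
      by move=> j sj; rewrite -/(A' j) Bs.
    rewrite eE [X in _ * X]muleC => <-; congr (Q (_ `&` _)).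
    by apply: eq_bigcapr => j /= sj; rewrite -/(A' j) Bs.
  have := expo_tilt_scaled (mulr_ge0 q0 e0) r0i lr (mA i) m1E'.
  have mexpl : measurable_fun (A i : set (measurableTypeR R))
      (fun x : measurableTypeR R => (expR (l * x))%:E).
    apply/measurable_EFinP/measurable_funTS.
    by apply: measurableT_comp => //; exact: measurable_funM.
  have expl0 (x : measurableTypeR R) : 0 <= (expR (l * x))%:E.
    by rewrite lee_fin expR_ge0.
  rewrite (pushforward_integral (mX i : measurable_fun setT (X i : T -> measurableTypeR R))
    (fun A _ => m1E A) (mA i) mexpl expl0).
  rewrite integral_mkcond.
  rewrite (@ge0_integral_density _ _ _ Q (mrestr Q mB) (\1_B)) //; last 3 first.
  - by move=> C mC; rewrite integral_indic// /mrestr setIC.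
  - apply/(measurable_restrictT _ _).1; first exact: mi.
    by apply: measurable_funTS; exact/measurable_EFinP.
  - by move=> t; rewrite patchE; case: ifP => // _; rewrite lee_fin.
  rewrite Q'E => h.
  transitivity ((q * e)%:E * ((r i / (r i - l))%:E * exponential_prob (r i - l) (A i))).
    rewrite -h [LHS]integral_mkcond; apply: eq_integral => t _; rewrite !patchE indicE.
    have -> : (t \in X i @^-1` A i `&` B) = (t \in X i @^-1` A i) && (t \in B).
      by rewrite in_setI.
    by case: (_ \in _); case: (_ \in _); rewrite /= ?mule1 ?mule0 ?mul0e.
  by rewrite eE EFinM -!muleA; congr (_ * _); rewrite muleC !muleA.
have Q'T : Q' setT = (q * (r i / (r i - l)))%:E.
  have := key (fun=> setT) (fun=> measurableT).
  rewrite expo_setT// mule1 big_seq big1 ?mule1; last first.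
    by move=> j sj; rewrite expo_setT// r0// in_cons sj orbT.
  rewrite (EFinM q) => <-; congr (Q' _); exact/seteqP.
exists Q'; split; [exact: Q'E|exact: Q'T|move=> A mA].
rewrite (key A mA) Q'T big_cons eqxx (EFinM q) -!muleA; congr (_ * (_ * (_ * _))).
apply: eq_big_seq => j sj; rewrite ifF//; apply/negP => /eqP ji.
by rewrite -ji sj in is_.
Qed.

(** The density factorizes, so the variables can be tilted one after the
    other. *)
Lemma indep_exp_tilt Q (q : R) X r s1 s2 (l : R) : Q setT = q%:E ->
  (forall j, measurable_fun setT (X j)) -> uniq (s1 ++ s2) ->
  {in s1 ++ s2, forall j, (0 < r j)%R} -> {in s1, forall j, (l < r j)%R} ->
  indep_exp Q X r (s1 ++ s2) ->
  exists Q' : {measure set T -> \bar R},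
    [/\ forall A, measurable A ->
          Q' A = \int[Q]_(t in A) (expR (l * \sum_(i <- s1) X i t))%:E,
        Q' setT = (q * \prod_(i <- s1) (r i / (r i - l)))%:E &
        indep_exp Q' X (fun j => if j \in s1 then r j - l else r j)%R (s1 ++ s2)].
Proof.
move=> QT mX; elim: s1 s2 => [|i s1 IHs] s2 us r0 lr QX.
  exists Q; split.
  - move=> A mA; under eq_integral do rewrite big_nil mulr0 expR0.
    by rewrite integral_cst// mul1e.
  - by rewrite big_nil mulr1.
  - exact: QX.
have p1 : perm_eq ((i :: s1) ++ s2) (s1 ++ i :: s2).
  by rewrite perm_sym perm_catC/= perm_cons perm_catC.
have [Q1 [Q1E Q1T Q1X]] : exists Q' : {measure set T -> \bar R},
    [/\ forall A, measurable A ->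
          Q' A = \int[Q]_(t in A) (expR (l * \sum_(i <- s1) X i t))%:E,
        Q' setT = (q * \prod_(i <- s1) (r i / (r i - l)))%:E &
        indep_exp Q' X (fun j => if j \in s1 then r j - l else r j)%R (s1 ++ i :: s2)].
  apply: IHs.
  - by rewrite -(perm_uniq p1).
  - by move=> j; rewrite -(perm_mem p1); exact: r0.
  - by move=> j js; apply: lr; rewrite in_cons js orbT.
  - exact: indep_exp_perm QX.
move: us => /= /andP[is12 us12].
have is1 : i \notin s1 by apply: contra is12; rewrite mem_cat => ->.
set r1 := fun j => _ in Q1X.
have r1i : r1 i = r i by rewrite /r1 (negbTE is1).
have Q1X' : indep_exp Q1 X r1 (i :: s1 ++ s2).
  by apply: indep_exp_perm Q1X; rewrite perm_sym.
have r10 : {in i :: s1 ++ s2, forall j, (0 < r1 j)%R}.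
  move=> j js; rewrite /r1; case: ifP => js1; last exact: r0.
  by rewrite subr_gt0 lr// in_cons js1 orbT.
have lri : (l < r1 i)%R by rewrite r1i lr// mem_head.
have [Q' [Q'E Q'T Q'X]] := indep_exp_tilt1 Q1T mX r10 lri is12 Q1X'.
exists Q'; split.
- move=> A mA; rewrite Q'E integral_mkcond.
  have mY : measurable_fun setT (fun t => expR (l * \sum_(i <- s1) X i t)).
    apply: measurableT_comp => //; apply: measurable_funM => //.
    exact: measurable_sum.
  rewrite (ge0_integral_density mY _ Q1E); last 3 first.
  + by move=> t; rewrite expR_ge0.
  + apply/(measurable_restrictT _ _).1; first exact: mA.
    apply: measurable_funTS; apply/measurable_EFinP.
    by apply: measurableT_comp => //; exact: measurable_funM.
  + by move=> t; rewrite patchE; case: ifP => // _; rewrite lee_fin expR_ge0.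
  rewrite [RHS]integral_mkcond; apply: eq_integral => t _.
  rewrite !patchE; case: ifP => _; last by rewrite mul0e.
  by rewrite -EFinM -expRD big_cons mulrDr.
- by rewrite Q'T big_cons r1i; congr (_%:E); rewrite -!mulrA; congr (_ * _)%R; rewrite mulrC mulrA.
- apply: eq_indep_exp Q'X => // j js; rewrite in_cons r1i.
  by case: eqP => [->|_] //=; rewrite /r1.
Qed.

(** The corner flip inside a larger family: restricting the measure to an
    event on the variables in s leaves the three others independent, so
    [corner_flip] applies with the mass of that restriction. The variable of
    index k is used up. *)
Lemma indep_exp_flip Q (q : R) X X' r i j k s : Q setT = q%:E ->
  (forall l, measurable_fun setT (X l)) ->
  uniq [:: i, j, k & s] -> {in [:: i, j, k & s], forall l, (0 < r l)%R} ->
  (r i + r j = 1)%R -> r k = 1%R ->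
  (forall t, X' i t = X k t + Num.max 0 (X i t - X j t))%R ->
  (forall t, X' j t = X k t + Num.max 0 (X j t - X i t))%R ->
  {in s, X =1 X'} ->
  indep_exp Q X r [:: i, j, k & s] -> indep_exp Q X' r [:: i, j & s].
Proof.
move=> QT mX us r0 rij rk X'i X'j X's QX A mA.
have q0 : (0 <= q)%R by rewrite -lee_fin -QT.
have [e e0 eE] : exists2 e : R, (0 <= e)%R &
    \prod_(l <- s) exponential_prob (r l) (A l) = e%:E.
  by apply: prod_expo_fine => // l sl; apply: r0; rewrite !in_cons sl !orbT.
set B := \bigcap_(l in [set` s]) (X l @^-1` A l).
have mB : measurable B by exact: measurable_preimage_bigcap.
move: us => /=; rewrite !in_cons !negb_or => /and4P[/and3P[ij ik is_] /andP[jk js] ks us].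
have law (A1 A2 A3 : set R) : measurable A1 -> measurable A2 -> measurable A3 ->
  mrestr Q mB (X i @^-1` A1 `&` X j @^-1` A2 `&` X k @^-1` A3) = (q * e)%:E *
    (exponential_prob (r i) A1 * exponential_prob (1 - r i) A2 * exponential_prob 1 A3).
  move=> mA1 mA2 mA3.
  pose A' l := if l == i then A1 else if l == j then A2 else if l == k then A3 else A l.
  have mA' l : measurable (A' l) by rewrite /A'; do 3?case: ifP.
  have A'i : A' i = A1 by rewrite /A' eqxx.
  have A'j : A' j = A2 by rewrite /A' eqxx eq_sym (negbTE ij).
  have A'k : A' k = A3.
    by rewrite /A' eqxx ![k == _]eq_sym (negbTE ik) (negbTE jk).
  have A's l : l \in s -> A' l = A l.
    move=> sl; rewrite /A'; case: eqP => [li|_]; first by rewrite -li sl in is_.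
    case: eqP => [lj|_]; first by rewrite -lj sl in js.
    by case: eqP => [lk|//]; rewrite -lk sl in ks.
  have := QX A' mA'; rewrite !preimage_bigcap_cons !big_cons A'i A'j A'k QT.
  rewrite (eq_big_seq (fun l => exponential_prob (r l) (A l))); last first.
    by move=> l sl; rewrite A's.
  have -> : \bigcap_(l in [set` s]) (X l @^-1` A' l) = B.
    by apply/seteqP; split => t h l /= sl; move: (h l sl); rewrite A's.
  rewrite eE /mrestr !setIA => ->.
  have -> : (1 - r i = r j)%R by rewrite -rij addrAC subrr add0r.
  by rewrite rk EFinM -!muleA; congr (_ * _); rewrite [RHS]muleC -!muleA.
have ri1 : (r i < 1)%R by rewrite -rij ltrDl r0// !in_cons eqxx orbT.
have ri0 : (0 < r i)%R by rewrite r0// mem_head.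
have := corner_flip (mulr_ge0 q0 e0) ri0 ri1 (mX i) (mX j) (mX k) law (mA i) (mA j).
have -> : (1 - r i = r j)%R by rewrite -rij addrAC subrr add0r.
rewrite !preimage_bigcap_cons !big_cons QT eE /mrestr => h.
transitivity ((q * e)%:E * (exponential_prob (r i) (A i) * exponential_prob (r j) (A j))).
  rewrite -h setIA; congr (Q _); apply/seteqP; split => t [[h1 h2] h3]; split.
  - by split; rewrite /= -?X'i -?X'j.
  - by move=> l sl; rewrite /= X's//; exact: h3.
  - by split; rewrite /= ?X'i ?X'j.
  - by move=> l sl; rewrite /= -X's//; exact: h3.
by rewrite EFinM -!muleA; congr (_ * _); rewrite [LHS]muleC -!muleA.
Qed.

End indep_exp.

Local Close Scope ereal_scope.

(** * Recursion, comparison and symmetries of last-passage times *)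

Section lpp.
Context (R : realType).
Implicit Types (omega : nat * nat -> R) (u v : nat * nat).

Lemma lpp_first_step omega u u' v : lattice_step u u' ->
  (u'.1 <= v.1)%N -> (u'.2 <= v.2)%N ->
  omega u + lpp omega u' v <= lpp omega u v.
Proof.
move=> st h1 h2; have [pi [p [-> pp lp]] ->] := lpp_attained omega h1 h2.
have : up_right_path u v (u :: u' :: p) by exists (u' :: p); split => //=; rewrite st.
by move=> /(lpp_ub omega); rewrite big_cons.
Qed.

Lemma lpp_first_step_ex omega u v : (u.1 <= v.1)%N -> (u.2 <= v.2)%N -> u != v ->
  exists u', [/\ lattice_step u u', (u'.1 <= v.1)%N, (u'.2 <= v.2)%N &
    lpp omega u v <= omega u + lpp omega u' v].
Proof.
move=> h1 h2 uv; have [pi [[|u' p] [-> pp lp]] ->] := lpp_attained omega h1 h2.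
  by move: uv; rewrite -lp eqxx.
move: pp => /= /andP[st pp].
have /andP[k1 k2] := path_last_ge pp (mem_head u' p).
exists u'; rewrite -lp /=; split => //; rewrite big_cons lerD2l; apply: lpp_ub.
by exists p; split.
Qed.

Lemma lpp_last_step omega u w v : lattice_step w v ->
  (u.1 <= w.1)%N -> (u.2 <= w.2)%N ->
  lpp omega u w + omega v <= lpp omega u v.
Proof.
move=> st h1 h2; have [pi [p [-> pp lp]] ->] := lpp_attained omega h1 h2.
have : up_right_path u v (rcons (u :: p) v).
  by exists (rcons p v); split => //; rewrite ?rcons_path ?last_rcons ?pp ?lp.
by move=> /(lpp_ub omega); rewrite -cats1 big_cat big_seq1.
Qed.

Lemma lpp_last_step_ex omega u v : (u.1 <= v.1)%N -> (u.2 <= v.2)%N -> u != v ->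
  exists w, [/\ lattice_step w v, (u.1 <= w.1)%N, (u.2 <= w.2)%N &
    lpp omega u v <= lpp omega u w + omega v].
Proof.
move=> h1 h2 uv; have [pi [p [-> pp lp]] ->] := lpp_attained omega h1 h2.
case: (lastP p) pp lp => [|q x] pp; first by move=> /= e; rewrite e eqxx in uv.
rewrite last_rcons => xv; move: pp; rewrite xv rcons_path => /andP[pq st].
exists (last u q); have /andP[k1 k2] := path_ge pq (mem_last u q); split => //.
rewrite -rcons_cons -cats1 big_cat big_seq1 /= lerD2r; apply: lpp_ub.
by exists q.
Qed.

Lemma lpp_point omega u : lpp omega u u = omega u.
Proof.
have [pi [p [-> pp lp]] ->] := lpp_attained omega (leqnn u.1) (leqnn u.2).
have := path_size pp; rewrite lp -[LHS]addn0 => /addnI/esym/size0nil ->.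
by rewrite big_seq1.
Qed.

Lemma lpp_corner omega u i j : (u.1 <= i)%N -> (u.2 <= j)%N ->
  lpp omega u (i.+1, j.+1) =
  omega (i.+1, j.+1) + Num.max (lpp omega u (i, j.+1)) (lpp omega u (i.+1, j)).
Proof.
move=> ui uj; apply/eqP; rewrite eq_le addrC; apply/andP; split; last first.
  rewrite -lerBrDr ge_max; apply/andP; split; rewrite lerBrDr lpp_last_step//=.
  - by rewrite /lattice_step/= eqxx.
  - exact: leqW.
  - by rewrite /lattice_step/= eqxx orbT.
  - exact: leqW.
have [||| w [st w1 w2 h]] := @lpp_last_step_ex omega u (i.+1, j.+1) => /=.
- exact: leqW.
- exact: leqW.
- by apply/eqP => e; rewrite e ltnn in ui.
rewrite (le_trans h)// lerD2r le_max.
case/orP: st => /eqP [e1 e2]; rewrite e1 e2 -surjective_pairing lexx ?orbT//.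
Qed.

Lemma lpp_row omega u i : (u.1 <= i)%N ->
  lpp omega u (i.+1, u.2) = omega (i.+1, u.2) + lpp omega u (i, u.2).
Proof.
move=> ui; apply/eqP; rewrite eq_le addrC; apply/andP; split; last first.
  by apply: lpp_last_step => //; rewrite /lattice_step/= eqxx.
have [||| w [st w1 w2 h]] := @lpp_last_step_ex omega u (i.+1, u.2) => //=.
- exact: leqW.
- by apply/eqP => e; rewrite e ltnn in ui.
rewrite (le_trans h)// lerD2r.
case/orP: st => /eqP [e1 e2]; first by rewrite e1 e2 -surjective_pairing.
by rewrite e2 ltnn in w2.
Qed.

Lemma lpp_col omega u j : (u.2 <= j)%N ->
  lpp omega u (u.1, j.+1) = omega (u.1, j.+1) + lpp omega u (u.1, j).
Proof.
move=> uj; apply/eqP; rewrite eq_le addrC; apply/andP; split; last first.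
  by apply: lpp_last_step => //; rewrite /lattice_step/= eqxx orbT.
have [||| w [st w1 w2 h]] := @lpp_last_step_ex omega u (u.1, j.+1) => //=.
- exact: leqW.
- by apply/eqP => e; rewrite e ltnn in uj.
rewrite (le_trans h)// lerD2r.
case/orP: st => /eqP [e1 e2]; last by rewrite e1 e2 -surjective_pairing.
by rewrite e1 ltnn in w1.
Qed.

Definition hinc omega u i j := lpp omega u (i.+1, j) - lpp omega u (i, j).
Definition vinc omega u i j := lpp omega u (i, j.+1) - lpp omega u (i, j).

(** In terms of increments the recursion at a corner is the corner flip: the
    increments on the left and bottom sides of a cell and the weight at its
    upper right corner determine those on the top and right sides. *)
Lemma hinc_corner omega u i j : (u.1 <= i)%N -> (u.2 <= j)%N ->
  hinc omega u i j.+1 = omega (i.+1, j.+1) +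
    Num.max 0 (hinc omega u i j - vinc omega u i j).
Proof.
move=> ui uj; rewrite /hinc /vinc lpp_corner// -addrA; congr (_ + _).
by rewrite addr_maxl subrr; congr (Num.max _ _); ring.
Qed.

Lemma vinc_corner omega u i j : (u.1 <= i)%N -> (u.2 <= j)%N ->
  vinc omega u i.+1 j = omega (i.+1, j.+1) +
    Num.max 0 (vinc omega u i j - hinc omega u i j).
Proof.
move=> ui uj; rewrite /hinc /vinc lpp_corner// -addrA; congr (_ + _).
by rewrite addr_maxl subrr maxC; congr (Num.max _ _); ring.
Qed.

(** Lowering the starting point from (1, 1) to (1, 0) increases horizontal
    increments and decreases vertical ones. The recursion is monotone in the
    horizontal increment and antitone in the vertical one, and the comparison
    holds on the first row, where the increment from (1, 1) is a single
    weight. *)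
Lemma inc_compare omega i j :
  hinc omega (1%N, 1%N) i.+1 j.+1 <= hinc omega (1%N, 0%N) i.+1 j.+1 /\
  vinc omega (1%N, 0%N) i.+1 j.+1 <= vinc omega (1%N, 1%N) i.+1 j.+1.
Proof.
have vstep j' : (forall i', hinc omega (1%N, 1%N) i'.+1 j'.+1 <=
      hinc omega (1%N, 0%N) i'.+1 j'.+1) ->
    forall i', vinc omega (1%N, 0%N) i'.+1 j'.+1 <= vinc omega (1%N, 1%N) i'.+1 j'.+1.
  move=> hj; elim=> [|i' IH].
    rewrite /vinc (@lpp_col omega (1%N, 0%N) j'.+1)// (@lpp_col omega (1%N, 1%N) j'.+1)//=.
    by rewrite !addrK.
  rewrite (@vinc_corner omega (1%N, 0%N) i'.+1 j'.+1)//.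
  rewrite (@vinc_corner omega (1%N, 1%N) i'.+1 j'.+1)// lerD2l.
  rewrite ge_max !le_max lexx/=; apply/orP; right.
  by rewrite lerD// lerN2.
elim: j i => [|j IH] i; last first.
  have h i' : hinc omega (1%N, 1%N) i'.+1 j.+2 <= hinc omega (1%N, 0%N) i'.+1 j.+2.
    rewrite (@hinc_corner omega (1%N, 0%N) i'.+1 j.+1)//.
    rewrite (@hinc_corner omega (1%N, 1%N) i'.+1 j.+1)// lerD2l.
    rewrite ge_max !le_max lexx/=; apply/orP; right.
    by have [? ?] := IH i'; rewrite lerD// lerN2.
  by split => //; exact: vstep.
have h i' : hinc omega (1%N, 1%N) i'.+1 1 <= hinc omega (1%N, 0%N) i'.+1 1.
  rewrite (@hinc_corner _ (1%N, 0%N))// /hinc (@lpp_row omega (1%N, 1%N) i'.+1)//=.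
  by rewrite addrK lerDl le_max lexx.
by split => //; exact: vstep.
Qed.

Lemma lpp_diff_compare omega i k j :
  lpp omega (1%N, 1%N) ((i + k).+1, j.+1) - lpp omega (1%N, 1%N) (i.+1, j.+1) <=
  lpp omega (1%N, 0%N) ((i + k).+1, j.+1) - lpp omega (1%N, 0%N) (i.+1, j.+1).
Proof.
elim: k => [|k IH]; first by rewrite addn0 !subrr.
have [h _] := inc_compare omega (i + k) j; move: h IH; rewrite /hinc addnS; lra.
Qed.

(** A map on paths that preserves weights gives one inequality; a symmetry of
    the lattice gives both. *)
Lemma lpp_path_map omega omega' u v u' v' (f : seq (nat * nat) -> seq (nat * nat)) :
  (u.1 <= v.1)%N -> (u.2 <= v.2)%N ->
  (forall pi, up_right_path u v pi -> up_right_path u' v' (f pi) /\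
     \sum_(p <- f pi) omega' p = \sum_(p <- pi) omega p) ->
  lpp omega u v <= lpp omega' u' v'.
Proof.
move=> h1 h2 fP; have [pi piP ->] := lpp_attained omega h1 h2.
by have [fpi <-] := fP _ piP; exact: lpp_ub.
Qed.

Definition transpose (p : nat * nat) := (p.2, p.1).

Lemma transposeK : involutive transpose. Proof. by case. Qed.

Lemma lpp_transpose omega u v : (u.1 <= v.1)%N -> (u.2 <= v.2)%N ->
  lpp (omega \o transpose) (transpose u) (transpose v) = lpp omega u v.
Proof.
have aux omega' u' v' : (u'.1 <= v'.1)%N -> (u'.2 <= v'.2)%N ->
    lpp omega' u' v' <= lpp (omega' \o transpose) (transpose u') (transpose v').
  move=> h1 h2; apply: (@lpp_path_map _ _ _ _ _ _ (map transpose)) => //.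
  move=> _ [p [-> pp lp]]; split; last first.
    by rewrite big_map; apply: eq_bigr => q _ /=; rewrite transposeK.
  exists (map transpose p); split => //=; last by rewrite last_map lp.
  rewrite path_map; apply: sub_path pp => -[a b] [c e]; rewrite /lattice_step /transpose/=.
  by rewrite orbC => /orP[]/eqP[-> ->]; rewrite eqxx ?orbT.
move=> h1 h2; apply/eqP; rewrite eq_le; apply/andP; split; last exact: aux.
have := @aux (omega \o transpose) (transpose u) (transpose v) h2 h1.
rewrite !transposeK => /le_trans; apply.
by rewrite le_eqVlt (@eq_lpp _ _ omega) ?eqxx// => p _ _ /=; rewrite transposeK.
Qed.

(** The half-turn of the rectangle with corners (1, 1) and v. *)
Definition reflect_pt (v p : nat * nat) := ((v.1.+1 - p.1)%N, (v.2.+1 - p.2)%N).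

(** The half-turn reverses paths, so it exchanges the roles of starting and
    end points. *)
Lemma lpp_reflect omega m n (u : nat * nat) :
  (0 < u.1)%N -> (0 < u.2)%N -> (u.1 <= m)%N -> (u.2 <= n)%N ->
  lpp (omega \o reflect_pt (m, n)) (1%N, 1%N) (reflect_pt (m, n) u) =
  lpp omega u (m, n).
Proof.
set f := reflect_pt (m, n).
have fK p : (p.1 <= m)%N -> (p.2 <= n)%N -> f (f p) = p.
  by case: p => a b; rewrite /f /reflect_pt/= => h1 h2; congr pair; lia.
have step p q : (q.1 <= m)%N -> (q.2 <= n)%N -> lattice_step p q -> lattice_step (f q) (f p).
  case: p q => [a b] [c e] /= h1 h2; rewrite /lattice_step /f /reflect_pt/=.
  by move=> /orP[]/eqP[ec ee]; rewrite ec in h1 *; rewrite ee in h2 *;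
    apply/orP; [left|right]; apply/eqP; congr pair; lia.
have aux omega' u' v' : (u'.1 <= v'.1)%N -> (u'.2 <= v'.2)%N ->
    (v'.1 <= m)%N -> (v'.2 <= n)%N ->
    lpp omega' u' v' <= lpp (omega' \o f) (f v') (f u').
  move=> h1 h2 h3 h4.
  apply: (@lpp_path_map _ _ _ _ _ _ (fun s => rev (map f s))) => //.
  move=> _ [p [-> pp lp]].
  have bd q : q \in u' :: p -> (q.1 <= m)%N /\ (q.2 <= n)%N.
    move=> /(path_last_ge pp); rewrite lp => /andP[k1 k2].
    by split; [exact: leq_trans h3|exact: leq_trans h4].
  have sumE : \sum_(q <- rev (map f (u' :: p))) (omega' \o f) q = \sum_(q <- u' :: p) omega' q.
    rewrite (perm_big (map f (u' :: p))) ?perm_rev// big_map.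
    by apply: eq_big_seq => q /bd[? ?]; rewrite /= fK.
  split; last exact: sumE.
  have rE : rev (map f (u' :: p)) = f v' :: rev (belast (f u') (map f p)).
    by rewrite /= lastI rev_rcons last_map lp.
  exists (rev (belast (f u') (map f p))); split => //; last first.
    by have := rE; rewrite -lp -last_map; case: (map f p) => //= y s _; rewrite rev_cons last_rcons.
  rewrite -lp -last_map rev_path path_map.
  elim: p u' pp {h1 h2 lp sumE rE} bd => //= y p IH x /andP[xy pyp] bd.
  have [y1 y2] : (y.1 <= m)%N /\ (y.2 <= n)%N by apply: bd; rewrite !inE eqxx orbT.
  rewrite step//=; apply: IH => //.
  by move=> q qp; apply: bd; rewrite in_cons qp orbT.
move=> u1 u2 um un; apply/eqP; rewrite eq_le; apply/andP; split; last first.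
  have := aux omega u (m, n) um un (leqnn _) (leqnn _).
  by rewrite {2}/f /reflect_pt/= !subSnn.
have := aux (omega \o f) (1%N, 1%N) (f u).
rewrite fK// => /(_ _ _ _ _)/le_trans; apply.
- by rewrite /f /reflect_pt/= subn_gt0 ltnS.
- by rewrite /f /reflect_pt/= subn_gt0 ltnS.
- by rewrite /f /reflect_pt/=; lia.
- by rewrite /f /reflect_pt/=; lia.
have -> : f (1%N, 1%N) = (m, n) by rewrite /f /reflect_pt/= !subn1.
have [pi [p [piE pp lp]] ->] := @lpp_attained _ (omega \o f \o f) u (m, n) um un.
apply: (@le_trans _ _ (\sum_(p <- pi) omega p)); last by apply: lpp_ub; exists p.
rewrite piE le_eqVlt; apply/orP; left; apply/eqP; apply: eq_big_seq => q /(path_last_ge pp).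
by rewrite lp => /andP[? ?]; rewrite /= fK.
Qed.

End lpp.

(** A finite maximum of finite sums; when v is not reachable from u it is the
    constant value of the supremum of the empty set. *)
Lemma measurable_lpp d (T : measurableType d) (R : realType)
    (omega : nat * nat -> T -> R) (u v : nat * nat) :
  (forall p, (u.1 <= p.1)%N -> (u.2 <= p.2)%N -> measurable_fun setT (omega p)) ->
  measurable_fun setT (fun t => lpp (omega ^~ t) u v).
Proof.
move=> mo; have [uv|uv] := boolP ((u.1 <= v.1)%N && (u.2 <= v.2)%N); last first.
  rewrite (_ : (fun _ => _) = fun=> sup set0); first exact: measurable_cst.
  apply/funext => t; rewrite /lpp; congr sup; apply/seteqP; split => // z [pi [p [_ pp lp]] _].
  have := path_ge pp (mem_last u p); rewrite lp => h.
  by rewrite h in uv.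
case/andP: uv => u1 u2.
have [X XE] := (iffLR (finite_seqP _)) (finite_up_right_path u v).
have [pi0 pi0P] := up_right_path_nonempty u1 u2.
have mX pi : up_right_path u v pi ->
    measurable_fun setT (fun t => \sum_(p <- pi) omega p t).
  move=> [p [-> pp lp]].
  rewrite (_ : (fun _ => _) = fun t => \sum_(q <- u :: p)
     (if (u.1 <= q.1)%N && (u.2 <= q.2)%N then omega q t else 0)).
    apply: measurable_sum => q.
    have [/andP[? ?]|_] := boolP ((u.1 <= q.1)%N && (u.2 <= q.2)%N); first exact: mo.
    exact: measurable_cst.
  by apply/funext => t; apply: eq_big_seq => q /(path_ge pp) ->.
rewrite (_ : (fun _ => _) = fun t => \big[Num.max/(\sum_(p <- pi0) omega p t)]_(pi <- X)
    (\sum_(p <- pi) omega p t)).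
  have : {subset X <= X} by [].
  elim: {1 3}X => [|pi s IH] sX.
    by under eq_fun do rewrite big_nil; exact: mX.
  under eq_fun do rewrite big_cons; apply: measurable_maxr.
    by apply: mX; rewrite XE /=; apply: sX; rewrite mem_head.
  by apply: IH => pi' pi's; apply: sX; rewrite in_cons pi's orbT.
apply/funext => t; apply/eqP; rewrite eq_le; apply/andP; split.
  have [pi piP ->] := lpp_attained (omega ^~ t) u1 u2.
  by apply: le_bigmax_seq => //; move: piP; rewrite XE.
rewrite big_seq; apply: (big_ind (fun x => x <= lpp (omega ^~ t) u v)) => [|x y|pi piX].
- exact: (@lpp_ub _ (omega ^~ t) u v pi0).
- by rewrite ge_max => -> ->.
- by apply: (@lpp_ub _ (omega ^~ t) u v pi); rewrite XE.
Qed.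

(** * The Burke property *)

(** The origin carries the weight 0 and is not a random variable of the model. *)
Definition rect (m n : nat) : seq (nat * nat) :=
  [seq p <- allpairs pair (iota 0 m.+1) (iota 0 n.+1) | p != (0%N, 0%N)].

Lemma mem_rect m n p : (p \in rect m n) =
  [&& p != (0%N, 0%N), (p.1 <= m)%N & (p.2 <= n)%N].
Proof.
rewrite mem_filter; congr (_ && _); apply/allpairsP/andP => [[[i j] [im jn ->]]|[pm pn]].
  by move: im jn; rewrite !mem_iota !add0n !ltnS.
by exists p; rewrite !mem_iota !add0n !ltnS -surjective_pairing.
Qed.

Lemma rect_uniq m n : uniq (rect m n).
Proof.
apply: filter_uniq; apply: allpairs_uniq; rewrite ?iota_uniq//.
by move=> [a b] [c e] _ _ [-> ->].
Qed.

Definition boundary_rate (R : realType) (w z : R) (p : nat * nat) : R :=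
  if p.2 == 0%N then w else if p.1 == 0%N then 1 - z else 1.

Section burke.
Context d (T : measurableType d) (R : realType) (Q : {measure set T -> \bar R}).
Variables (q rho : R) (m n : nat) (omega : nat * nat -> T -> R).
Hypotheses (QT : Q setT = q%:E) (rho0 : 0 < rho) (rho1 : rho < 1).
Hypothesis mo : forall p, measurable_fun setT (omega p).
Hypothesis indep : indep_exp Q omega (boundary_rate rho rho) (rect m n).

Let o : nat * nat := (0%N, 0%N).

(** The variables present when the sweep has treated the rows up to j and the
    first a cells of the next one. The increment across column i.+1 along the
    current staircase is stored in the slot (i.+1, 0), and the vertical
    increment of the current row in the slot (0, j.+1): an increment occupies
    the slot of the axis weight with the same law, so that the rates never
    change during the sweep. *)
Let Z a j p t : R :=
  match p with
  | (i.+1, 0%N) => if (i < a)%N then hinc (omega ^~ t) o i j.+1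
                   else hinc (omega ^~ t) o i j
  | (0%N, j'.+1) => if j' == j then vinc (omega ^~ t) o a j else omega p t
  | _ => omega p t
  end.

(** The slots still in use: all columns, the remaining vertical slots, and the
    bulk weights not yet swept. *)
Let alive a j (p : nat * nat) := (p.2 == 0%N) ||
  (j < p.2)%N && [|| p.1 == 0%N, (j.+1 < p.2)%N | (a < p.1)%N].

Let S a j := [seq p <- rect m n | alive a j p].

Let mhinc i j : measurable_fun setT (fun t => hinc (omega ^~ t) o i j).
Proof. by apply: measurable_funB; apply: measurable_lpp. Qed.

Let mvinc i j : measurable_fun setT (fun t => vinc (omega ^~ t) o i j).
Proof. by apply: measurable_funB; apply: measurable_lpp. Qed.

Let mZ a j p : measurable_fun setT (Z a j p).
Proof.
case: p => [[|i] [|j']]; rewrite /Z; try exact: mo.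
- by case: (j' == j).
- by case: (i < a)%N.
Qed.

Let rate_gt0 p : 0 < boundary_rate rho rho p.
Proof. by rewrite /boundary_rate; do 2?case: ifP => _ //; rewrite subr_gt0. Qed.

Let mem_S a j p : (p \in S a j) =
  alive a j p && [&& p != (0%N, 0%N), (p.1 <= m)%N & (p.2 <= n)%N].
Proof. by rewrite mem_filter mem_rect. Qed.

Let S_uniq a j : uniq (S a j).
Proof. exact/filter_uniq/rect_uniq. Qed.

(** One corner flip moves the staircase across the cell of upper right corner
    (a.+1, j.+1) and uses up its bulk weight. *)
Let burke_step a j : (a < m)%N -> (j < n)%N ->
  indep_exp Q (Z a j) (boundary_rate rho rho) (S a j) ->
  indep_exp Q (Z a.+1 j) (boundary_rate rho rho) (S a.+1 j).
Proof.
move=> am jn QZ.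
pose i0 := (a.+1, 0%N); pose j0 := (0%N, j.+1); pose k0 := (a.+1, j.+1).
pose s := [seq p <- S a j | p \notin [:: i0; j0; k0]].
have us : uniq [:: i0, j0, k0 & s].
  have sP p : p \in [:: i0; j0; k0] -> p \notin s by rewrite mem_filter => ->.
  have /= -> := filter_uniq (fun p => p \notin [:: i0; j0; k0]) (S_uniq a j).
  rewrite !in_cons !negb_or !sP ?inE ?eqxx ?orbT//= !andbT.
  by rewrite /i0 /j0 /k0 !xpair_eqE/= !andbF.
have pS : perm_eq (S a j) [:: i0, j0, k0 & s].
  apply: uniq_perm => // p; rewrite !in_cons [p \in s]mem_filter !in_cons in_nil orbF.
  have [->|_] := eqVneq p i0.
    by rewrite mem_S /alive/= am.
  have [->|_] := eqVneq p j0; first by rewrite mem_S /alive/= jn ltnSn.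
  have [->|//] := eqVneq p k0; first by rewrite mem_S /alive/= am jn !ltnSn orbT.
have := indep_exp_flip QT (mZ a j) us _ _ _ _ _ _ (indep_exp_perm pS QZ).
move=> /(_ (Z a.+1 j)) H.
apply: (@indep_exp_subset _ _ _ _ _ _ _ [:: i0, j0 & s]) => //.
- move: us; rewrite /= !in_cons !negb_or.
  by move=> /andP[/and3P[-> _ ->] /andP[/andP[_ ->] /andP[_ ->]]].
- move=> p; rewrite !in_cons [p \in s]mem_filter !mem_S => /andP[al pr].
  have [//|pi0] := eqVneq p i0; have [//|pj0] := eqVneq p j0.
  rewrite /= !in_cons in_nil orbF !negb_or pi0 pj0 pr/= andbT.
  move: al; rewrite /alive; case: (p) => [p1 p2] /=.
  rewrite /k0 xpair_eqE; lia.
- apply: H => //.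
  + by rewrite /boundary_rate/= addrC subrK.
  + by move=> t; rewrite /Z/= ltnn ltnSn eqxx; exact: hinc_corner.
  + by move=> t; rewrite /Z/= ltnn eqxx; exact: vinc_corner.
  + move=> p; rewrite mem_filter !in_cons in_nil orbF !negb_or => /andP[/and3P[pi pj _] _].
    apply/funext => t.
    case: p pi pj => [[|i] [|j']] pi pj; rewrite /Z //.
      have -> : (j' == j) = false by apply/negbTE; apply: contra pj => /eqP ->.
      by [].
    rewrite ltnS [(i <= a)%N]leq_eqVlt; case: eqP => [ia|_] //=.
    by move: pi; rewrite ia eqxx.
Qed.

(** At the end of a row the vertical increment leaves the rectangle and is
    forgotten; that of the next row starts as the weight on the vertical axis. *)
Let burke_row j : (j < n)%N ->
  indep_exp Q (Z 0 j) (boundary_rate rho rho) (S 0 j) ->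
  indep_exp Q (Z 0 j.+1) (boundary_rate rho rho) (S 0 j.+1).
Proof.
move=> jn QZ.
have : indep_exp Q (Z m j) (boundary_rate rho rho) (S m j).
  have : (m <= m)%N by [].
  elim: {1 3 4}m => [//|a IH] am; apply: burke_step => //; exact/IH/ltnW.
move=> QZm.
have QZm' : indep_exp Q (Z m j) (boundary_rate rho rho) (S 0 j.+1).
  apply: indep_exp_subset QZm => // p; rewrite !mem_S /alive; lia.
apply: eq_indep_exp QZm' => // p; rewrite mem_S /alive /Z => /andP[al /and3P[_ pm _]].
apply/funext => t.
case: p al pm => [[|i] [|j']]//=.
  move=> jj' _; rewrite gtn_eqF; last by lia.
  by case: eqP => // ->; rewrite /vinc (@lpp_col _ _ o)// addrK.
by move=> _ ->.
Qed.

(** The Burke property. On the axes the increments are the weights themselves;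
    every cell is crossed by a corner flip, which preserves independence and
    rates; at the end the staircase is the top side. *)
Lemma top_row_indep : indep_exp Q (fun i t => hinc (omega ^~ t) (0%N, 0%N) i n)
  (fun=> rho) (iota 0 m).
Proof.
have base : indep_exp Q (Z 0 0) (boundary_rate rho rho) (S 0 0).
  have QS : indep_exp Q omega (boundary_rate rho rho) (S 0 0).
    apply: indep_exp_subset indep => //; first exact: rect_uniq.
    by move=> p; rewrite mem_S mem_rect => /andP[].
  apply: eq_indep_exp QS => // p _; apply/funext => t; rewrite /Z.
  case: p => [[|i] [|j']]//=; last by rewrite /hinc (@lpp_row _ _ o)// addrK.
  by case: eqP => // ->; rewrite /vinc (@lpp_col _ _ o)// addrK.
have : indep_exp Q (Z 0 n) (boundary_rate rho rho) (S 0 n).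
  have : (n <= n)%N by [].
  elim: {1 3 4}n => [//|j IH] jn; apply: burke_row => //; exact/IH/ltnW.
move=> QZ.
pose f i := (i.+1, 0%N).
have Qf : indep_exp Q (Z 0 n) (boundary_rate rho rho) (map f (iota 0 m)).
  apply: indep_exp_subset QZ => //.
    by rewrite map_inj_uniq ?iota_uniq// => i i' [].
  move=> _ /mapP[i im ->]; rewrite mem_S /alive/=.
  by move: im; rewrite mem_iota add0n => /andP[_ ->].
have finj : {in iota 0 m &, injective f} by move=> i i' _ _ [].
have := indep_exp_map finj Qf; apply: eq_indep_exp => i _ //.
Qed.

End burke.

(** * Markov, Chernoff and Paley-Zygmund bounds *)

Section tails.
Context d (T : measurableType d) (R : realType) (Q : {measure set T -> \bar R}).

Lemma measurable_ge (X : T -> R) (a : R) : measurable_fun setT X ->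
  measurable [set t | a <= X t].
Proof.
move=> mX; have -> : [set t | a <= X t] = X @^-1` `[a, +oo[%classic.
  by apply/seteqP; split => t /=; rewrite in_itv/= andbT.
exact: measurable_preimage.
Qed.

Lemma measurable_lt (X : T -> R) (a : R) : measurable_fun setT X ->
  measurable [set t | X t < a].
Proof.
move=> mX; have -> : [set t | X t < a] = X @^-1` `]-oo, a[%classic.
  by apply/seteqP; split => t /=; rewrite in_itv/=.
exact: measurable_preimage.
Qed.

Lemma ge0_integral_EFinZ (f : T -> R) (c : R) : measurable_fun setT f ->
  (forall t, 0 <= f t) -> 0 <= c ->
  (c%:E * \int[Q]_t (f t)%:E = \int[Q]_t (c * f t)%:E)%E.
Proof.
move=> mf f0 c0; rewrite -ge0_integralZl//; first exact/measurable_EFinP.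
by move=> t _; rewrite lee_fin.
Qed.

Lemma ge0_integral_EFinD (f g : T -> R) : measurable_fun setT f ->
  (forall t, 0 <= f t) -> measurable_fun setT g -> (forall t, 0 <= g t) ->
  (\int[Q]_t (f t)%:E + \int[Q]_t (g t)%:E = \int[Q]_t (f t + g t)%:E)%E.
Proof.
move=> mf f0 mg g0; rewrite -ge0_integralD//.
- by move=> t _; rewrite lee_fin.
- exact/measurable_EFinP.
- by move=> t _; rewrite lee_fin.
- exact/measurable_EFinP.
Qed.

Lemma le_integral_EFin (f g : T -> R) : measurable_fun setT f ->
  measurable_fun setT g -> (forall t, 0 <= f t) -> (forall t, f t <= g t) ->
  (\int[Q]_t (f t)%:E <= \int[Q]_t (g t)%:E)%E.
Proof.
move=> mf mg f0 fg; apply: ge0_le_integral => //.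
- by move=> t _; rewrite lee_fin.
- exact/measurable_EFinP.
- exact/measurable_EFinP.
- by move=> t _; rewrite lee_fin.
Qed.

(** Markov's inequality, for an event on which Y is only known to be at least
    c. *)
Lemma measure_le_integral (Y : T -> R) (A : set T) (c : R) :
  measurable_fun setT Y -> measurable A -> (forall t, 0 <= Y t) -> 0 < c ->
  (forall t, A t -> c <= Y t) ->
  (Q A <= (c^-1)%:E * \int[Q]_t (Y t)%:E)%E.
Proof.
move=> mY mA Y0 c0 AY.
have -> : (Q A = \int[Q]_t (\1_A t)%:E)%E by rewrite integral_indic// setIT.
have c0' : 0 <= c^-1 by rewrite invr_ge0 ltW.
rewrite (ge0_integral_EFinZ mY Y0 c0').
apply: le_integral_EFin => //; first exact: measurable_funM.
move=> t; rewrite indicE; case: (boolP (t \in A)) => [|_].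
  by rewrite inE => /AY h /=; rewrite mulrC ler_pdivlMr// mul1r.
by rewrite /= mulr_ge0// invr_ge0 ltW.
Qed.

Lemma chernoff_le (X : T -> R) (a c e : R) : measurable_fun setT X -> 
  (\int[Q]_t (expR (a * X t))%:E = e%:E)%E -> 0 < a ->
  (Q [set t | (c <= X t)%R] <= (e * expR (- (a * c)))%:E)%E.
Proof.
move=> mX XE a0.
rewrite [e * _]mulrC expRN EFinM -XE; apply: measure_le_integral.
- by apply: measurableT_comp => //; exact: measurable_funM.
- exact: measurable_ge.
- by move=> t; exact: expR_ge0.
- exact: expR_gt0.
- by move=> t /= ct; rewrite ler_expR ler_pM2l.
Qed.

(** The event where Y reaches half its mean a, in terms of the second moment
    b. The proof integrates the pointwise bound Y <= a / 2 + a / (4 b)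
    Y^2 + (b / a) 1_A, which off A is trivial and on A is a completed square. *)
Lemma paley_zygmund (Y : T -> R) (q a b : R) : measurable_fun setT Y ->
  (forall t, 0 <= Y t) -> Q setT = q%:E -> 0 < a -> 0 < b ->
  (\int[Q]_t (Y t)%:E = (q * a)%:E)%E ->
  (\int[Q]_t (Y t ^+ 2)%:E = (q * b)%:E)%E ->
  ((q * (a ^+ 2 / (4 * b)))%:E <= Q [set t | (a / 2 <= Y t)%R])%E.
Proof.
move=> mY Y0 QT a0 b0 E1 E2; pose A := [set t | a / 2 <= Y t].
have mA : measurable A by exact: measurable_ge.
have q0 : 0 <= q by rewrite -lee_fin -QT.
have QAoo : Q A \is a fin_num.
  rewrite ge0_fin_numE// (@le_lt_trans _ _ (Q setT))// ?le_measure ?inE//.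
  by rewrite QT ltry.
have mY2 : measurable_fun setT (fun t => Y t ^+ 2) by exact: measurable_funX.
have main : (\int[Q]_t (Y t)%:E <=
    (a / 2)%:E * Q setT + ((a / (4 * b))%:E * \int[Q]_t (Y t ^+ 2)%:E +
      (b / a)%:E * Q A))%E.
  have c1 : 0 <= a / (4 * b) by rewrite divr_ge0// ?mulr_ge0// ltW.
  have c2 : 0 <= b / a by rewrite divr_ge0// ltW.
  have c3 : 0 <= a / 2 by rewrite divr_ge0// ltW.
  have m1 : measurable_fun setT (fun t => a / (4 * b) * Y t ^+ 2) by exact: measurable_funM.
  have m2 : measurable_fun setT (fun t => b / a * \1_A t) by exact: measurable_funM.
  have -> : (Q A = \int[Q]_t (\1_A t)%:E)%E by rewrite integral_indic// setIT.
  have m3 : measurable_fun setT (fun t => a / (4 * b) * Y t ^+ 2 + b / a * \1_A t).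
    exact: (measurable_funD m1 m2).
  have y1 t : 0 <= a / (4 * b) * Y t ^+ 2 by rewrite mulr_ge0// sqr_ge0.
  have y2 t : 0 <= b / a * \1_A t by rewrite mulr_ge0.
  have y3 t : 0 <= a / (4 * b) * Y t ^+ 2 + b / a * \1_A t by rewrite addr_ge0.
  have <- : (\int[Q]_t (cst (a / 2) t)%:E = (a / 2)%:E * Q setT)%E.
    exact: (integral_cst Q (@measurableT _ T) (a / 2)%:E).
  rewrite (ge0_integral_EFinZ mY2 (fun t => sqr_ge0 _) c1).
  rewrite (@ge0_integral_EFinZ (\1_A))// (ge0_integral_EFinD m1 y1 m2 y2).
  rewrite (@ge0_integral_EFinD (cst (a / 2)) _ _ (fun=> c3) m3 y3)//.
  apply: le_integral_EFin => //; first exact: measurable_funD.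
  move=> t; rewrite indicE /=.
  case: (boolP (t \in A)) => [tA|]; rewrite ?mulr1 ?mulr0 ?addr0; last first.
    rewrite notin_setE /A/= => /negP; rewrite -ltNge => h.
    by apply: (le_trans (ltW h)); rewrite lerDl mulr_ge0// sqr_ge0.
  have : 0 <= (a / (2 * b) * Y t - 1) ^+ 2 * (b / a).
    by rewrite mulr_ge0// sqr_ge0.
  have -> : (a / (2 * b) * Y t - 1) ^+ 2 * (b / a) =
      a / (4 * b) * Y t ^+ 2 + b / a - Y t.
    by field; rewrite ?gt_eqF.
  by rewrite subr_ge0 => /le_trans; apply; rewrite lerDr.
move: main; rewrite E1 E2 QT -(fineK QAoo) -!EFinM -!EFinD !lee_fin.
set x := fine _ => h.
have -> : q * (a ^+ 2 / (4 * b)) = (q * a / 4) / (b / a).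
  by field; rewrite ?gt_eqF.
rewrite ler_pdivrMr ?divr_gt0//.
have e1 : a / (4 * b) * (q * b) = q * a / 4 by field; rewrite gt_eqF.
rewrite e1 in h; lra.
Qed.

End tails.

(** * Exponential moments and mean of the passage time with boundary *)

Lemma sum_exp_mgf d (T : measurableType d) (R : realType) (I : eqType)
    (Q : {measure set T -> \bar R}) (q l : R) (X : I -> T -> R) (r : I -> R) s :
  Q setT = q%:E -> (forall j, measurable_fun setT (X j)) -> uniq s ->
  {in s, forall j, 0 < r j} -> {in s, forall j, l < r j} ->
  indep_exp Q X r s ->
  (\int[Q]_t (expR (l * \sum_(i <- s) X i t))%:E =
   (q * \prod_(i <- s) (r i / (r i - l)))%:E)%E.
Proof.
move=> QT mX us r0 lr QX.
have := @indep_exp_tilt _ _ _ _ Q q X r s [::] l; rewrite !cats0.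
move=> /(_ QT mX us r0 lr QX) [Q' [Q'E Q'T _]].
by rewrite -Q'T Q'E.
Qed.

Section lpp_sum.
Context (R : realType).
Implicit Types (omega : nat * nat -> R).

(** The passage time telescopes along the left side and then along the top
    side. *)
Lemma lpp_left_top omega m n : omega (0%N, 0%N) = 0 ->
  lpp omega (0%N, 0%N) (m, n) =
  \sum_(p <- [seq (0%N, j.+1) | j <- iota 0 n]) omega p +
  \sum_(i <- iota 0 m) hinc omega (0%N, 0%N) i n.
Proof.
move=> o0; rewrite big_map; elim: m => [|m IH].
  rewrite big_nil addr0; elim: n => [|n IHn]; first by rewrite lpp_point o0 big_nil.
  by rewrite (@lpp_col _ _ (0%N, 0%N))// IHn -addn1 iotaD big_cat big_seq1/= add0n addrC addn1.
by rewrite -addn1 iotaD big_cat big_seq1/= add0n addrA -IH /hinc addn1 addrC subrK.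
Qed.

End lpp_sum.

Section mgf.
Context d (T : measurableType d) (R : realType) (P : probability T R).
Variables (w z : R) (m n : nat) (omega : nat * nat -> T -> R).
Hypothesis mo : forall p, measurable_fun setT (omega p).
Hypothesis o0 : forall t, omega (0%N, 0%N) t = 0.
Hypothesis indep : indep_exp P omega (boundary_rate w z) (rect m n).

Let o : nat * nat := (0%N, 0%N).
Let left_side : seq (nat * nat) := [seq (0%N, j.+1) | j <- iota 0 n].
Let others : seq (nat * nat) := [seq p <- rect m n | p \notin left_side].

Let rect_perm : perm_eq (rect m n) (left_side ++ others).
Proof.
have uleft : uniq left_side by rewrite map_inj_uniq ?iota_uniq// => i i' [].
apply: uniq_perm; first exact: rect_uniq.
  rewrite cat_uniq uleft filter_uniq ?rect_uniq// andbT.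
  by apply/hasPn => p; rewrite mem_filter => /andP[].
move=> p; rewrite mem_cat [p \in others]mem_filter.
case: (boolP (p \in left_side)) => //= /mapP[j jn ->].
by rewrite mem_rect/=; move: jn; rewrite mem_iota add0n => /andP[_ ->].
Qed.

(** Tilting the left side by w - z changes its rate from 1 - z to 1 - w. Under
    the new measure the Burke property makes the increments of the top side
    independent Exp(w), so the remaining factor exp ((w - z) top) is a product
    of moments; the tilt contributes the other product. *)
Lemma lpp_mgf : 0 < z -> z < w -> w < 1 ->
  (\int[P]_t (expR ((w - z) * lpp (omega ^~ t) o (m, n)))%:E =
   ((w / z) ^+ m * ((1 - z) / (1 - w)) ^+ n)%:E)%E.
Proof.
move=> z0 zw w1.
have w0 : 0 < w by exact: lt_trans zw.
have PT : P setT = 1%:E by exact: probability_setT.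
have us : uniq (left_side ++ others) by rewrite -(perm_uniq rect_perm) rect_uniq.
have rate0 p : 0 < boundary_rate w z p.
  rewrite /boundary_rate; do 2?case: ifP => _ //.
  by rewrite subr_gt0 (lt_trans zw).
have rate_left p : p \in left_side -> boundary_rate w z p = 1 - z.
  by move=> /mapP[j _ ->].
have lr : {in left_side, forall p, w - z < boundary_rate w z p}.
  by move=> p /rate_left ->; rewrite ltrD2r.
have [Q [QE QT Qind]] := indep_exp_tilt PT mo us (fun p _ => rate0 p) lr
  (indep_exp_perm rect_perm indep).
set q := (1 * _) in QT.
have Qst : indep_exp Q omega (boundary_rate w w) (rect m n).
  apply: (@indep_exp_perm _ _ _ _ _ _ _ (left_side ++ others)).
    by rewrite perm_sym.
  apply: eq_indep_exp Qind => // p; rewrite mem_cat => pin.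
  case: ifPn pin => [pl _|pl /= po].
    rewrite rate_left// (_ : 1 - z - (w - z) = 1 - w); last by ring.
    by move: pl => /mapP[j _ ->].
  rewrite /boundary_rate; case: ifP => // p20; case: ifP => // p10.
  move: pl po; rewrite mem_filter mem_rect => pl /and4P[_ _ _ pn].
  case/negP: pl; apply/mapP; exists p.2.-1.
    by rewrite mem_iota add0n; move: p20 pn; case: (p.2).
  by move: p10 p20; case: (p) => p1 [|p2]//= /eqP ->.
have mh i : measurable_fun setT (fun t => hinc (omega ^~ t) o i n).
  by apply: measurable_funB; apply: measurable_lpp.
have top := top_row_indep QT w0 w1 mo Qst.
have := sum_exp_mgf QT mh (iota_uniq 0 m) (fun i _ => w0) (l := w - z) _ top.
rewrite (ge0_integral_density _ _ QE); last 4 first.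
- apply: measurableT_comp => //; apply: measurable_funM => //.
  by apply: measurable_sum => p.
- by move=> t; rewrite expR_ge0.
- apply/measurable_EFinP; apply: measurableT_comp => //; apply: measurable_funM => //.
  by apply: measurable_sum => p; exact: mh.
- by move=> t; rewrite lee_fin expR_ge0.
move=> H; transitivity (\int[P]_t ((expR ((w - z) *
    (\sum_(i <- iota 0 m) hinc (omega ^~ t) (0, 0)%N i n)))%:E *
    (expR ((w - z) * (\sum_(i <- left_side) omega i t)))%:E))%E.
  apply: eq_integral => t _.
  rewrite lpp_left_top// -EFinM -expRD -mulrDr.
  by congr (expR (_ * _))%:E; exact: addrC.
rewrite H; last by move=> i _; rewrite ltrBlDr ltrDl.
rewrite /q mul1r big_seq (eq_bigr (fun=> (1 - z) / (1 - w))); last first.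
  by move=> p pl; rewrite rate_left//; congr (_ / _); ring.
rewrite -big_seq big_map !big_const_seq !count_predT !size_iota.
rewrite (_ : w - (w - z) = z); last by ring.
by rewrite !iter_mulr_1 mulrC.
Qed.

End mgf.

(** The left-hand side is E exp (- l (X - k / r)) for X a sum of k independent
    Exp(r). It is 1 + O(l^2), hence at most 1 + l e for small l; the smallness
    conditions make this explicit. *)
Lemma centered_exp_bound (R : realType) (k : nat) (r l e : R) : 0 < r -> 0 < l ->
  l * (4 * k%:R + 1) <= r -> l * (4 * k%:R + 1) <= e * r ^+ 2 ->
  (r / (r + l)) ^+ k * expR (l * (k%:R / r)) <= 1 + l * e.
Proof.
move=> r0 l0 lr le; pose x := l / r.
have x0 : 0 < x by exact: divr_gt0.
have k0 : 0 <= k%:R :> R by [].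
have lE : l = x * r by rewrite /x divfK ?gt_eqF.
have x1 : x * (4 * k%:R + 1) <= 1 by rewrite /x mulrAC ler_pdivrMr// mul1r.
have x1' : x <= 1 by nra.
have [a aE] : exists a, a = r / (r + l) * expR x by exists (r / (r + l) * expR x).
have rlE : r / (r + l) = (1 + x)^-1.
  by rewrite lE; field; rewrite ?gt_eqF//; nra.
have a0 : 0 <= a by rewrite aE mulr_ge0 ?expR_ge0// divr_ge0// ?addr_ge0// ltW.
have ax : a * (1 - x ^+ 2) <= 1.
  have h : expR x * (1 - x) <= 1.
    have := expR_ge1Dx (- x); rewrite expRN => h.
    by rewrite -[leRHS](mulfV (lt0r_neq0 (expR_gt0 x))) ler_pM2l ?expR_gt0.
  have -> : a * (1 - x ^+ 2) = expR x * (1 - x).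
    by rewrite aE rlE; field; rewrite gt_eqF// addr_gt0.
  exact: h.
(* Bernoulli: a <= 1 / (1 - x^2), so a^j <= 1 / (1 - j x^2). *)
have aj j : (j <= k)%N -> a ^+ j * (1 - j%:R * x ^+ 2) <= 1.
  elim: j => [_|j IH jk]; first by rewrite expr0 mul0r subr0 mul1r.
  have {}IH := IH (ltnW jk).
  have aj0 : 0 <= a ^+ j by exact: exprn_ge0.
  have j0 : 0 <= j%:R :> R by [].
  have kx : k%:R * x ^+ 2 <= 1 by nra.
  have jk' : j%:R <= k%:R :> R by rewrite ler_nat ltnW.
  have jx : 0 <= 1 - j%:R * x ^+ 2.
    by rewrite subr_ge0 (le_trans _ kx)// ler_wpM2r ?sqr_ge0.
  apply: (@le_trans _ _ (a ^+ j * (1 - j%:R * x ^+ 2) * (a * (1 - x ^+ 2)))).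
    rewrite exprSr -!mulrA; apply: ler_wpM2l => //.
    rewrite [leRHS]mulrCA; apply: ler_wpM2l => //.
    rewrite -natr1; have := mulr_ge0 j0 (sqr_ge0 (x ^+ 2)); lra.
  have x20 : 0 <= 1 - x ^+ 2 by nra.
  apply: mulr_ile1 => //; last by rewrite mulr_ge0.
  exact: mulr_ge0.
have akE : (r / (r + l)) ^+ k * expR (l * (k%:R / r)) = a ^+ k.
  by rewrite aE [in RHS]exprMn -expRM_natl; congr (_ * expR _); rewrite /x; ring.
rewrite akE.
have := aj k (leqnn k); set y := a ^+ k => yk.
have y0 : 0 <= y by exact: exprn_ge0.
have kx : k%:R * x ^+ 2 <= 4^-1 by nra.
have y2 : y <= 1 + 2 * (k%:R * x ^+ 2).
  have kx0 : 0 <= k%:R * x ^+ 2 by rewrite mulr_ge0 ?sqr_ge0.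
  set u := k%:R * _ in yk kx kx0 *.
  nra.
apply: (le_trans y2); rewrite lerD2l.
have : x * (4 * k%:R + 1) <= e * r.
  rewrite /x mulrAC ler_pdivrMr//; move: le; rewrite expr2 mulrA//.
rewrite lE; nra.
Qed.

Section mean.
Context d (T : measurableType d) (R : realType) (P : probability T R).
Variables (rho : R) (m n : nat) (omega : nat * nat -> T -> R).
Hypotheses (rho0 : 0 < rho) (rho1 : rho < 1).
Hypothesis mo : forall p, measurable_fun setT (omega p).
Hypothesis o0 : forall t, omega (0%N, 0%N) t = 0.
Hypothesis indep : indep_exp P omega (boundary_rate rho rho) (rect m n).

Let o : nat * nat := (0%N, 0%N).

Let left_side : seq (nat * nat) := [seq (0%N, j.+1) | j <- iota 0 n].

(** The passage time has mean M, stated through nonnegative integrals. With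
    left and top parts of means n / (1 - rho) and m / rho, the inequality
    1 - x <= exp (- x) for l times each centered part bounds l (M - G)^+ - l
    (G - M)^+ + 2 by two exponentials whose means are at most 1 + l e / 2;
    then e tends to 0. *)
Lemma lpp_mean_ge (M := m%:R / rho + n%:R / (1 - rho)) :
  (\int[P]_t (Num.max 0 (M - lpp (omega ^~ t) o (m, n)))%:E <=
   \int[P]_t (Num.max 0 (lpp (omega ^~ t) o (m, n) - M))%:E)%E.
Proof.
have PT : P setT = 1%:E by exact: probability_setT.
have rho1' : 0 < 1 - rho by rewrite subr_gt0.
have uleft : uniq left_side by rewrite map_inj_uniq ?iota_uniq// => i i' [].
have rate0 p : 0 < boundary_rate rho rho p.
  by rewrite /boundary_rate; do 2?case: ifP => _ //.
have rate_left p : p \in left_side -> boundary_rate rho rho p = 1 - rho.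
  by move=> /mapP[j _ ->].
have ileft : indep_exp P omega (boundary_rate rho rho) left_side.
  apply: indep_exp_subset indep => //; first exact: rect_uniq.
  move=> _ /mapP[j jn ->]; rewrite mem_rect/=.
  by move: jn; rewrite mem_iota add0n => /andP[_ ->].
have top := top_row_indep PT rho0 rho1 mo indep.
have mh i : measurable_fun setT (fun t => hinc (omega ^~ t) o i n).
  by apply: measurable_funB; apply: measurable_lpp.
pose Y t := \sum_(p <- left_side) omega p t.
pose H t := \sum_(i <- iota 0 m) hinc (omega ^~ t) o i n.
have mY : measurable_fun setT Y by exact: measurable_sum.
have mH : measurable_fun setT H by exact: measurable_sum.
have GE t : lpp (omega ^~ t) o (m, n) = Y t + H t by rewrite lpp_left_top.
have mG : measurable_fun setT (fun t => lpp (omega ^~ t) o (m, n)).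
  exact: measurable_lpp.
apply/lee_addgt0Pr => e e0.
(* The largest l allowed by the conditions of [centered_exp_bound] for both
   parts, with e / 2 in each. *)
have [l [l0 l1 l2 l3 l4]] : exists l : R, [/\ 0 < l,
    l * (4 * m%:R + 1) <= rho, l * (4 * m%:R + 1) <= e / 2 * rho ^+ 2,
    l * (4 * n%:R + 1) <= 1 - rho & l * (4 * n%:R + 1) <= e / 2 * (1 - rho) ^+ 2].
  have m0 : 0 < 4 * m%:R + 1 :> R by rewrite ltr_wpDl// mulr_ge0.
  have n0 : 0 < 4 * n%:R + 1 :> R by rewrite ltr_wpDl// mulr_ge0.
  exists (Num.min (Num.min (rho / (4 * m%:R + 1)) (e / 2 * rho ^+ 2 / (4 * m%:R + 1)))
     (Num.min ((1 - rho) / (4 * n%:R + 1)) (e / 2 * (1 - rho) ^+ 2 / (4 * n%:R + 1)))).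
  split; rewrite -?ler_pdivlMr// ?ge_min ?lexx ?orbT//.
  by rewrite !lt_min !divr_gt0// ?mulr_gt0// ?exprn_gt0.
have cY : (\int[P]_t (expR (- l * (Y t - n%:R / (1 - rho))))%:E <= (1 + l * (e / 2))%:E)%E.
  have := sum_exp_mgf PT mo uleft (fun p _ => rate0 p) (l := - l) _ ileft.
  move=> hY; under eq_integral do rewrite mulrBr expRD EFinM muleC.
  rewrite ge0_integralZl//; last first.
    apply/measurable_EFinP; apply: measurableT_comp => //; exact: measurable_funM.
  rewrite hY; last by move=> p pl; rewrite (lt_trans _ (rate0 p))// oppr_lt0.
  rewrite mul1r big_seq (eq_bigr (fun=> (1 - rho) / (1 - rho + l))); last first.
    by move=> p pl; rewrite rate_left// opprK.
  rewrite -big_seq big_map big_const_seq count_predT size_iota iter_mulr_1.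
  rewrite -EFinM lee_fin mulNr opprK mulrC; exact: centered_exp_bound.
have cH : (\int[P]_t (expR (- l * (H t - m%:R / rho)))%:E <= (1 + l * (e / 2))%:E)%E.
  have := sum_exp_mgf PT mh (iota_uniq 0 m) (fun p _ => rho0) (l := - l) _ top.
  move=> hY; under eq_integral do rewrite mulrBr expRD EFinM muleC.
  rewrite ge0_integralZl//; last first.
    apply/measurable_EFinP; apply: measurableT_comp => //; exact: measurable_funM.
  rewrite hY; last by move=> p pl; rewrite (lt_trans _ rho0)// oppr_lt0.
  rewrite mul1r opprK big_const_seq count_predT size_iota iter_mulr_1.
  rewrite -EFinM lee_fin mulNr opprK mulrC; exact: centered_exp_bound.
pose Xn t := Num.max 0 (M - lpp (omega ^~ t) o (m, n)).
pose Xp t := Num.max 0 (lpp (omega ^~ t) o (m, n) - M).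
have mXn : measurable_fun setT Xn by apply: measurable_maxr => //; exact: measurable_funB.
have mXp : measurable_fun setT Xp by apply: measurable_maxr => //; exact: measurable_funB.
have Xn0 t : 0 <= Xn t by rewrite le_max lexx.
have Xp0 t : 0 <= Xp t by rewrite le_max lexx.
have mexp (f : T -> R) c : measurable_fun setT f ->
    measurable_fun setT (fun t => expR (- l * (f t - c))).
  move=> mf; apply: measurableT_comp => //.
  by apply: measurable_funM => //; exact: measurable_funB.
have key : (l%:E * \int[P]_t (Xn t)%:E + 2%:E <=
    l%:E * \int[P]_t (Xp t)%:E + (\int[P]_t (expR (- l * (Y t - n%:R / (1 - rho))))%:E +
      \int[P]_t (expR (- l * (H t - m%:R / rho)))%:E))%E.
  have -> : (2%:E = \int[P]_t (cst 2 t)%:E :> \bar R)%E.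
    have := integral_cst P (@measurableT _ T) 2%:E.
    by rewrite [X in (_ * X)%E]PT mule1 => h; exact/esym.
  have mlXn : measurable_fun setT (fun t => l * Xn t) by exact: measurable_funM.
  have mlXp : measurable_fun setT (fun t => l * Xp t) by exact: measurable_funM.
  have lXn0 t : 0 <= l * Xn t by rewrite mulr_ge0// ltW.
  have lXp0 t : 0 <= l * Xp t by rewrite mulr_ge0// ltW.
  have m2 : measurable_fun setT (cst 2 : T -> R) by exact: measurable_cst.
  have meY := mexp _ (n%:R / (1 - rho)) mY; have meH := mexp _ (m%:R / rho) mH.
  have eY0 t : 0 <= expR (- l * (Y t - n%:R / (1 - rho))) by exact: expR_ge0.
  have eH0 t : 0 <= expR (- l * (H t - m%:R / rho)) by exact: expR_ge0.
  rewrite (ge0_integral_EFinZ P mXn Xn0 (ltW l0)) (ge0_integral_EFinZ P mXp Xp0 (ltW l0)) 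
    (ge0_integral_EFinD P mlXn lXn0 m2 (fun=> ler0n R 2)).
  rewrite (ge0_integral_EFinD P meY eY0 meH eH0).
  rewrite (ge0_integral_EFinD P mlXp lXp0 (measurable_funD meY meH)
    (fun t => addr_ge0 (eY0 t) (eH0 t))).
  apply: ge0_le_integral => //.
  - by move=> t _; rewrite lee_fin addr_ge0.
  - by apply/measurable_EFinP; exact: measurable_funD.
  - apply/measurable_EFinP; apply: measurable_funD => //.
    exact: (measurable_funD meY meH).
  move=> t _; rewrite lee_fin /=.
  have h1 := expR_ge1Dx (- l * (Y t - n%:R / (1 - rho))).
  have h2 := expR_ge1Dx (- l * (H t - m%:R / rho)).
  have XE : Xn t = Xp t - (Y t - n%:R / (1 - rho)) - (H t - m%:R / rho).
    rewrite /Xn /Xp GE /M /Num.max; case: ltP => h3; case: ltP => h4; lra.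
  rewrite XE; lra.
have : (l%:E * \int[P]_t (Xn t)%:E + 2%:E <=
    l%:E * \int[P]_t (Xp t)%:E + (2 + l * e)%:E)%E.
  apply: (le_trans key); apply: leeD => //.
  apply: (le_trans (leeD cY cH)); rewrite -EFinD lee_fin; lra.
rewrite [2 + _]addrC (EFinD (l * e) 2) addeA leeD2rE//.
have -> : (l%:E * \int[P]_t (Xp t)%:E + (l * e)%:E = l%:E * (\int[P]_t (Xp t)%:E + e%:E))%E.
  rewrite (EFinM l e) [RHS]ge0_muleDr//; last by rewrite lee_fin ltW.
  by apply: integral_ge0 => t _; rewrite lee_fin.
by rewrite lee_pmul2l// lte_fin.
Qed.

End mean.

(** * Independence of the sigma-algebras of disjoint families *)

Section sigma_indep.
Context d (T : measurableType d) (R : realType) (P : probability T R).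
Context (I : eqType) (X : I -> {RV P >-> R}).
Hypothesis indep : mutually_independent X.

(** Cylinder events of the variables with index in J; they form a pi-system
    that generates their sigma-algebra. *)
Definition rectangles (J : pred I) : set (set T) :=
  [set E | exists s A, [/\ uniq s, all J s, (forall i, measurable (A i : set R)) &
    E = \bigcap_(i in [set` s]) (X i @^-1` A i)]].

Lemma rectangles_setI (J : pred I) : setI_closed (rectangles J).
Proof.
move=> _ _ [s [A [us Js mA ->]]] [s' [A' [us' Js' mA' ->]]].
exists (undup (s ++ s')).
exists (fun i => (if i \in s then A i else setT) `&` (if i \in s' then A' i else setT)).
split.
- exact: undup_uniq.
- apply/allP => i; rewrite mem_undup mem_cat => /orP[].
    by move/(allP Js).
  by move/(allP Js').
- by move=> i; apply: measurableI; case: ifP.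
apply/seteqP; split => t.
  move=> [h h'] i /= _; split; case: ifP => // si; [exact: h|exact: h'].
move=> h; split => i /= si; have := h i; rewrite /= mem_undup mem_cat si ?orbT => /(_ isT)[].
  by [].
by [].
Qed.

Lemma measurable_rectangles (J : pred I) E : rectangles J E -> measurable E.
Proof.
move=> [s [A [us Js mA ->]]]; apply: fin_bigcap_measurable => // i _.
exact: measurable_preimage.
Qed.

(** For a fixed cylinder E, both sides are finite measures in B that agree on
    cylinders. *)
Lemma sigma_indep (J : pred I) (E B : set T) :
  rectangles (predC J) E -> <<s rectangles J >> B -> P (E `&` B) = (P E * P B)%E.
Proof.
move=> rE sB.
have mE := measurable_rectangles rE.
have PE0 : 0 <= fine (P E) by rewrite fine_ge0.
have fE : P E \is a fin_num by rewrite fin_num_measure.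
have mscE A : mscale (NngNum PE0) P A = (P E * P A)%E.
  by rewrite -[in RHS](fineK fE).
have H : mrestr P mE B = mscale (NngNum PE0) P B.
  apply: (@g_sigma_algebra_measure_unique _ _ _ (rectangles J) _ (fun=> setT)) => //.
  - by move=> A /measurable_rectangles.
  - move=> _; exists [::], (fun=> setT); split => //.
    by apply/seteqP; split.
  - by rewrite bigcup_const.
  - exact: rectangles_setI.
  - move=> A rA; transitivity (P E * P A)%E; last exact: esym (mscE A).
    transitivity (P (A `&` E)) => //.
    move: rE rA => [s [C [us Js mC ->]]] [s' [C' [us' Js' mC' ->]]].
    have dis i : i \in s -> i \in s' -> False.
      by move=> /(allP Js)/= /negP ni /(allP Js').
    pose D i := if i \in s then C i else C' i.
    have uss : uniq (s ++ s').
      rewrite cat_uniq us us' andbT; apply/hasPn => i is'; apply/negP => si.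
      exact: (dis i si is').
    have mD i : measurable (D i) by rewrite /D; case: ifP.
    have := indep uss mD; rewrite big_cat/=.
    rewrite (eq_big_seq (fun i => P (X i @^-1` C i))); last first.
      by move=> i si; rewrite /D si.
    rewrite [X in (_ * X)%E](eq_big_seq (fun i => P (X i @^-1` C' i))); last first.
      move=> i si; rewrite /D ifF//; apply/negP => si'; exact: dis si.
    rewrite -!indep// => <-; congr (P _).
    apply/seteqP; split => t.
      move=> [h' h] i /=; rewrite mem_cat /D; case: ifP => [si _|_ /= si]; first exact: h.
      exact: h'.
    move=> h; split => i /= si; have := h i; rewrite /= mem_cat si ?orbT => /(_ isT).
      rewrite /D; case: ifP => // si'; by case: (dis i si' si).
    by rewrite /D si.
  - move=> _; apply: (@le_lt_trans _ _ 1%E); last exact: ltry.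
    by apply: probability_le1; exact: measurableI.
by rewrite -mscE -H /mrestr setIC.
Qed.

End sigma_indep.

(** * Upper tail of a bulk increment *)

(** The origin has weight 0, and the first step goes to one of the two axes. *)
Lemma lpp_axes_le (R : realType) (omega : nat * nat -> R) (v : nat * nat) :
  (0 < v.1)%N -> (0 < v.2)%N -> omega (0%N, 0%N) = 0 ->
  [/\ lpp omega (1%N, 0%N) v <= lpp omega (0%N, 0%N) v,
      lpp omega (0%N, 1%N) v <= lpp omega (0%N, 0%N) v &
      lpp omega (0%N, 0%N) v <=
        Num.max (lpp omega (1%N, 0%N) v) (lpp omega (0%N, 1%N) v)].
Proof.
move=> v1 v2 o0; split.
- by have := @lpp_first_step _ omega (0%N, 0%N) (1%N, 0%N) v erefl v1 isT; rewrite o0 add0r.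
- by have := @lpp_first_step _ omega (0%N, 0%N) (0%N, 1%N) v erefl isT v2; rewrite o0 add0r.
have [|u [st _ _]] := @lpp_first_step_ex _ omega (0%N, 0%N) v isT isT.
  by case: v v1 {v2} => [[|?] ?].
rewrite o0 add0r le_max; case/orP: st => /eqP -> /= ->; rewrite ?orbT//.
Qed.

(** The exponential moment of order w - z of the passage time to (m, n), for
    axes of rates w and 1 - z: see [lpp_mgf]. *)
Definition stationary_mgf (R : realType) (m n : nat) (z w : R) : R :=
  (w / z) ^+ m * ((1 - z) / (1 - w)) ^+ n.

Section reflected.
Context d (T : measurableType d) (R : realType) (P : probability T R).
Context (W : coupled_weights P).

Lemma weight_indep_exp (w z : R) s : 0 < w -> z < 1 -> uniq s ->
  (0%N, 0%N) \notin s -> indep_exp P (weight W w z) (boundary_rate w z) s.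
Proof.
move=> w0 z1 us s0 A mA.
rewrite (weight_independence W w0 z1 us mA) probability_setT mul1e.
apply: eq_big_seq => -[[|i] [|j]] ps /=.
- by rewrite ps in s0.
- exact: (ver_law W z1 (ltn0Sn j) (mA _)).
- exact: (hor_law W w0 (ltn0Sn i) (mA _)).
- exact: (bulk_law W (ltn0Sn i) (ltn0Sn j) (mA _)).
Qed.

Variable v : nat * nat.

(** The bulk is turned by a half-turn that brings v to (1, 1), while the axes
    keep their weights. Passage times from (k.+1, 1) to v become passage times
    from (1, 1) to (v.1 - k, v.2), all with the same starting point, to which
    boundary weights can be attached. *)
Definition reflected (w z : R) (p : nat * nat) : T -> R :=
  if (p.1 == 0%N) || (p.2 == 0%N) then weight W w z p else bulk W (reflect_pt v p).

Lemma measurable_reflected w z p : measurable_fun setT (reflected w z p).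
Proof. by rewrite /reflected; case: ifP => _; exact: measurable_funPT. Qed.

Lemma reflected0 w z t : reflected w z (0%N, 0%N) t = 0.
Proof. by []. Qed.

Lemma reflected_indep (w z : R) m n : 0 < w -> z < 1 ->
  (m <= v.1)%N -> (n <= v.2)%N ->
  indep_exp P (reflected w z) (boundary_rate w z) (rect m n).
Proof.
move=> w0 z1 mv nv.
pose f (p : nat * nat) := if (p.1 == 0%N) || (p.2 == 0%N) then p else reflect_pt v p.
have finj : {in rect m n &, injective f}.
  move=> [a b] [c e]; rewrite !mem_rect /f /reflect_pt/= => ab ce.
  case: ifP => h1; case: ifP => h2 [] h3 h4; congr pair; lia.
have f0 : (0%N, 0%N) \notin map f (rect m n).
  apply/negP => /mapP[[a b]]; rewrite mem_rect /f /reflect_pt/= => ab.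
  move: ab; rewrite xpair_eqE; case: ifP => h1 ab [] h2 h3; lia.
have uf : uniq (map f (rect m n)) by rewrite map_inj_in_uniq// rect_uniq.
have := indep_exp_map finj (weight_indep_exp w0 z1 uf f0).
apply: eq_indep_exp => p; rewrite mem_rect => /and3P[p0 pm pn].
  rewrite /reflected /f /=; case: ifP => // /negbT; rewrite negb_or => /andP[p1 p2].
  have : ((reflect_pt v p).1 != 0)%N /\ ((reflect_pt v p).2 != 0)%N.
    by rewrite /reflect_pt/= !subn_eq0 -!ltnNge !ltnS (leq_trans pm mv) (leq_trans pn nv).
  by case: (reflect_pt v p) => -[|i] [|j] [].
rewrite /f /=; case: ifP => // /negbT; rewrite negb_or => /andP[p1 p2].
rewrite /boundary_rate/= (negbTE p1) (negbTE p2).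
rewrite !ifF//; apply/negbTE; rewrite /= subn_eq0 -ltnNge ltnS.
  by rewrite (leq_trans pm mv).
by rewrite (leq_trans pn nv).
Qed.

Hypotheses (v1 : (0 < v.1)%N) (v2 : (0 < v.2)%N).

Lemma bulk_reflect k w z t : (k < v.1)%N ->
  lpp (fun p => bulk W p t) (k.+1, 1%N) v =
  lpp (reflected w z ^~ t) (1%N, 1%N) ((v.1 - k)%N, v.2).
Proof.
move=> kv; rewrite [in LHS](surjective_pairing v) -lpp_reflect//=.
rewrite /reflect_pt/= subSS subn1/=.
by apply: eq_lpp => -[[|i] [|j]].
Qed.

(** After the half-turn the two bulk passage times end at v and at (v.1 - k,
    v.2), and [lpp_diff_compare] adds the horizontal axis. *)
Lemma bulk_diff_le k w z t : (k < v.1)%N ->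
  G W v t - lpp (fun p => bulk W p t) (k.+1, 1%N) v <=
  lpp (reflected w z ^~ t) (1%N, 0%N) v -
  lpp (reflected w z ^~ t) (1%N, 0%N) ((v.1 - k)%N, v.2).
Proof.
move=> kv; have := @bulk_reflect 0 w z t v1; rewrite subn0 -surjective_pairing /G => ->.
rewrite (bulk_reflect w z t kv).
have := lpp_diff_compare (reflected w z ^~ t) (v.1 - k).-1 k v.2.-1.
rewrite !prednK ?subn_gt0// -addSn prednK ?subn_gt0// subnK ?(ltnW kv)//.
by rewrite -surjective_pairing.
Qed.

Lemma measurable_bulk_lpp k :
  measurable_fun setT (fun t => lpp (fun p => bulk W p t) (k.+1, 1%N) v).
Proof. by apply: (@measurable_lpp _ _ _ (fun p => bulk W p)) => p _ _; exact: measurable_funPT. Qed.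

Lemma reflected_mgf w z m n : 0 < z -> z < w -> w < 1 -> (m <= v.1)%N -> (n <= v.2)%N ->
  (\int[P]_t (expR ((w - z) * lpp (reflected w z ^~ t) (0%N, 0%N) (m, n)))%:E =
  (stationary_mgf m n z w)%:E)%E.
Proof.
move=> z0 zw w1 mv nv; apply: (lpp_mgf (measurable_reflected w z) (reflected0 w z) _ z0 zw w1).
by apply: reflected_indep => //; [exact: lt_trans zw|exact: lt_trans w1].
Qed.

(** By [bulk_diff_le] the increment is at most Ghor_v - Ghor_u with weights of
    rate rho on the axis, where u = (v.1 - k, v.2). If it exceeds a - (M - b),
    then either Ghor_v >= a, or Ghor_u <= M - b. In the second case either
    Gver_u >= M - b, or the stationary passage time to u, which is the larger
    of the two, is below its mean M by at least b. The three events are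
    bounded with a boundary rate changed on the axis that the passage time
    ignores: Ghor_v is below the passage time with vertical parameter z1, and
    Gver_u below the one with horizontal rate w. The last event is bounded by
    Markov's inequality and [lpp_mean_ge], with x^+ <= exp (c x) / c for the
    excess of either part. *)
Lemma bulk_increment_tail (k : nat) (rho w z1 z3 a b : R)
    (M := (v.1 - k)%:R / rho + v.2%:R / (1 - rho)) : (k < v.1)%N ->
  0 < z1 -> z1 < rho -> 0 < z3 -> z3 < rho -> rho < w -> w < 1 -> 0 < b ->
  (P [set t | (a - (M - b) <= G W v t - lpp (fun p => bulk W p t) (k.+1, 1%N) v)%R] <=
  (stationary_mgf v.1 v.2 z1 rho * expR (- ((rho - z1) * a)) +
   stationary_mgf (v.1 - k) v.2 rho w * expR (- ((w - rho) * (M - b))) +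
   b^-1 * ((rho - z3)^-1 *
             (stationary_mgf (v.1 - k) v.2 z3 rho * expR (- ((rho - z3) * M))) +
           (w - rho)^-1 *
             (stationary_mgf (v.1 - k) v.2 rho w * expR (- ((w - rho) * M)))))%:E)%E.
Proof.
move=> kv z10 z1rho z30 z3rho rhow w1 b0.
have rho0 : 0 < rho by exact: lt_trans z1rho.
have rho1 : rho < 1 by exact: lt_trans w1.
have w0 : 0 < w by exact: lt_trans rhow.
set u : nat * nat := ((v.1 - k)%N, v.2).
have u1 : (0 < u.1)%N by rewrite subn_gt0.
have uv : (u.1 <= v.1)%N by rewrite leq_subr.
pose L w' z' x t := lpp (reflected w' z' ^~ t) (0%N, 0%N) x.
have mL w' z' x : measurable_fun setT (L w' z' x).
  by apply: measurable_lpp => p _ _; exact: measurable_reflected.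
pose S1 := [set t | a <= L rho z1 v t].
pose S2 := [set t | M - b <= L w rho u t].
pose S3 := [set t | b <= Num.max 0 (M - L rho rho u t)].
have mXn : measurable_fun setT (fun t => Num.max 0 (M - L rho rho u t)).
  by apply: measurable_maxr => //; exact: measurable_funB.
have mXp : measurable_fun setT (fun t => Num.max 0 (L rho rho u t - M)).
  by apply: measurable_maxr => //; exact: measurable_funB.
have mS1 : measurable S1 by exact: measurable_ge.
have mS2 : measurable S2 by exact: measurable_ge.
have mS3 : measurable S3 by exact: measurable_ge.
have horE w' z' z'' x t : lpp (reflected w' z' ^~ t) (1%N, 0%N) x =
    lpp (reflected w' z'' ^~ t) (1%N, 0%N) x.
  by apply: eq_lpp => -[[|i] [|j]].
have verE w' w'' z' x t : lpp (reflected w' z' ^~ t) (0%N, 1%N) x =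
    lpp (reflected w'' z' ^~ t) (0%N, 1%N) x.
  by apply: eq_lpp => -[[|i] [|j]].
have sub : [set t | (a - (M - b) <= G W v t - lpp (fun p => bulk W p t) (k.+1, 1%N) v)%R]
    `<=` S1 `|` S2 `|` S3.
  move=> t /= tD; have [?|t1] := leP a (L rho z1 v t); first by left; left.
  have [?|t2] := leP (M - b) (L w rho u t); first by left; right.
  right; rewrite /S3/= leNgt; apply/negP => t3.
  have := bulk_diff_le rho rho t kv; rewrite -/u => /(le_trans tD).
  have [hv _ _] := @lpp_axes_le _ (reflected rho z1 ^~ t) v v1 v2 (reflected0 rho z1 t).
  have [_ vu _] := @lpp_axes_le _ (reflected w rho ^~ t) u u1 v2 (reflected0 w rho t).
  have [_ _ gu] := @lpp_axes_le _ (reflected rho rho ^~ t) u u1 v2 (reflected0 rho rho t).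
  rewrite (horE _ _ z1 v) leNgt => /negP; apply.
  have Lu : M - b < L rho rho u t by move: t3; rewrite gt_max => /andP[_]; lra.
  have : M - b < Num.max (lpp (reflected rho rho ^~ t) (1%N, 0%N) u)
      (lpp (reflected rho rho ^~ t) (0%N, 1%N) u) by exact: lt_le_trans gu.
  rewrite (verE _ w) lt_max => /orP[h|h].
    by move: hv t1; rewrite /L; lra.
  by have := lt_le_trans h vu; move: t2; rewrite /L; lra.
have mD : measurable [set t | (a - (M - b) <= G W v t - lpp (fun p => bulk W p t) (k.+1, 1%N) v)%R].
  by apply: measurable_ge; apply: measurable_funB; exact: measurable_bulk_lpp.
apply: (@le_trans _ _ (P (S1 `|` S2 `|` S3))).
  by rewrite le_measure ?inE//; do 2?apply: measurableU.
apply: (le_trans (measureU2 _ (measurableU _ _ mS1 mS2) mS3)).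
rewrite EFinD; apply: leeD.
  apply: (le_trans (measureU2 _ mS1 mS2)); rewrite EFinD; apply: leeD.
    apply: chernoff_le => //; last by rewrite subr_gt0.
    have := reflected_mgf z10 z1rho rho1 (leqnn v.1) (leqnn v.2).
    by rewrite -surjective_pairing.
  apply: chernoff_le => //; last by rewrite subr_gt0.
  exact: reflected_mgf.
have Xn0 t : 0 <= Num.max 0 (M - L rho rho u t) by rewrite le_max lexx.
have Xp0 t : 0 <= Num.max 0 (L rho rho u t - M) by rewrite le_max lexx.
apply: (le_trans (measure_le_integral P mXn mS3 Xn0 b0 (fun t h => h))).
rewrite EFinM; apply: lee_wpmul2l; first by rewrite lee_fin invr_ge0 ltW.
have := @lpp_mean_ge _ _ _ P rho (v.1 - k) v.2 (reflected rho rho) rho0 rho1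
  (measurable_reflected rho rho) (reflected0 rho rho) (reflected_indep rho0 rho1 uv (leqnn _)).
move=> /le_trans; apply.
have mexp c w' z' : measurable_fun setT (fun t => expR (c * L w' z' u t)).
  by apply: measurableT_comp => //; exact: measurable_funM.
pose c1 := (rho - z3)^-1 * expR (- ((rho - z3) * M)).
pose c2 := (w - rho)^-1 * expR (- ((w - rho) * M)).
have c10 : 0 <= c1 by rewrite mulr_ge0 ?expR_ge0// invr_ge0 subr_ge0 ltW.
have c20 : 0 <= c2 by rewrite mulr_ge0 ?expR_ge0// invr_ge0 subr_ge0 ltW.
pose f1 t := expR ((rho - z3) * L rho z3 u t).
pose f2 t := expR ((w - rho) * L w rho u t).
have mf1 : measurable_fun setT f1 by exact: mexp.
have mf2 : measurable_fun setT f2 by exact: mexp.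
have f10 t : 0 <= f1 t by exact: expR_ge0.
have f20 t : 0 <= f2 t by exact: expR_ge0.
have mc1 : measurable_fun setT (fun t => c1 * f1 t) by exact: measurable_funM.
have mc2 : measurable_fun setT (fun t => c2 * f2 t) by exact: measurable_funM.
have cf1 t : 0 <= c1 * f1 t by exact: mulr_ge0.
have cf2 t : 0 <= c2 * f2 t by exact: mulr_ge0.
apply: (@le_trans _ _ (\int[P]_t (c1 * f1 t + c2 * f2 t)%:E)%E).
  apply: le_integral_EFin => //; first exact: (measurable_funD mc1 mc2).
  move=> t.
  (* Since c x <= exp (c x). *)
  have exple (c x : R) : 0 < c -> Num.max 0 x <= c^-1 * expR (c * x).
    move=> c0; have ci : 0 <= c^-1 by rewrite invr_ge0 ltW.
    rewrite ge_max mulr_ge0 ?expR_ge0//=.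
    by rewrite [leRHS]mulrC ler_pdivlMr// (le_trans _ (expR_ge1Dx _))// mulrC lerDr.
  have [_ _ gu] := @lpp_axes_le _ (reflected rho rho ^~ t) u u1 v2 (reflected0 rho rho t).
  have [hu _ _] := @lpp_axes_le _ (reflected rho z3 ^~ t) u u1 v2 (reflected0 rho z3 t).
  have [_ vu _] := @lpp_axes_le _ (reflected w rho ^~ t) u u1 v2 (reflected0 w rho t).
  rewrite (horE _ _ z3) (verE _ w) in gu.
  have LL : L rho rho u t <= Num.max (L rho z3 u t) (L w rho u t).
    by apply: (le_trans gu); rewrite ge_max !le_max hu vu orbT.
  have expE c x : c^-1 * expR (c * (x - M)) = c^-1 * expR (- (c * M)) * expR (c * x).
    by rewrite mulrBr expRD -[RHS]mulrA; congr (_ * _); exact: mulrC.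
  have e1 : Num.max 0 (L rho z3 u t - M) <= c1 * f1 t.
    have r3 : 0 < rho - z3 by rewrite subr_gt0.
    have := exple _ (L rho z3 u t - M) r3.
    by rewrite expE.
  have e2 : Num.max 0 (L w rho u t - M) <= c2 * f2 t.
    have rw : 0 < w - rho by rewrite subr_gt0.
    have := exple _ (L w rho u t - M) rw.
    by rewrite expE.
  move: LL; rewrite le_max => /orP[h|h].
    apply: (@le_trans _ _ (c1 * f1 t)); last by rewrite lerDl.
    apply: le_trans e1; rewrite ge_max !le_max lexx/= lerD2r h orbT//.
  apply: (@le_trans _ _ (c2 * f2 t)); last by rewrite lerDr.
  apply: le_trans e2; rewrite ge_max !le_max lexx/= lerD2r h orbT//.
rewrite -(ge0_integral_EFinD P mc1 cf1 mc2 cf2).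
rewrite -(ge0_integral_EFinZ P mf1 f10 c10) -(ge0_integral_EFinZ P mf2 f20 c20).
rewrite /f1 /f2 /L !reflected_mgf// -!EFinM -EFinD lee_fin /c1 /c2.
by rewrite le_eqVlt; apply/orP; left; apply/eqP; ring.
Qed.

End reflected.

(** * Lower bound through the horizontal axis *)

Lemma lpp_along_axis (R : realType) (omega : nat * nat -> R) (v : nat * nat) (k : nat) :
  (k < v.1)%N -> (0 < v.2)%N ->
  \sum_(i <- iota 0 k.+1) omega (i.+1, 0%N) + lpp omega (k.+1, 1%N) v <=
  lpp omega (1%N, 0%N) v.
Proof.
move=> kv v2.
have axis j : (j < v.1)%N ->
    \sum_(i <- iota 0 j) omega (i.+1, 0%N) + lpp omega (j.+1, 0%N) v <=
    lpp omega (1%N, 0%N) v.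
  elim: j => [_|j IH jv]; first by rewrite big_nil add0r.
  apply: le_trans (IH (ltnW jv)); rewrite -[in leLHS]addn1 iotaD big_cat big_seq1/= add0n addn1.
  rewrite -addrA lerD2l; apply: lpp_first_step => //.
  by rewrite /lattice_step/= eqxx.
apply: le_trans (axis k kv); rewrite -addn1 iotaD big_cat big_seq1/= add0n addn1.
rewrite -addrA lerD2l; apply: lpp_first_step => //.
by rewrite /lattice_step/= eqxx orbT.
Qed.

Section lower.
Context d (T : measurableType d) (R : realType) (P : probability T R).
Context (W : coupled_weights P) (v : nat * nat) (k : nat).
Hypotheses (kv : (k < v.1)%N) (v2 : (0 < v.2)%N).

Let bulk_event (D : R) :=
  [set t | (G W v t - lpp (fun p => bulk W p t) (k.+1, 1%N) v < D)%R].

(** The bulk increment is measurable for the sigma-algebra of the bulk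
    weights, which is independent of the axes. *)
Lemma bulk_event_indep (D w z : R) E :
  rectangles (weight W w z) (fun p => (p.1 == 0%N) || (p.2 == 0%N)) E ->
  0 < w -> z < 1 ->
  (P (E `&` bulk_event D) = P E * P (bulk_event D))%E.
Proof.
move=> rE w0 z1.
pose J (p : nat * nat) := (p.1 != 0%N) && (p.2 != 0%N).
apply: (sigma_indep (weight_independence W w0 z1) (J := J)).
  move: rE => [s [A [us sJ mA ->]]]; exists s, A; split => //.
  by apply: sub_all sJ => p; rewrite /J/= negb_and !negbK.
pose Rect := rectangles (weight W w z) J.
(* T with the sigma-algebra of the bulk weights only. *)
pose T' := g_sigma_algebraType Rect.
have mbulk p : J p -> measurable_fun [set: T'] (bulk W p : T' -> R).
  move=> Jp _ A mA; rewrite setTI; apply: sub_sigma_algebra.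
  exists [:: p], (fun=> A); split => //=; first by rewrite Jp.
  apply/seteqP; split => t.
    move=> h i /=; rewrite inE => /eqP ->.
    by case: p Jp h => -[|a] [|b].
  by move=> /(_ p); rewrite /= mem_head => /(_ isT); case: p Jp => -[|a] [|b].
apply: (@measurable_lt _ T' R (fun t => G W v t - lpp (fun p => bulk W p t) (k.+1, 1%N) v)).
apply: measurable_funB; apply: (@measurable_lpp _ T' R (fun p => bulk W p));
  move=> -[[|a] [|b]] //= _ _; exact: mbulk.
Qed.

(** The bulk event is independent of the axis, so under P restricted to it the
    axis weights are still independent exponential variables, now with mass q.
    The Paley-Zygmund inequality applies to Y = exp (s w S), with S the sum of
    the first k.+1 of them: E Y = q (1 - s)^-(k+1) and E Y^2 = q (1 - 2
    s)^-(k+1), and Y >= (1 - s)^-(k+1) / 2 is the stated lower bound for S. *)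
Lemma hor_increment_lower (D w z s q : R) : 0 < w -> z < 1 -> 0 < s -> s < 2^-1 ->
  P (bulk_event D) = q%:E ->
  ((q * (((1 - 2 * s) / (1 - s) ^+ 2) ^+ k.+1 / 4))%:E <=
   P [set t | ((- k.+1%:R * ln (1 - s) - ln 2) / (w * s) - D <=
               Ghor W w z v t - G W v t)%R])%E.
Proof.
move=> w0 z1 s0 s12 PB.
have mG : measurable_fun setT (G W v) := measurable_bulk_lpp W v 0.
have mB : measurable (bulk_event D).
  by apply: measurable_lt; apply: measurable_funB => //; exact: measurable_bulk_lpp.
(* P conditioned on the bulk event, without normalization. *)
pose Q := mrestr P mB.
have QT : Q setT = q%:E by rewrite -PB /Q /= /mrestr setTI.
pose X i := weight W w z (i.+1, 0%N) : T -> R.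
have mX i : measurable_fun setT (X i) by exact: measurable_funPT.
have QX : indep_exp Q X (fun=> w) (iota 0 k.+1).
  move=> A mA; rewrite QT -PB /Q /= /mrestr.
  pose f i : nat * nat := (i.+1, 0%N).
  pose E := \bigcap_(i in [set` iota 0 k.+1]) (X i @^-1` A i).
  have EE : E = \bigcap_(p in [set` map f (iota 0 k.+1)]) (weight W w z p @^-1` A p.1.-1).
    apply/seteqP; split => t h i si.
      by have /mapP[j js ->] : i \in map f (iota 0 k.+1) := si; exact: (h j js).
    exact: (h (f i) (map_f f si)).
  have rE : rectangles (weight W w z) (fun p => (p.1 == 0%N) || (p.2 == 0%N)) E.
    exists (map f (iota 0 k.+1)), (fun p => A p.1.-1); split => //.
      by rewrite map_inj_uniq ?iota_uniq// => i j [].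
    by apply/allP => p /mapP[i _ ->]; rewrite orbT.
  rewrite -/E (bulk_event_indep D rE w0 z1).
  rewrite muleC; congr (_ * _)%E; rewrite EE.
  have uf : uniq (map f (iota 0 k.+1)) by rewrite map_inj_uniq ?iota_uniq// => i j [].
  have f0 : (0%N, 0%N) \notin map f (iota 0 k.+1) by apply/negP => /mapP[i _].
  have := weight_indep_exp W w0 z1 uf f0 (fun p => mA p.1.-1).
  by rewrite probability_setT mul1e big_map.
pose S t := \sum_(i <- iota 0 k.+1) X i t.
have mS : measurable_fun setT S by exact: measurable_sum.
have mgf c : 0 < c -> c < 1 ->
    (\int[Q]_t (expR (c * w * S t))%:E = (q * ((1 - c)^-1) ^+ k.+1)%:E)%E.
  move=> c0 c1; rewrite (sum_exp_mgf QT mX (iota_uniq _ _) (fun _ _ => w0) _ QX); last first.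
    by move=> i _; rewrite gtr_pMl.
  rewrite big_const_seq count_predT size_iota iter_mulr_1; congr (q * _ ^+ _)%:E.
  by field; rewrite !subr_eq0 !gt_eqF//=; nra.
pose Y t := expR (s * w * S t).
have mY : measurable_fun setT Y by apply: measurableT_comp => //; exact: measurable_funM.
have s1 : s < 1 by rewrite (lt_trans s12)// invf_lt1// ltr1n.
have s21 : 2 * s < 1 by rewrite mulrC -ltr_pdivlMr// mul1r.
have E1 := mgf s s0 s1.
have E2 : (\int[Q]_t (Y t ^+ 2)%:E = (q * ((1 - 2 * s)^-1) ^+ k.+1)%:E)%E.
  rewrite -(mgf (2 * s) _ s21) ?mulr_gt0//; apply: eq_integral => t _.
  by rewrite /Y -expRM_natl; congr (expR _)%:E; ring.
set a := (1 - s)^-1 ^+ k.+1 in E1; set b := (1 - 2 * s)^-1 ^+ k.+1 in E2.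
have a0 : 0 < a by rewrite exprn_gt0// invr_gt0 subr_gt0.
have b0 : 0 < b by rewrite exprn_gt0// invr_gt0 subr_gt0.
have := paley_zygmund mY (fun t => expR_ge0 _) QT a0 b0 E1 E2.
have -> : a ^+ 2 / (4 * b) = ((1 - 2 * s) / (1 - s) ^+ 2) ^+ k.+1 / 4.
  rewrite /a /b -exprM mulnC exprM invfM -exprVn invrK [_^-1 * _ in LHS]mulrC mulrA -exprMn.
  by rewrite exprVn [_^-1 * _]mulrC.
move=> /le_trans; apply; rewrite /Q /= /mrestr.
apply: le_measure; rewrite ?inE.
- by apply: measurableI => //; exact: measurable_ge.
- apply: measurable_ge; apply: measurable_funB => //.
  by apply: measurable_lpp => p _ _; exact: measurable_funPT.
move=> t [/= aY BD].
have h1 := @lpp_along_axis _ (fun p => weight W w z p t) v k kv v2.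
have h2 : lpp (fun p => weight W w z p t) (k.+1, 1%N) v =
    lpp (fun p => bulk W p t) (k.+1, 1%N) v by apply: eq_lpp => -[[|i] [|j]].
have h3 : (- k.+1%:R * ln (1 - s) - ln 2) / (w * s) <= S t.
  rewrite ler_pdivrMr ?mulr_gt0//.
  have -> : S t * (w * s) = ln (Y t) by rewrite /Y expRK; ring.
  have -> : - k.+1%:R * ln (1 - s) - ln 2 = ln (a / 2).
    rewrite ln_div ?posrE// /a lnXn ?invr_gt0 ?subr_gt0// lnV ?posrE ?subr_gt0//.
    by rewrite mulNrn mulNr mulr_natl.
  by rewrite ler_ln ?posrE ?expR_gt0// divr_gt0.
rewrite h2 in h1; rewrite /bulk_event/= in BD; rewrite /Ghor.
rewrite -/(S t) in h1.
lra.
Qed.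

End lower.

(** * Taylor bounds for the logarithm *)

Section log_bounds.
Context (R : realType).

Lemma deriv_ge0_ge0 (f df : R -> R) (x : R) : 0 <= x -> f 0 = 0 ->
  (forall y, 0 <= y <= x -> is_derive y 1 f (df y)) ->
  (forall y, 0 <= y <= x -> 0 <= df y) -> 0 <= f x.
Proof.
rewrite le_eqVlt => /orP[/eqP <- -> //|x0] f0 fd df0.
have cf : {within `[0, x], continuous f}.
  apply: continuous_in_subspaceT => y; rewrite inE/= in_itv/= => /fd h.
  by apply: differentiable_continuous; apply/derivable1_diffP; have [] := h.
have fd' y : y \in `]0, x[ -> is_derive y 1 f (df y).
  by rewrite in_itv/= => /andP[y0 yx]; apply: fd; rewrite !ltW.
have [c] := MVT x0 fd' cf.
rewrite in_itv/= f0 !subr0 => /andP[c0 cx] ->.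
by rewrite mulr_ge0 ?(ltW x0)// df0// !ltW.
Qed.

(** Each Taylor bound says that a polynomial minus a logarithm is nonnegative;
    since the difference vanishes at 0 it suffices to compare derivatives,
    which is an inequality between rational functions. *)
Lemma poly_ln_ge0 (p : {poly R}) (c e x : R) : 0 <= x -> p.[0] = 0 ->
  (forall y, 0 <= y <= x -> 0 < 1 + e * y) ->
  (forall y, 0 <= y <= x -> 0 <= p^`().[y] - c * (e / (1 + e * y))) ->
  0 <= p.[x] - c * ln (1 + e * x).
Proof.
move=> x0 p0 e0 dp.
apply: (@deriv_ge0_ge0 (fun y => p.[y] - c * ln (1 + e * y)) _ x x0 _ _ dp).
  by rewrite p0 mulr0 addr0 ln1 mulr0 subrr.
move=> y yx; pose g := (1 + e *: 'X : {poly R}).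
have gE z : g.[z] = 1 + e * z by rewrite /g !hornerE.
have -> : (fun y => p.[y] - c * ln (1 + e * y)) = horner p - c \*: (@ln R \o horner g).
  by apply/funext => z /=; rewrite -gE.
have hg : is_derive y 1 (horner g) e.
  have ge : g^`().[y] = e.
    by rewrite /g !poly.derivE !hornerE.
  by rewrite -ge; exact: is_derive_poly.
have gy0 : 0 < g.[y] by rewrite gE e0.
have hl := is_derive1_comp (is_derive1_ln gy0) hg.
apply: is_derive_eq.
by rewrite gE; congr (_ - _); rewrite /GRing.scale/= [_^-1 * _]mulrC.
Qed.

Lemma ln1D_le (x : R) : 0 <= x -> ln (1 + x) <= x - x ^+ 2 / 2 + x ^+ 3 / 3.
Proof.
move=> x0; pose p : {poly R} := 'X - 2^-1 *: 'X^2 + 3^-1 *: 'X^3.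
have pE y : p.[y] = y - y ^+ 2 / 2 + y ^+ 3 / 3.
  by rewrite /p !(hornerD, hornerN, hornerZ, hornerXn, hornerX); field.
have dpE y : p^`().[y] = 1 - y + y ^+ 2.
  by rewrite /p !poly.derivE !(mul1r, mulr1) -?polyC1
    !(hornerM, hornerD, hornerN, hornerZ, hornerXn, hornerX, hornerMn, hornerC) /=; field.
suff : 0 <= p.[x] - 1 * ln (1 + 1 * x) by rewrite pE !mul1r subr_ge0.
apply: (poly_ln_ge0 x0); first by rewrite pE; field.
- by move=> y /andP[y0 _]; rewrite mul1r ltr_wpDr.
move=> y /andP[y0 _]; have y1 : 0 < 1 + y by rewrite ltr_wpDr.
rewrite dpE !mul1r.
have -> : 1 - y + y ^+ 2 - (1 + y)^-1 = y ^+ 3 / (1 + y).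
  by field; rewrite gt_eqF.
by apply: divr_ge0; [exact: exprn_ge0|exact: ltW].
Qed.

Lemma lnN1B_le (x : R) : 0 <= x -> x <= 2^-1 -> - ln (1 - x) <= x + x ^+ 2 / 2 + x ^+ 3.
Proof.
move=> x0 x2; pose p : {poly R} := 'X + 2^-1 *: 'X^2 + 'X^3.
have pE y : p.[y] = y + y ^+ 2 / 2 + y ^+ 3.
  by rewrite /p !(hornerD, hornerN, hornerZ, hornerXn, hornerX); field.
have dpE y : p^`().[y] = 1 + y + 3 * y ^+ 2.
  by rewrite /p !poly.derivE !(mul1r, mulr1) -?polyC1
    !(hornerM, hornerD, hornerN, hornerZ, hornerXn, hornerX, hornerMn, hornerC) /=; field.
suff : 0 <= p.[x] - -1 * ln (1 + -1 * x) by rewrite pE !mulN1r opprK -lerBlDr sub0r.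
apply: (poly_ln_ge0 x0); first by rewrite pE; field.
- by move=> y /andP[y0 yx]; lra.
move=> y /andP[y0 yx]; have y1 : 0 < 1 - y by lra.
rewrite dpE.
have -> : 1 + y + 3 * y ^+ 2 - -1 * (-1 / (1 + -1 * y)) =
  y ^+ 2 * (2 - 3 * y) / (1 - y) by field; rewrite gt_eqF.
by apply: divr_ge0; [apply: mulr_ge0; [exact: sqr_ge0|lra]|exact: ltW].
Qed.

Lemma lnN1B_ge (x : R) : 0 <= x -> x < 1 -> x + x ^+ 2 / 2 <= - ln (1 - x).
Proof.
move=> x0 x1; pose p : {poly R} := - 'X - 2^-1 *: 'X^2.
have pE y : p.[y] = - (y + y ^+ 2 / 2).
  by rewrite /p !(hornerD, hornerN, hornerZ, hornerXn, hornerX); field.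
have dpE y : p^`().[y] = - 1 - y.
  by rewrite /p !poly.derivE !(mul1r, mulr1) -?polyC1
    !(hornerM, hornerD, hornerN, hornerZ, hornerXn, hornerX, hornerMn, hornerC) /=; field.
suff : 0 <= p.[x] - 1 * ln (1 + -1 * x) by rewrite pE mulN1r mul1r addrC subr_ge0.
apply: (poly_ln_ge0 x0); first by rewrite pE; field.
- by move=> y /andP[y0 yx]; lra.
move=> y /andP[y0 yx]; have y1 : 0 < 1 - y by lra.
rewrite dpE.
have -> : - 1 - y - 1 * (-1 / (1 + -1 * y)) = y ^+ 2 / (1 - y).
  by field; rewrite gt_eqF.
by apply: divr_ge0; [exact: sqr_ge0|exact: ltW].
Qed.

End log_bounds.

(** * The bulk increment at its typical size *)

Section taylor.
Context (R : realType).

Lemma stationary_mgf_exp m n (z w : R) : 0 < z -> z < w -> w < 1 ->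
  stationary_mgf m n z w =
  expR (m%:R * ln (w / z) + n%:R * ln ((1 - z) / (1 - w))).
Proof.
move=> z0 zw w1; rewrite /stationary_mgf expRD !expRM_natl !lnK//; rewrite posrE divr_gt0//; lra.
Qed.

(** The linear coefficient of the exponent is the stationary mean, and the
    quadratic one vanishes when rho is the characteristic parameter, where
    m / rho^2 = n / (1 - rho)^2. *)
Lemma stationary_mgf_below m n (rho t : R) : 0 < rho -> rho < 1 -> 0 < t ->
  t <= rho / 2 ->
  stationary_mgf m n (rho - t) rho <=
  expR (t * (m%:R / rho + n%:R / (1 - rho))
    + t ^+ 2 / 2 * (m%:R / rho ^+ 2 - n%:R / (1 - rho) ^+ 2)
    + t ^+ 3 * (m%:R / rho ^+ 3 + n%:R / (1 - rho) ^+ 3)).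
Proof.
move=> r0 r1 t0 tr.
have r1' : 0 < 1 - rho by lra.
rewrite stationary_mgf_exp; [|lra|lra|lra].
rewrite ler_expR.
have x0 : 0 <= t / rho by rewrite divr_ge0// ltW.
have x2 : t / rho <= 2^-1 by rewrite ler_pdivrMr// mulrC.
have y0 : 0 <= t / (1 - rho) by rewrite divr_ge0// ltW.
have e1 : ln (rho / (rho - t)) <= t / rho + (t / rho) ^+ 2 / 2 + (t / rho) ^+ 3.
  have -> : rho / (rho - t) = (1 - t / rho)^-1.
    by field; rewrite !gt_eqF//=; lra.
  rewrite lnV ?lnN1B_le// posrE; lra.
have e2 : ln ((1 - (rho - t)) / (1 - rho)) <= t / (1 - rho) -
    (t / (1 - rho)) ^+ 2 / 2 + (t / (1 - rho)) ^+ 3.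
  have -> : (1 - (rho - t)) / (1 - rho) = 1 + t / (1 - rho).
    by field; rewrite gt_eqF.
  apply: (le_trans (ln1D_le y0)); rewrite lerD2l.
  by have := exprn_ge0 3 y0; lra.
have m0 : 0 <= m%:R :> R by [].
have n0 : 0 <= n%:R :> R by [].
apply: (le_trans (lerD (ler_wpM2l m0 e1) (ler_wpM2l n0 e2))).
rewrite le_eqVlt; apply/orP; left; apply/eqP; field.
by rewrite !gt_eqF.
Qed.

Lemma stationary_mgf_above m n (rho t : R) : 0 < rho -> rho < 1 -> 0 < t ->
  t <= (1 - rho) / 2 ->
  stationary_mgf m n rho (rho + t) <=
  expR (t * (m%:R / rho + n%:R / (1 - rho))
    - t ^+ 2 / 2 * (m%:R / rho ^+ 2 - n%:R / (1 - rho) ^+ 2)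
    + t ^+ 3 * (m%:R / rho ^+ 3 + n%:R / (1 - rho) ^+ 3)).
Proof.
move=> r0 r1 t0 tr.
have r1' : 0 < 1 - rho by lra.
rewrite stationary_mgf_exp; [|lra|lra|lra].
rewrite ler_expR.
have x0 : 0 <= t / rho by rewrite divr_ge0// ltW.
have y0 : 0 <= t / (1 - rho) by rewrite divr_ge0// ltW.
have y2 : t / (1 - rho) <= 2^-1 by rewrite ler_pdivrMr// mulrC.
have e1 : ln ((rho + t) / rho) <= t / rho - (t / rho) ^+ 2 / 2 + (t / rho) ^+ 3.
  have -> : (rho + t) / rho = 1 + t / rho by field; rewrite gt_eqF.
  apply: (le_trans (ln1D_le x0)); rewrite lerD2l.
  by have := exprn_ge0 3 x0; lra.
have e2 : ln ((1 - rho) / (1 - (rho + t))) <= t / (1 - rho) +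
    (t / (1 - rho)) ^+ 2 / 2 + (t / (1 - rho)) ^+ 3.
  have -> : (1 - rho) / (1 - (rho + t)) = (1 - t / (1 - rho))^-1.
    by field; rewrite !gt_eqF//=; lra.
  rewrite lnV ?lnN1B_le// posrE; lra.
have m0 : 0 <= m%:R :> R by [].
have n0 : 0 <= n%:R :> R by [].
apply: (le_trans (lerD (ler_wpM2l m0 e1) (ler_wpM2l n0 e2))).
rewrite le_eqVlt; apply/orP; left; apply/eqP; field.
by rewrite !gt_eqF.
Qed.

End taylor.

(** The factor a in rho = zeta - a h. It is the solution of (2
    a - 1) / 2 = 8 / c^3 + 2: the quadratic term then outweighs the cubic one,
    bounded by 8 / c^3, and leaves the exponent - 2 L. *)
Definition drift_const (R : realType) (c : R) : R := 8 / c ^+ 3 + 5 / 2.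

(** Bounds the sum of the quadratic and cubic coefficients, in units of h N
    t^2. *)
Definition curvature_const (R : realType) (c : R) : R :=
  10 * drift_const c / c ^+ 2 + 8 / c ^+ 3.

(** A lower bound for sqrt L under which all the error terms add up to at most
    1/2. *)
Definition scale_const (R : realType) (c : R) : R :=
  2 * (3 + expR (curvature_const c)).

(** Here (m, n) is a point whose characteristic parameter zeta and its
    complement are at least c, and q = m / zeta^2 = n / (1 - zeta)^2 is the
    typical bulk passage time, which is comparable with N = m + n. *)
Section numeric.
Context (R : realType).
Variables (c h zeta q : R) (m n k : nat).
Local Notation a := (drift_const c).
Local Notation C := (curvature_const c).
Local Notation N := (m%:R + n%:R : R).
Local Notation L := (h ^+ 3 * N).
Hypotheses (c0 : 0 < c) (h0 : 0 < h).
Hypotheses (zc : c <= zeta) (zc' : c <= 1 - zeta).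
Hypotheses (mE : m%:R = q * zeta ^+ 2) (nE : n%:R = q * (1 - zeta) ^+ 2).
Hypotheses (Nq : N <= q) (qN : q <= 2 * N) (N0 : 0 < N).
Hypotheses (ahc : a * h <= c / 4) (hc : h <= c / 4).
Hypotheses (km : (k <= m)%N) (kh : k%:R <= c ^+ 2 / 4 * (h * N)).

Let rho := zeta - a * h.

Let c30 : 0 < c ^+ 3. Proof. exact: exprn_gt0. Qed.
Let c20 : 0 < c ^+ 2. Proof. exact: exprn_gt0. Qed.
Let a1 : 1 <= a.
Proof. by rewrite /drift_const; have : 0 <= 8 / c ^+ 3; [rewrite divr_ge0// ltW|lra]. Qed.
Let d0 : 0 < a * h. Proof. by rewrite mulr_gt0// (lt_le_trans ltr01). Qed.
Let rc : c / 2 <= rho. Proof. by rewrite /rho; have := c0; have := ahc; have := zc; lra. Qed.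
Let rho0 : 0 < rho. Proof. by rewrite (lt_le_trans _ rc)// divr_gt0. Qed.
Let rho1c : c <= 1 - rho.
Proof. by rewrite /rho; have := d0; have := zc'; lra. Qed.
Let rho1 : rho < 1. Proof. by have := c0; have := rho1c; lra. Qed.
Let rho1' : 0 < 1 - rho. Proof. by rewrite subr_gt0. Qed.
Let q0 : 0 < q. Proof. exact: lt_le_trans Nq. Qed.

Let rc_exp j : (c / 2) ^+ j <= rho ^+ j.
Proof. by apply: lerXn2r; rewrite ?nnegrE; [exact: divr_ge0 (ltW c0) _|exact: ltW|exact: rc]. Qed.
Let rc1_exp j : c ^+ j <= (1 - rho) ^+ j.
Proof. by apply: lerXn2r; rewrite ?nnegrE; [exact: ltW|exact: ltW|exact: rho1c]. Qed.

Let mkE : (m - k)%:R = m%:R - k%:R :> R. Proof. by rewrite natrB. Qed.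

(** The left-hand side vanishes at rho = zeta and is Lipschitz in rho with
    constant of order N. *)
Lemma curvature_upper :
  m%:R / rho ^+ 2 - n%:R / (1 - rho) ^+ 2 <= 20 * (a * h) * N / c ^+ 2.
Proof.
set d := a * h; have d0' : 0 < d := d0.
have zE : zeta = rho + d by rewrite /rho /d; ring.
have r2 : 0 < rho ^+ 2 by exact: exprn_gt0.
have r12 : 0 < (1 - rho) ^+ 2 by exact: exprn_gt0.
have dc : 0 <= d / c ^+ 2 by rewrite divr_ge0// ltW.
have h1 : m%:R / rho ^+ 2 <= q * (1 + 8 * (d / c ^+ 2)).
  rewrite ler_pdivrMr// mE -mulrA ler_pM2l// zE.
  have : 2 * d <= 8 * (d / c ^+ 2) * rho ^+ 2.
    have -> : 2 * d = 8 * (d / c ^+ 2) * (c / 2) ^+ 2 by field; rewrite gt_eqF.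
    by apply: ler_wpM2l; [exact: mulr_ge0|exact: rc_exp].
  have : zeta < 1 by have := c0; have := zc'; lra.
  rewrite zE; have := d0'; have := rho1; nra.
have h2 : q * (1 - 2 * (d / c ^+ 2)) <= n%:R / (1 - rho) ^+ 2.
  rewrite ler_pdivlMr// nE -mulrA ler_pM2l// zE.
  have : 2 * d <= 2 * (d / c ^+ 2) * (1 - rho) ^+ 2.
    have -> : 2 * d = 2 * (d / c ^+ 2) * c ^+ 2 by field; rewrite gt_eqF.
    by apply: ler_wpM2l; [exact: mulr_ge0|exact: rc1_exp].
  have := rho0; have := d0'; nra.
have : q * (10 * (d / c ^+ 2)) <= 2 * N * (10 * (d / c ^+ 2)).
  by rewrite ler_wpM2r// mulr_ge0.
have -> : 20 * d * N / c ^+ 2 = 2 * N * (10 * (d / c ^+ 2)) by field; rewrite gt_eqF.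
lra.
Qed.

(** The shift of rho by a h below zeta contributes 2 a h N, and the removal of
    k columns costs at most h N since k <= c^2 / 4 * h N and rho >= c / 2. *)
Lemma curvature_lower :
  (2 * a - 1) * (h * N) <= (m - k)%:R / rho ^+ 2 - n%:R / (1 - rho) ^+ 2.
Proof.
rewrite mkE [(m%:R - k%:R) / _]mulrBl; set d := a * h; have d0' : 0 < d := d0.
have zE : zeta = rho + d by rewrite /rho /d; ring.
have r2 : 0 < rho ^+ 2 by exact: exprn_gt0.
have r12 : 0 < (1 - rho) ^+ 2 by exact: exprn_gt0.
have h1 : q * (1 + 2 * d) <= m%:R / rho ^+ 2.
  rewrite ler_pdivlMr// mE -mulrA ler_pM2l// zE.
  have : 0 <= d * rho * (1 - rho) by exact: (mulr_ge0 (mulr_ge0 (ltW d0') (ltW rho0)) (ltW rho1')).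
  have := sqr_ge0 d; nra.
have h2 : n%:R / (1 - rho) ^+ 2 <= q.
  rewrite ler_pdivrMr// nE ler_pM2l// lerXn2r ?nnegrE//;
  have := d0'; have := c0; have := zc'; have := rho1; rewrite ?zE; lra.
have h3 : k%:R / rho ^+ 2 <= h * N.
  rewrite ler_pdivrMr// (le_trans kh)// mulrC ler_pM2l ?mulr_gt0//.
  have -> : c ^+ 2 / 4 = (c / 2) ^+ 2 by field.
  exact: rc_exp.
have : 2 * d * N <= 2 * d * q by rewrite ler_wpM2l// mulr_ge0// ltW.
have -> : (2 * a - 1) * (h * N) = 2 * d * N - h * N by rewrite /d; ring.
lra.
Qed.

Lemma third_upper m' : (m' <= m)%N ->
  m'%:R / rho ^+ 3 + n%:R / (1 - rho) ^+ 3 <= 8 / c ^+ 3 * N.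
Proof.
move=> m'm.
have cc : 8 / c ^+ 3 = ((c / 2) ^+ 3)^-1 by field; rewrite gt_eqF.
have r1 : (rho ^+ 3)^-1 <= 8 / c ^+ 3.
  by rewrite cc lef_pV2 ?posrE ?exprn_gt0 ?divr_gt0.
have r2 : ((1 - rho) ^+ 3)^-1 <= 8 / c ^+ 3.
  rewrite cc lef_pV2 ?posrE ?exprn_gt0 ?divr_gt0//; apply: le_trans (rc1_exp 3).
  apply: lerXn2r; rewrite ?nnegrE; have := c0; lra.
have m'm' : m'%:R <= m%:R :> R by rewrite ler_nat.
rewrite mulrDr [_ * m%:R]mulrC [_ * n%:R]mulrC lerD//; last by rewrite ler_wpM2l.
by apply: ler_pM => //; rewrite invr_ge0 exprn_ge0// ltW.
Qed.

Lemma mgf_below_le m' t : (m' <= m)%N -> 0 < t -> t <= h ->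
  stationary_mgf m' n (rho - t) rho * expR (- (t * (m'%:R / rho + n%:R / (1 - rho)))) <=
  expR (C * (h * N * t ^+ 2)).
Proof.
move=> m'm t0 th.
have tr : t <= rho / 2 by rewrite (le_trans th)// (le_trans hc)// ; have := rc; lra.
apply: (le_trans (ler_wpM2r (expR_ge0 _) (stationary_mgf_below m' n rho0 rho1 t0 tr))).
rewrite -expRD ler_expR.
set M := m'%:R / rho + _.
have h3 := third_upper m'm.
have h2 : m'%:R / rho ^+ 2 - n%:R / (1 - rho) ^+ 2 <= 20 * (a * h) * N / c ^+ 2.
  apply: le_trans curvature_upper; rewrite lerD2r ler_pM2r ?ler_nat//.
  by rewrite invr_gt0 exprn_gt0.
have k1 : t ^+ 2 / 2 * (m'%:R / rho ^+ 2 - n%:R / (1 - rho) ^+ 2) <=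
    t ^+ 2 / 2 * (20 * (a * h) * N / c ^+ 2).
  by rewrite ler_wpM2l// divr_ge0// sqr_ge0.
have k2 : t ^+ 3 * (m'%:R / rho ^+ 3 + n%:R / (1 - rho) ^+ 3) <=
    (t ^+ 2 * h) * (8 / c ^+ 3 * N).
  apply: ler_pM => //; first by rewrite exprn_ge0// ltW.
    by rewrite addr_ge0// divr_ge0// exprn_ge0// ltW.
  by rewrite exprSr ler_wpM2l// exprn_ge0// ltW.
have -> : C * (h * N * t ^+ 2) = t ^+ 2 / 2 * (20 * (a * h) * N / c ^+ 2) +
    t ^+ 2 * h * (8 / c ^+ 3 * N).
  by rewrite /curvature_const; field; rewrite gt_eqF.
lra.
Qed.

(** The vertical passage time to (m - k, n) is unlikely to reach M: the
    negative quadratic term dominates, by the choice of [drift_const]. *)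
Lemma mgf_above_le :
  stationary_mgf (m - k) n rho (rho + h) *
    expR (- (h * ((m - k)%:R / rho + n%:R / (1 - rho)))) <= expR (- (2 * L)).
Proof.
have hr : h <= (1 - rho) / 2 by have := rho1c; have := c0; have := hc; lra.
apply: (le_trans (ler_wpM2r (expR_ge0 _) (stationary_mgf_above (m - k) n rho0 rho1 h0 hr))).
rewrite -expRD ler_expR.
set M := (m - k)%:R / rho + _.
have h3 := third_upper (leq_subr k m).
have k1 : h ^+ 2 / 2 * ((2 * a - 1) * (h * N)) <=
    h ^+ 2 / 2 * ((m - k)%:R / rho ^+ 2 - n%:R / (1 - rho) ^+ 2).
  by rewrite ler_wpM2l ?curvature_lower// divr_ge0// sqr_ge0.
have k2 : h ^+ 3 * ((m - k)%:R / rho ^+ 3 + n%:R / (1 - rho) ^+ 3) <=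
    h ^+ 3 * (8 / c ^+ 3 * N).
  by rewrite ler_wpM2l// exprn_ge0// ltW.
have : h ^+ 2 / 2 * ((2 * a - 1) * (h * N)) = h ^+ 3 * (8 / c ^+ 3 * N) + 2 * L.
  by rewrite /drift_const; field; rewrite gt_eqF.
lra.
Qed.

Hypothesis Lbig : scale_const c ^+ 2 <= L.

Let g := Num.sqrt L.

(** The first two terms are at most exp (- L). In the third one the threshold
    h^2 N = L / h is compared with an excess of order g / h: with the tilt
    h / g, where g^2 = L, the exponential moment is bounded by exp C, so the
    quotient is of order 1 / g. *)
Lemma bulk_tail_small
  (M := (m - k)%:R / rho + n%:R / (1 - rho))
  (M' := m%:R / rho + n%:R / (1 - rho)) :
  [/\ 0 < rho - h, 0 < rho - h / g, h / g <= h, 0 < h / g & rho + h < 1] /\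
  stationary_mgf m n (rho - h) rho * expR (- ((rho - (rho - h)) * (M' + (C + 1) * (h ^+ 2 * N)))) +
  stationary_mgf (m - k) n rho (rho + h) * expR (- ((rho + h - rho) * (M - h ^+ 2 * N))) +
   (h ^+ 2 * N)^-1 * ((rho - (rho - h / g))^-1 *
       (stationary_mgf (m - k) n (rho - h / g) rho * expR (- ((rho - (rho - h / g)) * M))) +
     (rho + h - rho)^-1 *
       (stationary_mgf (m - k) n rho (rho + h) * expR (- ((rho + h - rho) * M)))) <= 2^-1.
Proof.
have eC := expR_gt0 C.
have G8 : 6 <= scale_const c by rewrite /scale_const; lra.
have gG : scale_const c <= g.
  rewrite -(@ger0_norm _ (scale_const c)) ?(le_trans _ G8)// -sqrtr_sqr.
  by rewrite ler_sqrt// (le_trans _ Lbig)// sqr_ge0.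
have g1 : 1 <= g by rewrite (le_trans _ gG)// (le_trans _ G8)//; lra.
have g0 : 0 < g by exact: lt_le_trans g1.
have L0 : 0 < L by rewrite mulr_gt0// exprn_gt0.
have gL : g ^+ 2 = L by rewrite sqr_sqrtr// ltW.
have hg : h / g <= h by rewrite ler_pdivrMr// ler_peMr// ltW.
have hg0 : 0 < h / g by exact: divr_gt0.
have rh : 0 < rho - h by have := rc; have := c0; have := hc; lra.
split.
  split => //; first by rewrite (lt_le_trans rh)// lerD2l lerN2.
  by have := rho1c; have := c0; have := hc; lra.
have -> : rho - (rho - h) = h by ring.
have -> : rho + h - rho = h by ring.
have -> : rho - (rho - h / g) = h / g by ring.
have p1 := mgf_below_le (leqnn m) h0 (lexx h).
have p2 := mgf_above_le.
have p3 := mgf_below_le (leq_subr k m) hg0 hg.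
(* From exp (- L) <= 1 / L = 1 / g^2 and g >= 1. *)
have eL : expR (- L) <= g^-1.
  apply: (@le_trans _ _ L^-1).
    rewrite expRN lef_pV2 ?posrE ?expR_gt0//.
    by have := expR_ge1Dx L; lra.
  by rewrite -gL lef_pV2 ?posrE ?exprn_gt0// expr2 ler_peMl// ltW.
have q1 : stationary_mgf m n (rho - h) rho * expR (- (h * (M' + (C + 1) * (h ^+ 2 * N)))) <= g^-1.
  apply: (le_trans _ eL).
  have -> : - (h * (M' + (C + 1) * (h ^+ 2 * N))) = - (h * M') + - ((C + 1) * L) by ring.
  rewrite expRD mulrA.
  apply: (le_trans (ler_wpM2r (expR_ge0 _) p1)).
  by rewrite -expRD ler_expR le_eqVlt; apply/orP; left; apply/eqP; ring.
have q2 : stationary_mgf (m - k) n rho (rho + h) * expR (- (h * (M - h ^+ 2 * N))) <= g^-1.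
  apply: (le_trans _ eL).
  have -> : - (h * (M - h ^+ 2 * N)) = - (h * M) + L by ring.
  rewrite expRD mulrA.
  apply: (le_trans (ler_wpM2r (expR_ge0 _) p2)).
  by rewrite -expRD ler_expR le_eqVlt; apply/orP; left; apply/eqP; ring.
have b0 : 0 < (h ^+ 2 * N)^-1 by rewrite invr_gt0 mulr_gt0// exprn_gt0.
have q3 : (h ^+ 2 * N)^-1 * ((h / g)^-1 *
       (stationary_mgf (m - k) n (rho - h / g) rho * expR (- (h / g * M)))) <= expR C * g^-1.
  have eE : C * (h * N * (h / g) ^+ 2) = C.
    have -> : h * N * (h / g) ^+ 2 = L / g ^+ 2 by field; rewrite gt_eqF.
    by rewrite gL divff ?mulr1// gt_eqF.
  rewrite eE in p3.
  have hg0' : 0 <= (h / g)^-1 by rewrite invr_ge0 ltW.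
  apply: (le_trans (ler_wpM2l (ltW b0) (ler_wpM2l hg0' p3))).
  have -> : (h ^+ 2 * N)^-1 * ((h / g)^-1 * expR C) = expR C * (g / L).
    by field; rewrite !gt_eqF.
  suff -> : g / L = g^-1 by [].
  by rewrite -gL; field; rewrite gt_eqF.
have q4 : (h ^+ 2 * N)^-1 * (h^-1 *
       (stationary_mgf (m - k) n rho (rho + h) * expR (- (h * M)))) <= g^-1.
  have p2' : stationary_mgf (m - k) n rho (rho + h) * expR (- (h * M)) <= 1.
    apply: (le_trans p2); rewrite -[leRHS]expR0 ler_expR oppr_le0.
    exact: mulr_ge0 (ler0n _ 2) (ltW L0).
  have h0' : 0 <= h^-1 by rewrite invr_ge0 ltW.
  apply: (le_trans (ler_wpM2l (ltW b0) (ler_wpM2l h0' p2'))).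
  have -> : (h ^+ 2 * N)^-1 * (h^-1 * 1) = L^-1 by field; rewrite !gt_eqF.
  by rewrite -gL lef_pV2 ?posrE ?exprn_gt0// expr2 ler_peMl// ltW.
rewrite [(h ^+ 2 * N)^-1 * (_ + _)]mulrDr.
apply: (le_trans (lerD (lerD q1 q2) (lerD q3 q4))).
have -> : g^-1 + g^-1 + (expR C * g^-1 + g^-1) = (3 + expR C) / g by field; rewrite gt_eqF.
rewrite ler_pdivrMr//; move: gG; rewrite /scale_const; lra.
Qed.

End numeric.

(** * Amplitude and cost of the tilt *)

(** The relative amplitude A h of the tilt. The second-order gain A / 2 has to
    pay for the deviation (C + 3) h^2 N, for the loss of a factor 2 in the
    Paley-Zygmund inequality, both measured against k >= c^2 / 4 * h N, and
    for the discrepancy (K + a) h between the rate w and rho. *)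
Definition tilt_const (R : realType) (c K : R) : R :=
  2 * ((2 * curvature_const c + 7) / (c ^+ 2 / 4) + 2 * (K + drift_const c) / c) + 1.

Section amplitude.
Context (R : realType).

Lemma drift_const_ge1 (c : R) : 0 < c -> 1 <= drift_const c.
Proof.
move=> c0; rewrite /drift_const.
have : 0 <= 8 / c ^+ 3 by rewrite divr_ge0// exprn_ge0// ltW.
lra.
Qed.

Lemma curvature_const_ge0 (c : R) : 0 < c -> 0 <= curvature_const c.
Proof.
move=> c0; rewrite /curvature_const addr_ge0// divr_ge0// ?exprn_ge0 ?(ltW c0)//.
by rewrite mulr_ge0// (le_trans ler01)// drift_const_ge1.
Qed.

Lemma tilt_const_ge1 (c K : R) : 0 < c -> 0 <= K -> 1 <= tilt_const c K.
Proof.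
move=> c0 K0; have C0 := curvature_const_ge0 c0; have a1 := drift_const_ge1 c0.
rewrite /tilt_const lerDr mulr_ge0// addr_ge0// divr_ge0//.
- by rewrite addr_ge0// mulr_ge0.
- by rewrite divr_ge0// sqr_ge0.
- by rewrite mulr_ge0// addr_ge0// (le_trans ler01).
- exact: ltW.
Qed.

(** The inequality - ln (1 - s) >= s + s^2 / 2 turns the exponent of the
    tilted sum into (k + 1) (1 + s / 2) / w, up to an error 1 / (w s). Its
    leading part exceeds k / rho up to the discrepancy between w and rho, and
    the gain s / 2 covers everything else by the choice of [tilt_const]. *)
Lemma tilted_sum_large (c K h zeta Nr w : R) (k : nat)
    (rho := zeta - drift_const c * h) (s := tilt_const c K * h) :
  0 < c -> 0 <= K -> 0 < h -> zeta <= 1 -> c / 2 <= rho -> K * h <= 1 ->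
  s <= 4^-1 -> 1 <= h ^+ 3 * Nr -> 0 <= Nr -> c ^+ 2 / 4 * (h * Nr) <= k.+1%:R ->
  0 < w -> w <= zeta + K * h ->
  h ^+ 2 * Nr <= (- k.+1%:R * ln (1 - s) - ln 2) / (w * s) -
     (k%:R / rho + (curvature_const c + 2) * (h ^+ 2 * Nr)).
Proof.
move=> c0 K0 h0 z1 rc Kh s4 L1 N0 kk w0 wz.
set A := tilt_const c K in s s4 *; set C := curvature_const c.
set a := drift_const c in rho rc *.
have A1 : 1 <= A by exact: tilt_const_ge1.
have A0 : 0 < A by exact: lt_le_trans A1.
have C0 : 0 <= C by exact: curvature_const_ge0.
have a1 : 1 <= a by exact: drift_const_ge1.
have s0 : 0 < s by exact: mulr_gt0.
have rho0 : 0 < rho by rewrite (lt_le_trans _ rc)// divr_gt0.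
set H := h ^+ 2 * Nr.
have H0 : 0 <= H by rewrite mulr_ge0// sqr_ge0.
have k0 : 0 <= k%:R :> R by [].
have kK : k.+1%:R = k%:R + 1 :> R by rewrite natr1.
set kr := k.+1%:R in kk kK *.
have kr0 : 0 <= kr by rewrite /kr.
have ln2 : ln (2 : R) <= 1.
  have := ln1D_le (@ler01 R); rewrite !expr1n (_ : 1 + 1 = 2)//; lra.
have ls : s + s ^+ 2 / 2 <= - ln (1 - s) by apply: lnN1B_ge; lra.
have X1 : kr * (s + s ^+ 2 / 2) - 1 <= - kr * ln (1 - s) - ln 2.
  by have := ler_wpM2l kr0 ls; lra.
rewrite lerBrDr.
suff h1 : H + (k%:R / rho + (C + 2) * H) <= (kr * (s + s ^+ 2 / 2) - 1) / (w * s).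
  by apply: (le_trans h1); rewrite ler_pM2r// invr_gt0 mulr_gt0.
rewrite ler_pdivlMr ?mulr_gt0//.
have Kac0 : 0 <= (K + a) * h * (2 / c).
  apply: mulr_ge0; last by rewrite divr_ge0 ?(ltW c0).
  by apply: mulr_ge0; [apply: addr_ge0 => //; exact: le_trans a1|exact: ltW].
have hw : (H + (k%:R / rho + (C + 2) * H)) * w <=
    k%:R + kr * (K + a) * h * (2 / c) + 2 * (C + 3) * H.
  have e1 : k%:R / rho * w <= k%:R + kr * (K + a) * h * (2 / c).
    have -> : k%:R / rho * w = k%:R * (w / rho) by rewrite mulrAC mulrA.
    have : w / rho <= 1 + (K + a) * h * (2 / c).
      rewrite ler_pdivrMr//.
      have : (K + a) * h <= (K + a) * h * (2 / c) * rho.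
        have e0 : (K + a) * h = (K + a) * h * (2 / c) * (c / 2) by field; rewrite gt_eqF.
        rewrite [leLHS]e0.
        exact: ler_wpM2l.
      have zE : zeta = rho + a * h by rewrite /rho; ring.
      move=> H1; rewrite mulrDl mul1r; apply: (le_trans wz); rewrite zE -addrA lerD2l.
      by rewrite addrC -mulrDl.
    move=> /(ler_wpM2l k0) /le_trans; apply.
    rewrite mulrDr mulr1 lerD2l.
    have -> : kr * (K + a) * h * (2 / c) = kr * ((K + a) * h * (2 / c)) by ring.
    apply: ler_wpM2r; last by rewrite kK lerDl.
    exact: Kac0.
  have e2 : (C + 3) * H * w <= (C + 3) * H * 2.
    apply: ler_wpM2l; last by lra.
    by rewrite mulr_ge0// addr_ge0.
  lra.
have hws := ler_wpM2r (ltW s0) hw.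
have -> : (H + (k%:R / rho + (C + 2) * H)) * (w * s) =
   (H + (k%:R / rho + (C + 2) * H)) * w * s by rewrite mulrA.
apply: (le_trans hws).
(* Absorbs the factor 1/2 of the Paley-Zygmund event, whose logarithm is at
   least - 1. *)
have sH : 1 <= s * H.
  have -> : s * H = A * (h ^+ 3 * Nr) by rewrite /s /H; ring.
  by rewrite (le_trans L1)// ler_peMl// (le_trans ler01).
have krh : c ^+ 2 / 4 * H <= kr * h.
  have -> : c ^+ 2 / 4 * H = c ^+ 2 / 4 * (h * Nr) * h by rewrite /H; ring.
  by apply: ler_wpM2r kk; exact: ltW.
have AE : A / 2 = (2 * C + 7) / (c ^+ 2 / 4) + (K + a) * (2 / c) + 2^-1.
  by rewrite /A /tilt_const -/C -/a; field; rewrite gt_eqF.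
have e3 : (2 * C + 7) * H <= (2 * C + 7) / (c ^+ 2 / 4) * (kr * h).
  have -> : (2 * C + 7) * H = (2 * C + 7) / (c ^+ 2 / 4) * (c ^+ 2 / 4 * H).
    by field; rewrite gt_eqF.
  apply: ler_wpM2l krh; rewrite divr_ge0 ?divr_ge0 ?sqr_ge0//.
  by rewrite addr_ge0// mulr_ge0.
have e4 : kr * (K + a) * h * (2 / c) + 2 * (C + 3) * H + H <= kr * (A / 2 * h).
  have -> : kr * (A / 2 * h) = (2 * C + 7) / (c ^+ 2 / 4) * (kr * h) +
     kr * (K + a) * h * (2 / c) + kr * h / 2 by rewrite AE; field; rewrite gt_eqF.
  have : 0 <= kr * h / 2 by rewrite divr_ge0// mulr_ge0// ltW.
  lra.
have e5 := ler_wpM2r (ltW s0) e4.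
have e6 : kr * (A / 2 * h) * s = kr * (s ^+ 2 / 2) by rewrite /s; field.
have e7 : k%:R * s <= kr * s by rewrite ler_wpM2r ?(ltW s0)// kK lerDl.
lra.
Qed.

(** Each of the k + 1 factors is at least exp (- 8 s^2), and k + 1 <= 2 h N;
    the numerical constants are absorbed since L >= 1. *)
Lemma tilt_cost (A h Nr s : R) (k : nat) : s = A * h -> 0 < A -> 0 < h -> h <= 1 ->
  s <= 4^-1 -> 1 <= h ^+ 3 * Nr -> 0 <= Nr -> k%:R <= h * Nr ->
  expR (- ((16 * A ^+ 2 + 3) * (h ^+ 3 * Nr))) <=
  2^-1 * (((1 - 2 * s) / (1 - s) ^+ 2) ^+ k.+1 / 4).
Proof.
move=> sE A0 h0 h1 s4 L1 N0 kN.
have s0 : 0 < s by rewrite sE mulr_gt0.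
set L := h ^+ 3 * Nr in L1 *.
have hN1 : 1 <= h * Nr.
  apply: (le_trans L1); rewrite /L exprS -mulrA; apply: ler_wpM2l; first exact: ltW.
  by rewrite ler_piMl// exprn_ile1// ltW.
have kN2 : k.+1%:R <= 2 * (h * Nr) by rewrite -natr1; lra.
have y1 : expR (- (8 * s ^+ 2)) <= (1 - 2 * s) / (1 - s) ^+ 2.
  have x4 : 4 * s ^+ 2 <= 4^-1 by nra.
  apply: (@le_trans _ _ (1 - 4 * s ^+ 2)).
    rewrite expRN invf_ple ?posrE ?expR_gt0//; last lra.
    apply: (@le_trans _ _ (1 + 8 * s ^+ 2)); last by have := expR_ge1Dx (8 * s ^+ 2); lra.
    rewrite -[_^-1]mul1r ler_pdivrMr; last lra.
    have := sqr_ge0 s; nra.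
  have s1 : 0 < (1 - s) ^+ 2 by rewrite exprn_gt0//; lra.
  rewrite ler_pdivlMr//.
  have : 4^-1 <= (1 - s) ^+ 2 by nra.
  have := sqr_ge0 s; nra.
have y2 : expR (- (16 * A ^+ 2 * L)) <= ((1 - 2 * s) / (1 - s) ^+ 2) ^+ k.+1.
  have -> : 16 * A ^+ 2 * L = 2 * (h * Nr) * (8 * s ^+ 2) by rewrite sE /L; ring.
  apply: (@le_trans _ _ (expR (- (8 * s ^+ 2)) ^+ k.+1)).
    rewrite -expRM_natl ler_expR mulrN lerN2; apply: ler_wpM2r kN2.
    by rewrite mulr_ge0// sqr_ge0.
  by apply: lerXn2r; rewrite ?nnegrE ?expR_ge0//; apply: le_trans y1; exact: expR_ge0.
have y3 : expR (- (3 * L)) <= 8^-1.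
  rewrite expRN lef_pV2 ?posrE ?expR_gt0// expRM_natl.
  have -> : 8 = 2 ^+ 3 :> R by rewrite -natrX.
  apply: lerXn2r; rewrite ?nnegrE ?expR_ge0//.
  by have := expR_ge1Dx L; lra.
have -> : - ((16 * A ^+ 2 + 3) * L) = - (16 * A ^+ 2 * L) + - (3 * L) by ring.
rewrite expRD; apply: (le_trans (ler_pM (expR_ge0 _) (expR_ge0 _) y2 y3)).
by rewrite le_eqVlt; apply/orP; left; apply/eqP; field; lra.
Qed.

End amplitude.

(** * The horizontal bound at scale h, and transposition *)

(** The number zeta is the characteristic parameter of (m, n): the ratios
    m / zeta^2 and n / (1 - zeta)^2 agree, and their common value is (sqrt
    m + sqrt n)^2. *)
Lemma zeta_decomposition (R : realType) (m n : nat) (zeta := zeta (toR2 R (m, n)))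
    (q := (Num.sqrt m%:R + Num.sqrt n%:R) ^+ 2) : (0 < m)%N -> (0 < n)%N ->
  [/\ m%:R = q * zeta ^+ 2, n%:R = q * (1 - zeta) ^+ 2, m%:R + n%:R <= q &
      q <= 2 * (m%:R + n%:R)].
Proof.
move=> m0 n0; rewrite /zeta /Defs.zeta /toR2/= /q.
set x := Num.sqrt _; set y := Num.sqrt _.
have x0 : 0 < x by rewrite sqrtr_gt0 ltr0n.
have y0 : 0 < y by rewrite sqrtr_gt0 ltr0n.
have xE : m%:R = x ^+ 2 by rewrite sqr_sqrtr.
have yE : n%:R = y ^+ 2 by rewrite sqr_sqrtr.
have xy : x + y != 0 by rewrite gt_eqF// addr_gt0.
split.
- by rewrite xE; field.
- by rewrite yE; field.
- by rewrite xE yE sqrrD; have := mulr_gt0 x0 y0; lra.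
- by rewrite xE yE sqrrD; have := sqr_ge0 (x - y); rewrite sqrrB; lra.
Qed.

Section core.
Context d (T : measurableType d) (R : realType) (P : probability T R).
Context (W : coupled_weights P) (v : nat * nat).

(** The axis is followed for k steps, with k the integer part of c^2 / 4 * h
    N. This is a multiple of h N, the length over which an excess of relative
    size h is of order h^2 N, and small enough for the remaining point (m - k,
    n) to keep its characteristic parameter within O(h) of zeta. *)
Lemma hor_exceeds (c K h w z : R) (N := v.1%:R + v.2%:R : R) :
  (0 < v.1)%N -> (0 < v.2)%N -> 0 < c -> 0 <= K -> 0 < h ->
  c <= zeta (toR2 R v) -> c <= 1 - zeta (toR2 R v) ->
  drift_const c * h <= c / 4 -> h <= c / 4 -> h <= 1 -> tilt_const c K * h <= 4^-1 ->
  K * h <= 1 -> scale_const c ^+ 2 <= h ^+ 3 * N ->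
  0 < w -> z < 1 -> w <= zeta (toR2 R v) + K * h ->
  ((expR (- ((16 * tilt_const c K ^+ 2 + 3) * (h ^+ 3 * N))))%:E <=
   P [set t | (h ^+ 2 * N <= Ghor W w z v t - G W v t)%R])%E.
Proof.
move=> v1 v2 c0 K0 h0 zc zc' ahc hc h1 Ah Kh Lbig w0 z1 wz.
set A := tilt_const c K in Ah *.
have A1 : 1 <= A by exact: tilt_const_ge1.
have A0 : 0 < A by exact: lt_le_trans A1.
set s := A * h in Ah.
have s0 : 0 < s by exact: mulr_gt0.
have [mE nE Nq qN] := zeta_decomposition R v1 v2.
rewrite -surjective_pairing in mE nE.
set ze := zeta (toR2 R v) in zc zc' wz mE nE; set q := (_ ^+ 2) in mE nE Nq qN.
have N0 : 0 < N by rewrite addr_gt0// ltr0n.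
have kr0 : 0 <= c ^+ 2 / 4 * (h * N).
  by apply: mulr_ge0; [exact: divr_ge0 (sqr_ge0 _) _|exact: mulr_ge0 (ltW h0) (ltW N0)].
set k := Num.truncn (c ^+ 2 / 4 * (h * N)).
have /andP[kh kh'] := truncn_itv kr0.
rewrite -/k in kh kh'.
have c1 : c <= 1 by have := zc; have := zc'; lra.
have c21 : c ^+ 2 <= 1 by rewrite exprn_ile1// ltW.
have hN : h * N <= N by rewrite ler_piMl// ltW.
have kN : k%:R <= h * N.
  apply: (le_trans kh); rewrite ler_piMl//; first exact: mulr_ge0 (ltW h0) (ltW N0).
  by lra.
have km : (k < v.1)%N.
  rewrite -(ltr_nat R); apply: (le_lt_trans kh).
  have e1 : N * c ^+ 2 <= v.1%:R.
    rewrite mE; apply: ler_pM => //; [exact: ltW|exact: sqr_ge0|].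
    by apply: lerXn2r => //; rewrite nnegrE ltW// (lt_le_trans c0).
  apply: lt_le_trans e1.
  have : c ^+ 2 / 4 * (h * N) <= c ^+ 2 / 4 * N.
    by apply: ler_wpM2l hN; exact: divr_ge0 (sqr_ge0 _) _.
  have : 0 < N * c ^+ 2 by rewrite mulr_gt0// exprn_gt0.
  lra.
have [[r1 r2 r3 r4 r5]] := bulk_tail_small c0 h0 zc zc' mE nE Nq qN N0 ahc hc (ltnW km) kh Lbig.
set rho := ze - _ in r1 r2 r3 r4 r5 *.
set g := Num.sqrt _ in r2 r3 r4 *.
set M := (v.1 - k)%:R / rho + _; set M' := v.1%:R / rho + _ => small.
have tail := @bulk_increment_tail _ _ _ _ W v v1 v2 k rho (rho + h) (rho - h) (rho - h / g)
  (M' + (curvature_const c + 1) * (h ^+ 2 * N)) (h ^+ 2 * N) km r1.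
have {}tail := tail ltac:(lra) r2 ltac:(lra) ltac:(lra) r5 (mulr_gt0 (exprn_gt0 2 h0) N0).
rewrite -lee_fin in small; have {small}tail := le_trans tail small.
rewrite -/M in tail.
have rc : c / 2 <= rho by rewrite /rho; lra.
have rho0 : 0 < rho by rewrite (lt_le_trans _ rc)// divr_gt0.
set D := M' + _ - _ in tail.
have DE : D = k%:R / rho + (curvature_const c + 2) * (h ^+ 2 * N).
  rewrite /D /M /M' natrB ?(ltnW km)//; ring.
pose B := [set t | (G W v t - lpp (fun p => bulk W p t) (k.+1, 1%N) v < D)%R].
have mG : measurable_fun setT (G W v) := measurable_bulk_lpp W v 0.
have mGhor : measurable_fun setT (Ghor W w z v).
  by apply: measurable_lpp => p _ _; exact: measurable_funPT.
have mB : measurable B.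
  by apply: measurable_lt; apply: measurable_funB => //; exact: measurable_bulk_lpp.
have PBE : P B = (fine (P B))%:E by rewrite fineK// fin_num_measure.
have PB : 2^-1 <= fine (P B).
  have BC : B = ~` [set t | (D <= G W v t - lpp (fun p => bulk W p t) (k.+1, 1%N) v)%R].
    by apply/seteqP; split => t; rewrite /B /= ltNge => /negP.
  rewrite -lee_fin -PBE BC probability_setC//; last first.
    by apply: measurable_ge; apply: measurable_funB => //; exact: measurable_bulk_lpp.
  have -> : (2^-1)%:E = (1 - (2^-1)%:E)%E :> \bar R by rewrite -EFinB; congr EFin; field.
  exact: leeB.
have low := hor_increment_lower km v2 w0 z1 s0 ltac:(lra) PBE.
have L1 : 1 <= h ^+ 3 * N.
  apply: le_trans Lbig; rewrite -[leLHS](expr1n _ 2); apply: lerXn2r; rewrite ?nnegrE//.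
    by rewrite /scale_const; have := expR_gt0 (curvature_const c); lra.
  by rewrite /scale_const; have := expR_gt0 (curvature_const c); lra.
have cost := tilt_cost (erefl s) A0 h0 h1 Ah L1 (ltW N0) kN.
have large := tilted_sum_large c0 K0 h0 _ rc Kh Ah L1 (ltW N0) (ltW kh') w0 wz.
have {}large := large ltac:(lra).
rewrite -DE in large.
apply: (@le_trans _ _ (fine (P B) * (((1 - 2 * s) / (1 - s) ^+ 2) ^+ k.+1 / 4))%:E).
  rewrite lee_fin; apply: (le_trans cost); apply: ler_wpM2r PB.
  by apply: divr_ge0 => //; apply: exprn_ge0; apply: divr_ge0; [lra|exact: sqr_ge0].
apply: (le_trans low); apply: le_measure; rewrite ?inE.
- by apply: measurable_ge; exact: measurable_funB.
- by apply: measurable_ge; exact: measurable_funB.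
by move=> t /=; exact: le_trans.
Qed.

End core.

Section transposed.
Context d (T : measurableType d) (R : realType) (P : probability T R).
Context (W : coupled_weights P).

Lemma transposed_weight (w z : R) p :
  boundary_weight (bulk W \o transpose) (fun w => ver W (1 - w))
    (fun z => hor W (1 - z)) w z p = weight W (1 - z) (1 - w) (transpose p).
Proof. by case: p => -[|i] [|j]. Qed.

Lemma transposed_independence (w z : R) : 0 < w -> z < 1 ->
  mutually_independent (boundary_weight (bulk W \o transpose)
    (fun w => ver W (1 - w)) (fun z => hor W (1 - z)) w z).
Proof.
move=> w0 z1 s A us mA.
have z0' : 0 < 1 - z by lra.
have w1' : 1 - w < 1 by lra.
have ut : uniq (map transpose s) by rewrite map_inj_uniq//; exact: inv_inj transposeK.
have := weight_independence W z0' w1' ut (fun p => mA (transpose p)).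
rewrite big_map; under [in X in _ = X -> _]eq_bigr do rewrite transposeK.
under [in X in _ -> _ = X]eq_bigr do rewrite transposed_weight.
move=> <-; congr (P _); apply/seteqP; split => t h p ps.
  move: (h (transpose p)); rewrite transposed_weight transposeK; apply.
  by move: ps => /= /mapP[q qs ->]; rewrite transposeK.
by move: (h _ (map_f transpose ps)); rewrite transposed_weight transposeK.
Qed.

(** Exchanging the axes turns the horizontal rate w into the vertical
    parameter 1 - w, and z into 1 - z. *)
Definition transposed : coupled_weights P.
Proof.
refine (@CoupledWeights _ _ _ P (bulk W \o transpose) (fun w => ver W (1 - w))
  (fun z => hor W (1 - z)) _ _ _ transposed_independence).
- by move=> i j i0 j0; exact: bulk_law.
- move=> w i w0 i0; have w1 : 1 - w < 1 by lra.
  by have := ver_law W w1 i0; rewrite subKr.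
- by move=> z j z1 j0; apply: hor_law => //; rewrite subr_gt0.
Defined.

Lemma G_transposed v t : (0 < v.1)%N -> (0 < v.2)%N ->
  G transposed (transpose v) t = G W v t.
Proof. by move=> v1 v2; exact: (@lpp_transpose _ _ (1%N, 1%N) v). Qed.

Lemma Ghor_transposed w z v t : (0 < v.2)%N ->
  Ghor transposed (1 - z) (1 - w) (transpose v) t = Gver W w z v t.
Proof.
move=> v2; rewrite /Ghor /Gver -(@lpp_transpose _ _ (0%N, 1%N) v)//.
apply: eq_lpp => p _ _; rewrite /= /weight transposed_weight /weight.
by rewrite !subKr.
Qed.

End transposed.

(** * Lower tail bounds *)

(** The value of zeta on the side x = delta y of the cone, and of 1 - zeta on
    the other side. *)
Definition cone_const (R : realType) (delta : R) : R :=
  Num.sqrt delta / (Num.sqrt delta + 1).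

Lemma cone_zeta (R : realType) (delta x y : R) : 0 < delta -> cone delta (x, y) ->
  cone_const delta <= zeta (x, y) /\ cone_const delta <= 1 - zeta (x, y).
Proof.
move=> d0 [/= x0 y0 xd yd]; rewrite /zeta /cone_const/=.
have sx0 : 0 < Num.sqrt x by rewrite sqrtr_gt0.
have sy0 : 0 < Num.sqrt y by rewrite sqrtr_gt0.
have sd0 : 0 < Num.sqrt delta by rewrite sqrtr_gt0.
have hx : Num.sqrt delta * Num.sqrt y <= Num.sqrt x.
  by rewrite -sqrtrM ?(ltW d0)//; apply: ler_wsqrtr.
have hy : Num.sqrt delta * Num.sqrt x <= Num.sqrt y.
  by rewrite -sqrtrM ?(ltW d0)//; apply: ler_wsqrtr.
have -> : 1 - Num.sqrt x / (Num.sqrt x + Num.sqrt y) =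
    Num.sqrt y / (Num.sqrt x + Num.sqrt y).
  by field; rewrite gt_eqF// addr_gt0.
by split; rewrite ler_pdivrMr ?addr_gt0// mulrAC ler_pdivlMr ?addr_gt0//; lra.
Qed.

(** The minimum of the thresholds on h imposed by the conditions of
    [hor_exceeds]. *)
Definition step_bound (R : realType) (c K : R) : R :=
  Num.min (Num.min 1 (c / 4)) (Num.min (Num.min (c / 4 / drift_const c)
    (4^-1 / tilt_const c K)) (K + 1)^-1).

Lemma step_bound_gt0 (R : realType) (c K : R) : 0 < c -> 0 <= K -> 0 < step_bound c K.
Proof.
move=> c0 K0; have a1 := drift_const_ge1 c0; have A1 := tilt_const_ge1 c0 K0.
rewrite /step_bound !lt_min ltr01 !divr_gt0//= ?invr_gt0//; lra.
Qed.

Lemma step_bound_le (R : realType) (c K h : R) : 0 < c -> 0 <= K -> 0 <= h -> h <= step_bound c K ->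
  [/\ drift_const c * h <= c / 4, h <= c / 4, h <= 1, tilt_const c K * h <= 4^-1 &
      K * h <= 1].
Proof.
move=> c0 K0 h0; have a1 := drift_const_ge1 c0; have A1 := tilt_const_ge1 c0 K0.
rewrite /step_bound !le_min -!andbA => /and5P[h1 h2 h3 h4 h5]; split => //.
- by rewrite mulrC -ler_pdivlMr// (lt_le_trans ltr01).
- by rewrite mulrC -ler_pdivlMr// (lt_le_trans ltr01).
- apply: (@le_trans _ _ (h * (K + 1))); first lra.
  by rewrite -ler_pdivlMr ?div1r//; lra.
Qed.

(** In terms of S = sqrt s and e = N^(1/3) all the powers are integral, and
    h = S / e. *)
Lemma scaling_powers (R : realType) (s N : R) (h := Num.sqrt s / N `^ 3^-1) :
  0 < s -> 0 < N ->
  [/\ h ^+ 2 * N = s * N `^ (1 / 3), h ^+ 3 * N = s `^ (3 / 2),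
      s `^ (1 / 2) * N `^ (- (1 / 3)) = h &
      forall b, 0 <= b -> (s <= b ^+ 2 * N `^ (2 / 3)) -> h <= b].
Proof.
move=> s0 N0; rewrite /h !div1r.
set S := Num.sqrt s; set e := N `^ 3^-1.
have S0 : 0 < S by rewrite sqrtr_gt0.
have e0 : 0 < e by exact: powR_gt0.
have SE : s = S ^+ 2 by rewrite sqr_sqrtr// ltW.
have NE : N = e ^+ 3.
  by rewrite /e -powR_mulrn ?powR_ge0// -powRrM mulVf ?powRr1// ltW.
have s2 : s `^ 2^-1 = S by rewrite powR12_sqrt// ltW.
have s3 : s `^ (3 / 2) = S ^+ 3.
  by rewrite mulrC powRrM s2 powR_mulrn// ltW.
have N2 : N `^ (2 / 3) = e ^+ 2.
  by rewrite mulrC powRrM powR_mulrn// ltW.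
have eN : e != 0 by rewrite gt_eqF.
split.
- by rewrite {1}NE SE; field.
- by rewrite {1}NE s3; field.
- by rewrite s2 powRN.
move=> b b0; rewrite N2 SE -exprMn => h1; rewrite ler_pdivrMr//.
by move: h1; rewrite ler_pXn2r// nnegrE ?mulr_ge0// ltW.
Qed.

Section tail.
Context (R : realType) (delta K : R).
Hypotheses (delta0 : 0 < delta) (K0 : 0 <= K).
Let c := cone_const delta.

Lemma cone_const_gt0 : 0 < c.
Proof. by have := delta0; rewrite /c /cone_const => d0; rewrite divr_gt0 ?addr_gt0 ?sqrtr_gt0. Qed.

Lemma hor_lower_tail d (T : measurableType d) (P : probability T R)
    (W : coupled_weights P) (v : nat * nat) (s w z : R) :
  cone delta (toR2 R v) -> scale_const c ^+ 2 <= s ->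
  s <= step_bound c K ^+ 2 * l1norm (toR2 R v) `^ (2 / 3) ->
  0 < w -> z < 1 ->
  w <= zeta (toR2 R v) + K * s `^ (1 / 2) * l1norm (toR2 R v) `^ (- (1 / 3)) ->
  ((expR (- ((16 * tilt_const c K ^+ 2 + 3) * s `^ (3 / 2))))%:E <=
   P [set t | (s * l1norm (toR2 R v) `^ (1 / 3) <= Ghor W w z v t - G W v t)%R])%E.
Proof.
move=> cv ss se w0 z1 wz.
have [zc zc'] := cone_zeta delta0 cv.
have [/= v1 v2 _ _] := cv; rewrite !ltr0n in v1 v2.
have c0 : 0 < c := cone_const_gt0.
have NE : l1norm (toR2 R v) = v.1%:R + v.2%:R by rewrite /l1norm/= !ger0_norm.
have N0 : 0 < l1norm (toR2 R v) by rewrite NE addr_gt0// ltr0n.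
have s1 : 1 <= s.
  apply: le_trans ss; rewrite -[leLHS](expr1n _ 2); apply: lerXn2r; rewrite ?nnegrE//;
  by rewrite /scale_const; have := expR_gt0 (curvature_const c); lra.
have s0 : 0 < s by exact: lt_le_trans s1.
have b0 := step_bound_gt0 c0 K0.
have [h2 h3 hK /(_ _ (ltW b0) se)] := scaling_powers s0 N0.
set h := Num.sqrt s / _ in h2 h3 hK * => hb.
have h0 : 0 < h by rewrite divr_gt0 ?sqrtr_gt0// powR_gt0.
have [k1 k2 k3 k4 k5] := step_bound_le c0 K0 (ltW h0) hb.
rewrite -mulrA hK in wz.
rewrite -h2 -h3 NE in ss *.
apply: hor_exceeds => //.
apply: (le_trans ss); rewrite -NE h3.
rewrite -[leLHS](@powRr1 _ s) ?(ltW s0)//; apply: ler_powR => //; lra.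
Qed.

End tail.

Theorem theorem2p7 (R : realType) (delta : R) (hdelta : 0 < delta) :
  exists s0 : R, 0 < s0 /\
  forall K : R, 0 <= K ->
  exists (C0 eps0 : R) (N0 : nat), [/\ 0 < C0, 0 < eps0, (0 < N0)%N &
  forall (d : measure_display) (T : measurableType d) (P : probability T R)
    (W : coupled_weights P) (v : nat * nat) (s w z : R),
  (N0 <= v.1)%N -> (N0 <= v.2)%N -> cone delta (toR2 R v) ->
  s0 <= s -> s <= eps0 * l1norm (toR2 R v) `^ (2 / 3) ->
  0 < w -> z < 1 ->
  (w <= zeta (toR2 R v)
        + K * s `^ (1 / 2) * l1norm (toR2 R v) `^ (- (1 / 3)) ->
   (P [set t | (s * l1norm (toR2 R v) `^ (1 / 3)
                <= Ghor W w z v t - G W v t)%R]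
    >= (expR (- (C0 * s `^ (3 / 2))))%:E)%E) /\
  (z >= zeta (toR2 R v)
        - K * s `^ (1 / 2) * l1norm (toR2 R v) `^ (- (1 / 3)) ->
   (P [set t | (s * l1norm (toR2 R v) `^ (1 / 3)
                <= Gver W w z v t - G W v t)%R]
    >= (expR (- (C0 * s `^ (3 / 2))))%:E)%E)].
Proof.
set c := cone_const delta.
exists (scale_const c ^+ 2); split.
  by rewrite exprn_gt0// /scale_const; have := expR_gt0 (curvature_const c); lra.
move=> K K0; exists (16 * tilt_const c K ^+ 2 + 3), (step_bound c K ^+ 2), 1%N; split => //.
- by rewrite ltr_wpDl// mulr_ge0// sqr_ge0.
- by rewrite exprn_gt0// step_bound_gt0// cone_const_gt0.
move=> d T P W v s w z v1 v2 cv ss se w0 z1; split; first exact: hor_lower_tail.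
move=> zz.
have cvT : cone delta (toR2 R (transpose v)) by case: cv.
have lT : l1norm (toR2 R (transpose v)) = l1norm (toR2 R v) by rewrite /l1norm addrC.
have zT : zeta (toR2 R (transpose v)) = 1 - zeta (toR2 R v).
  have [/= x0 y0 _ _] := cv; rewrite /zeta/= [_ + Num.sqrt v.1%:R]addrC.
  by field; rewrite gt_eqF// addr_gt0// sqrtr_gt0.
have w0' : 0 < 1 - z by lra.
have z1' : 1 - w < 1 by lra.
have := hor_lower_tail hdelta K0 (transposed W) cvT ss _ w0' z1'.
rewrite lT zT => /(_ se); under eq_set do rewrite Ghor_transposed// G_transposed//.
apply; lra.
Qed.
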